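(* Let $w\in S_n$ be a permutation compatible with a sequence of positive integers $a_1<\cdots<a_p$. Put $a_0=0$ and $X_i=\{x_{a_{i-1}+1},\dots,x_{a_i}\}$. Then $$\mathfrak S_w(X)=\sum_\lambda c_\lambda\, s_{\lambda^1}(X_1)\cdots s_{\lambda^p}(X_p),$$ where the sum is over all sequences of partitions $\lambda=(\lambda^1,\dots,\lambda^p)$. Each $c_\lambda$ is a quiver coefficient, equal to the number of sequences of semistandard tableaux $(T_1,\dots,T_p)$ strictly bounded below by $(0,a_1,a_2,\dots,a_{p-1})$, such that the shape of $T_i$ is conjugate to $\lambda^i$ for each $i$ and $\operatorname{col}(T_1)\cdots\operatorname{col}(T_p)$ is a reduced word for $w$.
   Context: Permutations: $S_n\subset S_{n+1}$ via permutations fixing $n+1$; $s_i=(i,i+1)$; products are compositions of functions; $\ell(w)$ is the length; a reduced word for $w$ is $(e_1,\dots,e_\ell)$ with $\ell=\ell(w)$ and $w=s_{e_1}\cdots s_{e_\ell}$. $u\cdot v=w$ means $uv=w$ and $\ell(u)+\ell(v)=\ell(w)$. For $w\in S_n$, $1^m\times w\in S_{n+m}$ is the identity on $\{1,\dots,m\}$ and maps $j$ to $w(j-m)+m$ for $j>m$. $w$ has a descent position at $i$ if $w(i)>w(i+1)$; $w$ and a sequence of integers $a_1<\dots<a_p$ are compatible if all descent positions of $w$ lie in $\{a_1,\dots,a_p\}$. Tableaux: semistandard tableaux have positive integer entries, weakly increasing along rows and strictly increasing down columns; empty tableaux are allowed. $\operatorname{col}(T)$ is the column word: columns are read from bottom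 to top, taken from left to right. A sequence of tableaux $(T_1,\dots,T_r)$ is strictly bounded below by $(k_1,\dots,k_r)$ if the entries of $T_i$ are strictly greater than $k_i$ for each $i$. Schubert polynomials: for the longest element $w_0\in S_n$ set $\mathfrak S_{w_0}(X)=\prod_{i+j\le n}x_i=x_1^{n-1}x_2^{n-2}\cdots x_{n-1}$; if $\ell(ws_i)=\ell(w)+1$ set $\mathfrak S_w(X)=\partial_i\mathfrak S_{ws_i}(X)$, where $\partial_i f=(f-s_if)/(x_i-x_{i+1})$ and $s_i$ exchanges $x_i$ and $x_{i+1}$. $s_\alpha(X_i)$ is the usual Schur polynomial in the variables $X_i$. Quiver coefficients: a quiver coefficient here means an integer of the form $c^{(N)}_{v,\kappa}$ for some $N\ge1$, some $v\in S_{N+1}$ and some sequence of partitions $\kappa=(\kappa^1,\dots,\kappa^{2N-1})$, defined as follows. For sequences $c=(c_1,c_2,\dots)$, $d=(d_1,d_2,\dots)$ and a partition $\alpha$ with $p$ parts put $s_\alpha(c-d)=\det(h_{\alpha_i+j-i})_{p\times p}$ where $\sum_k h_kt^k=\dfrac{1-d_1t+d_2t^2-\cdots}{1-c_1t+c_2t^2-\cdots}$. Let $c_i(j),d_i(j)$ ($1\le i\le j$) be independent variables, $c_0(j)=d_0(j)=1$, $c_i(j)=d_i(j)=0$ if $i<0$ or $i>j$, $c(j)=(c_1(j),c_2(j),\dots)$, $d(j)=(d_1(j),d_2(j),\dots)$. For $v\in S_{N+1}$ write uniquely $\mathfrak S_v(X)=\sum a_{i_1,\dots,i_N}e_{i_1}(x_1)e_{i_2}(x_1,x_2)\cdots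 e_{i_N}(x_1,\dots,x_N)$ ($i_\alpha\le\alpha$, $\sum i_\alpha=\ell(v)$), put $\mathfrak S_v(c)=\sum a_{i_1,\dots,i_N}c_{i_1}(1)\cdots c_{i_N}(N)$ and $\mathfrak S_v(c;d)=\sum_{u\cdot u'=v}(-1)^{\ell(u)}\mathfrak S_{u^{-1}}(d)\mathfrak S_{u'}(c)$. The integers $c^{(N)}_{v,\kappa}$ (zero unless $\sum|\kappa^i|=\ell(v)$) are uniquely characterized by the requirement that for all $m\ge0$ $$\mathfrak S_{1^m\times v}(c;d)=\sum_\kappa c^{(N)}_{v,\kappa}\prod_{i=1}^{N-1}s_{\kappa^i}\big(d(i+1+m)-d(i+m)\big)\, s_{\kappa^N}\big(c(N+m)-d(N+m)\big)\prod_{i=N+1}^{2N-1}s_{\kappa^i}\big(c(2N-i+m)-c(2N-i+1+m)\big).$$ *)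

(* Defs.v *)
From HB Require Import structures.
From mathcomp Require Import all_boot all_order all_fingroup all_algebra.
From mathcomp Require Import mpoly.
From Stdlib Require ClassicalEpsilon.

Set Implicit Arguments.
Unset Strict Implicit.
Unset Printing Implicit Defensive.

Import GRing.Theory.
Local Open Scope ring_scope.

(* Sums over infinite index types are only used when finitely many terms are
   nonzero; [is_fsum F x] says that this is so and that the sum is [x]. *)
Definition is_fsum (I : eqType) (V : nmodType) (F : I -> V) (x : V) : Prop :=
  exists s : seq I,
    [/\ uniq s, forall i, F i != 0 -> i \in s & x = \sum_(i <- s) F i].

Definition has_card (T : eqType) (P : T -> Prop) (k : nat) : Prop :=
  exists s : seq T, [/\ uniq s, forall t, t \in s <-> P t & size s = k].

(* An element of 'S_n acts on 'I_n = {0, .., n - 1}; [pfun] is the action on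
   {1, .., n}, extended to all larger integers by the identity. *)
Definition pfun n (w : 'S_n) (k : nat) : nat :=
  if k is k'.+1 then
    (if insub k' is Some i then (w (i : 'I_n)).+1 else k)
  else 0%N.

(* The library's product (v * u)%g applies v first. *)
Definition pcomp n (u v : 'S_n) : 'S_n := (v * u)%g.

Definition ell n (w : 'S_n) : nat :=
  #|[set ij : 'I_n * 'I_n | (ij.1 < ij.2)%N && (w ij.2 < w ij.1)%N]|.

Definition longest n : 'S_n := perm (@rev_ord_inj n).

Definition compatible n (w : 'S_n) (a : seq nat) : Prop :=
  forall i : nat, (pfun w i.+1 < pfun w i)%N -> i \in a.

Definition shift_fun m n (w : 'S_n) (i : 'I_(m + n)) : 'I_(m + n) :=
  match split i with inl j => lshift n j | inr k => rshift m (w k) end.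

Lemma shift_fun_inj m n (w : 'S_n) : injective (@shift_fun m n w).
Proof.
move=> i j; rewrite /shift_fun.
case: (split_ordP i) => i' ->; case: (split_ordP j) => j' ->.
- by move/lshift_inj=> ->.
- by move/eqP; rewrite eq_lrshift.
- by move/eqP; rewrite eq_rlshift.
- by move/rshift_inj/perm_inj=> ->.
Qed.

(* 1^m x w *)
Definition one_times m n (w : 'S_n) : 'S_(m + n) := perm (@shift_fun_inj m n w).

Definition s_nat (i k : nat) : nat :=
  if k == i then i.+1 else if k == i.+1 then i else k.

Definition word_fun (e : seq nat) : nat -> nat :=
  foldr (fun i f => s_nat i \o f) id e.

Definition reduced_word n (w : 'S_n) (e : seq nat) : Prop :=
  [/\ all (leq 1) e, size e = ell w & pfun w =1 word_fun e].

Definition is_part (s : seq nat) : bool := sorted geq s && (0%N \notin s).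

Record intpart := IntPart { parts :> seq nat; partsP : is_part parts }.
HB.instance Definition _ := [isSub for parts].
HB.instance Definition _ := [Choice of intpart by <:].

Definition part0 : intpart := @IntPart [::] isT.

Definition conj_part (s : seq nat) : seq nat :=
  [seq count (fun r => (j < r)%N) s | j <- iota 0 (head 0%N s)].

(* A tableau is the list of its rows, from top to bottom. *)
Definition tableau := seq (seq nat).

Definition above_row (r r' : seq nat) : bool :=
  all (fun j => (nth 0%N r j < nth 0%N r' j)%N) (iota 0 (size r')).

Definition is_ssyt (T : tableau) : bool :=
  [&& is_part (shape T), all (all (leq 1)) T, all (sorted leq) T
    & sorted above_row T].

Definition tab_col (T : tableau) (j : nat) : seq nat :=
  [seq nth 0%N r j | r <- T & (j < size r)%N].

Definition col_word (T : tableau) : seq nat :=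
  flatten [seq rev (tab_col T j) | j <- iota 0 (size (head [::] T))].

Definition strictly_bounded_below (T : tableau) (k : nat) : bool :=
  all (all (ltn k)) T.

Definition words (A : seq nat) (k : nat) : seq (seq nat) :=
  iter k (fun W => [seq x :: u | x <- A, u <- W]) [:: [::]].

Definition fillings (A : seq nat) (sh : seq nat) : seq tableau :=
  foldr (fun k F => [seq r :: T | r <- words A k, T <- F]) [:: [::]] sh.

(* The variable x_i of Z[x_1, .., x_M]; 'X_k is x_(k + 1). *)
Definition xvar M (i : nat) : {mpoly int[M]} :=
  if i is k.+1 then (if insub k is Some j then 'X_(j : 'I_M) else 0) else 0.

(* s_alpha(x_(b+1), .., x_b') *)
Definition schur M (b b' : nat) (alpha : seq nat) : {mpoly int[M]} :=
  \sum_(T <- fillings (iota b.+1 (b' - b)%N) alpha | is_ssyt T)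
     \prod_(r <- T) \prod_(x <- r) xvar M x.

Lemma ddiff_exists n (i j : 'I_n) (f : {mpoly int[n]}) :
  exists g, g * ('X_i - 'X_j) == f - msym (tperm i j) f.
Proof.
pose P (f : {mpoly int[n]}) :=
  exists g, g * ('X_i - 'X_j) == f - msym (tperm i j) f.
have PD f1 f2 : P f1 -> P f2 -> P (f1 + f2).
  move=> [g1 /eqP h1] [g2 /eqP h2]; exists (g1 + g2).
  by rewrite mulrDl h1 h2 msymD opprD addrACA.
have PM f1 f2 : P f1 -> P f2 -> P (f1 * f2).
  move=> [g1 /eqP h1] [g2 /eqP h2].
  exists (f1 * g2 + g1 * msym (tperm i j) f2).
  rewrite mulrDl -mulrA h2 mulrAC h1 msymM mulrBr mulrBl addrA.
  by rewrite subrK.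
have P1 : P 1 by exists 0; rewrite mul0r msym1 subrr.
have PZ c f1 : P f1 -> P (c *: f1).
  by move=> [g /eqP h]; exists (c *: g); rewrite -scalerAl h msymZ scalerBr.
have PX k : P 'X_k.
  rewrite /P msymX.
  have -> : [multinom (U_(k)%MM : 'X_{1..n}) ((tperm i j)^-1%g l) | l < n]
            = U_(tperm i j k)%MM.
    apply/mnmP=> l; rewrite mnmE !mnm1E tpermV.
    by rewrite (can2_eq (tpermK i j) (tpermK i j)).
  case: tpermP => [->|->|_ _]; [exists 1|exists (-1)|exists 0].
  - by rewrite mul1r.
  - by rewrite mulN1r opprB.
  - by rewrite mul0r subrr.
rewrite (mpolyE f); apply: (big_ind P) => //.
  by exists 0; rewrite mul0r msym0 subrr.
move=> m _; apply: (PZ).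
rewrite mpolyXE_id; apply: (big_ind P) => // k _.
by elim: (m k) => [|e IH]; rewrite ?expr0 // exprS; apply: PM.
Qed.

(* (f - s f) / (x_i - x_j) with s exchanging x_i and x_j, for i != j *)
Definition ddiff n (i j : 'I_n) (f : {mpoly int[n]}) : {mpoly int[n]} :=
  xchoose (ddiff_exists i j f).

Lemma ddiffP n (i j : 'I_n) (f : {mpoly int[n]}) :
  ddiff i j f * ('X_i - 'X_j) = f - msym (tperm i j) f.
Proof. exact/eqP/(xchooseP (ddiff_exists i j f)). Qed.

(* Pairs (i, i + 1) at which w s_i is longer than w. *)
Definition is_ascent n (w : 'S_n) (ij : 'I_n * 'I_n) : bool :=
  (ij.2 == ij.1.+1 :> nat)
  && (ell (pcomp w (tperm ij.1 ij.2)) == (ell w).+1).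

(* The descending recursion from the longest element.  The polynomial does not
   depend on the ascents that are picked, since the operators satisfy the braid
   relations; ell (longest n) steps always reach the longest element. *)
Fixpoint schubert_rec (k n : nat) (w : 'S_n) : {mpoly int[n]} :=
  match k, [pick ij | is_ascent w ij] with
  | k'.+1, Some ij =>
      ddiff ij.1 ij.2 (schubert_rec k' (pcomp w (tperm ij.1 ij.2)))
  | _, _ => \prod_(i < n) 'X_i ^+ (n - i.+1)%N
  end.

Definition schubert n (w : 'S_n) : {mpoly int[n]} :=
  schubert_rec (ell (longest n)) w.

Definition schubertX M n (w : 'S_n) : {mpoly int[M]} :=
  schubert w \mPo [tuple xvar M i.+1 | i < n].

(* e_k(x_1, .., x_r) *)
Definition elem n (r k : nat) : {mpoly int[n]} :=
  \sum_(h : {set 'I_n} | (#|h| == k) && [forall i in h, (i < r)%N])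
     \prod_(i in h) 'X_i.

(* Exponent sequences (i_1, .., i_N) for S_(N + 1), here with n = N + 1; the
   index alpha : 'I_n.-1 stands for alpha + 1. *)
Definition elem_index n := {ffun 'I_n.-1 -> 'I_n}.

Definition elem_admissible n (v : 'S_n) (I : elem_index n) : bool :=
  [forall al : 'I_n.-1, (I al <= al.+1)%N] && (\sum_(al < n.-1) I al == ell v)%N.

Definition elem_expansion n (v : 'S_n) (a : elem_index n -> int) : Prop :=
  schubert v =
    \sum_(I | elem_admissible v I) a I *: \prod_(al < n.-1) elem n al.+1 (I al).

(* The coefficients of the expansion, which exists and is unique. *)
Definition elem_coef n (v : 'S_n) : elem_index n -> int :=
  ClassicalEpsilon.epsilon (inhabits (fun=> 0)) (elem_expansion v).

(* In what follows c j i stands for c_i(j), and d j i for d_i(j). *)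
Definition univ_schubert (R : comNzRingType) (c : nat -> nat -> R) n
    (v : 'S_n) : R :=
  \sum_(I | elem_admissible v I) (elem_coef v I)%:~R * \prod_(al < n.-1) c al.+1 (I al).

Definition univ_double_schubert (R : comNzRingType) (c d : nat -> nat -> R) n
    (v : 'S_n) : R :=
  \sum_(uu : 'S_n * 'S_n
         | (pcomp uu.1 uu.2 == v) && (ell uu.1 + ell uu.2 == ell v)%N)
    (-1) ^+ ell uu.1 * univ_schubert d (uu.1^-1)%g * univ_schubert c uu.2.

(* The first k coefficients of
   (1 - d_1 t + d_2 t^2 - ..) / (1 - c_1 t + c_2 t^2 - ..). *)
Fixpoint hseries (R : comNzRingType) (c d : nat -> R) (k : nat) : seq R :=
  if k is k'.+1 then
    let s := hseries c d k' in
    rcons s ((-1) ^+ k' * (if k' is 0 then 1 else d k')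
             - \sum_(1 <= i < k'.+1) (-1) ^+ i * c i * s`_(k' - i))
  else [::].

Definition hcoef (R : comNzRingType) (c d : nat -> R) (k : nat) : R :=
  (hseries c d k.+1)`_k.

Lemma size_hseries (R : comNzRingType) (c d : nat -> R) k :
  size (hseries c d k) = k.
Proof. by elim: k => //= k IH; rewrite size_rcons IH. Qed.

Lemma nth_hseries (R : comNzRingType) (c d : nat -> R) k i :
  (i < k)%N -> (hseries c d k)`_i = hcoef c d i.
Proof.
elim: k => // k IH; rewrite ltnS leq_eqVlt => /predU1P[-> //|ik] /=.
by rewrite nth_rcons size_hseries ik IH.
Qed.

Lemma hcoefP (R : comNzRingType) (c d : nat -> R) (k : nat) :
  c 0%N = 1 -> d 0%N = 1 ->
  \sum_(0 <= i < k.+1) ((-1) ^+ i * c i) * hcoef c d (k - i)%N = (-1) ^+ k * d k.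
Proof.
move=> c0 d0; rewrite big_nat_recl // c0 expr0 !mul1r subn0.
rewrite {1}/hcoef /= nth_rcons size_hseries ltnn eqxx.
have -> : (if k is 0 then 1 else d k) = d k by case: k.
rewrite big_add1 /= [X in _ - X]big_nat_cond [X in _ + X]big_nat_cond.
rewrite -addrA [X in _ + X](_ : _ = 0) ?addr0 //.
apply/eqP; rewrite addrC subr_eq0; apply/eqP; apply: eq_bigr => i.
rewrite andbT => /andP[_ ik]; rewrite nth_hseries // ltn_subrL.
by rewrite (leq_trans _ ik).
Qed.

(* s_alpha(c - d), with h_k = 0 for k < 0 *)
Definition schur_diff (R : comNzRingType) (c d : nat -> R) (alpha : seq nat) :
    R :=
  \det (\matrix_(i < size alpha, j < size alpha)
          if (i <= nth 0%N alpha i + j)%N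
          then hcoef c d (nth 0%N alpha i + j - i) else 0).

(* Variables for all c_i(j), d_i(j) with i, j <= L (those with 1 <= i <= j are
   used); true marks c and false marks d. *)
Definition cd_index (L : nat) : finType := (bool * 'I_L.+1 * 'I_L.+1)%type.
Definition cd_ring (L : nat) : comNzRingType := {mpoly int[#|cd_index L|]}.

Definition cd_var (L : nat) (b : bool) (j i : nat) : cd_ring L :=
  if i == 0%N then 1
  else if (i <= j)%N
  then 'X_(enum_rank ((b, inord j, inord i) : cd_index L))
  else 0.

(* Position i of the sequence (kappa^1, .., kappa^(2N-1)) is counted from 1. *)
Definition quiver_term (N m : nat) (kappa : seq intpart) : cd_ring (N + m) :=
  let c := cd_var (N + m) true in
  let d := cd_var (N + m) false in
  let k i := nth part0 kappa i.-1 in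
  (\prod_(1 <= i < N) schur_diff (d (i + 1 + m)%N) (d (i + m)%N) (k i))
  * schur_diff (c (N + m)%N) (d (N + m)%N) (k N)
  * \prod_(N.+1 <= i < (2 * N)%N)
      schur_diff (c (2 * N - i + m)%N) (c (2 * N - i + 1 + m)%N) (k i).

(* C is the family (c^(N)_(v, kappa))_kappa. *)
Definition quiver_family (N : nat) (v : 'S_N.+1)
    (C : (2 * N - 1).-tuple intpart -> int) : Prop :=
  (forall kappa : (2 * N - 1).-tuple intpart,
     (\sum_(k <- kappa) sumn (parts k))%N != ell v -> C kappa = 0)
  /\ forall m : nat,
       is_fsum (fun kappa : (2 * N - 1).-tuple intpart =>
                  (C kappa)%:~R * quiver_term N m kappa)
         (univ_double_schubert (cd_var (N + m) true) (cd_var (N + m) false)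
            (one_times m v)).

Definition quiver_coefficient (z : int) : Prop :=
  exists (N : nat) (v : 'S_N.+1) (kappa : (2 * N - 1).-tuple intpart)
         (C : (2 * N - 1).-tuple intpart -> int),
    [/\ (1 <= N)%N, quiver_family v C & z = C kappa].

(* a_0 = 0, and a_i is the i-th element of a *)
Definition bound (a : seq nat) (i : nat) : nat := nth 0%N (0%N :: a) i.

(* The sequences (T_1, .., T_p) counted by c_lambda; i : 'I_p stands for
   i + 1. *)
Definition counted_tableaux n (w : 'S_n) p (a : p.-tuple nat)
    (lam : p.-tuple intpart) (T : p.-tuple tableau) : Prop :=
  [/\ forall i : 'I_p, is_ssyt (tnth T i),
      forall i : 'I_p, strictly_bounded_below (tnth T i) (bound a i),
      forall i : 'I_p, shape (tnth T i) = conj_part (tnth lam i)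
    & reduced_word w (flatten [seq col_word t | t <- T])].

(* Main.v *)
(** In the nilCoxeter algebra, whose basis elements multiply as permutations when
lengths add and to zero otherwise, put A_i(x) = (1 + x u_(n-1)) .. (1 + x u_i).
By Fomin and Stanley, S_w is the coefficient of w in A_1(x_1) A_2(x_2) ...

Replacing A_i(x_i) by A_(b+1)(x_i) for i in a block b < i <= b' only multiplies the
whole product on the right by factors 1 + z u_j with j not among the a_i. If w is
compatible with a, such a factor does not change the coefficient of w. In a block
all factors are A_(b+1)(x_(b+1)) A_(b+1)(x_(b+2)) .., with commuting factors.
Multiplying by the Vandermonde determinant and expanding, a sign-reversing
involution (reflection) cancels all terms except those of semistandard columns,
giving the sum over tableaux T with entries > b of the alternant of the shape
conjugate to T times the word col(T). Dividing by the Vandermonde turns the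
alternants into Schur polynomials, and the coefficient of w selects the reduced
words of w.

The coefficients are natural numbers, and every natural number is a quiver
coefficient. *)

Require Import Defs.
From mathcomp Require Import all_boot all_order all_fingroup all_algebra.
From mathcomp Require Import mpoly zify ring.

Set Implicit Arguments.
Unset Strict Implicit.
Unset Printing Implicit Defensive.
Import GRing.Theory.
Local Open Scope ring_scope.

(** Three obstacles lie behind the outline. First, [schubert] descends through arbitrarily picked
    ascents. The Fomin-Stanley product satisfies the same divided difference relation, its
    coefficient at the longest element is the staircase monomial up to an unknown factor 0 or 1, and
    the coefficient 1 at the identity excludes 0. The nilCoxeter algebra is realized by matrices,
    its right regular representation, so that its relations become equalities of permutations.
    Second, the elementary expansion behind a quiver coefficient is chosen by [epsilon]. It can be
    computed only once products of elementary symmetric polynomials are known to be independent.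
    Quiver families are then found for products of commuting transpositions, where everything
    factors over the letters. Third, a reduced word may a priori use any positive letter and lambda
    any partitions, while the expansion yields only letters below n and at most as many rows as a
    block has variables. Reduced words are shown to stay in the group, and Schur polynomials with
    too many rows vanish, although their coefficients may be nonzero. *)

Local Notation pcomp := Defs.pcomp.

(** * Factors of the Fomin-Stanley product *)

Section NilCoxeter.

Context (R : comNzRingType) (B : algType R) (u : nat -> B).
Hypothesis u_nil : forall i, u i * u i = 0.
Hypothesis u_far : forall i j, (i.+1 < j)%N -> u i * u j = u j * u i.
Hypothesis u_braid : forall i, u i * u i.+1 * u i = u i.+1 * u i * u i.+1.

Definition hfac (i : nat) (x : R) : B := 1 + x *: u i.

(** The letters run down from i + d - 1 to i. Counting letters rather than naming the top one lets
    induction on [d] split off the smallest letter on the right. *)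
Fixpoint afac (d i : nat) (x : R) : B :=
  if d is d'.+1 then afac d' i.+1 x * hfac i x else 1.

Lemma hfac_hfac i x y : hfac i x * hfac i y = hfac i (x + y).
Proof.
rewrite /hfac mulrDl !mulrDr !mul1r mulr1 -scalerAl -scalerAr u_nil !scaler0.
by rewrite addr0 scalerDl -addrA [y *: _ + _]addrC.
Qed.

Lemma hfac_inv i x : hfac i x * hfac i (- x) = 1.
Proof. by rewrite hfac_hfac subrr /hfac scale0r addr0. Qed.

(** The terms are grouped so that the two sides of the Yang-Baxter equation compare group by group;
    [a * c] stands alone because it vanishes there. *)
Lemma mul3_1D (a b c : B) : (1 + a) * (1 + b) * (1 + c) =
  1 + ((a + c) + b) + (a * b + b * c) + a * c + a * b * c.
Proof.
rewrite !mulrDl !mulrDr !mul1r !mulr1.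
by rewrite ![(_ + _) * c]mulrDl mul1r !addrA (ACl (1*5*3*2*6*4*7*8)).
Qed.

(** The outer letters coincide, so their product dies by [u_nil]; the middle parameter x + y
    balances the linear terms, and the cubic terms agree by the braid relation. *)
Lemma yang_baxter i x y :
  hfac i x * hfac i.+1 (x + y) * hfac i y =
  hfac i.+1 y * hfac i (x + y) * hfac i.+1 x.
Proof.
rewrite /hfac !mul3_1D -?scalerAr -?scalerAl -?scalerAr -?scalerAl.
rewrite !u_nil u_braid !scaler0 !addr0 !scalerA.
congr (_ + _ + _ + _); last by congr (_ *: _); ring.
  by rewrite -!scalerDl addrC [y + x]addrC.
by rewrite addrC [y * _]mulrC [_ * x]mulrC.
Qed.

Lemma u_afac d i j y : (i.+1 < j)%N -> u i * afac d j y = afac d j y * u i.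
Proof.
elim: d j => [|d IH] j ij /=; first by rewrite mulr1 mul1r.
rewrite mulrA IH 1?ltnW // -!mulrA; congr (_ * _).
by rewrite /hfac mulrDl mulrDr mul1r mulr1 -scalerAl -scalerAr u_far.
Qed.

Lemma hfac_afac d i j x y : (i.+1 < j)%N ->
  hfac i x * afac d j y = afac d j y * hfac i x.
Proof.
by move=> ij; rewrite /hfac mulrDl mulrDr mul1r mulr1 -scalerAl -scalerAr u_afac.
Qed.

(** By induction the factors commute once the smallest letter i is removed. Since [hfac i] passes
    everything from i + 2 on, only the letters i and i + 1 interact, and they are reordered by
    Yang-Baxter. *)
Lemma afacC d i x y : afac d i x * afac d i y = afac d i y * afac d i x.
Proof.
elim: d i x y => [|d IH] i x y //=.
case: d IH => [|d] IH /=; first by rewrite !mul1r !hfac_hfac addrC.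
(* The induction hypothesis times [hfac i.+1 (- y)] on the right: the leftover parameter x - y is
   what Yang-Baxter needs next to [hfac i x]. *)
have key : afac d i.+2 x * hfac i.+1 x * afac d i.+2 y =
    afac d i.+2 y * hfac i.+1 y * afac d i.+2 x * hfac i.+1 (x - y).
  have := IH i.+1 x y; rewrite /= => E.
  rewrite -[LHS]mulr1 -(hfac_inv i.+1 y) mulrA -[X in X * _]mulrA E.
  by rewrite -!mulrA hfac_hfac.
have yb : hfac i.+1 (x - y) * hfac i x * hfac i.+1 y =
          hfac i y * hfac i.+1 x * hfac i (x - y).
  by have := yang_baxter i y (x - y); rewrite addrC subrK => ->.
transitivity (afac d i.+2 x * hfac i.+1 x * afac d i.+2 y *
              (hfac i x * hfac i.+1 y * hfac i y)).
  by rewrite -!mulrA; congr (_ * (_ * _)); rewrite mulrA hfac_afac // !mulrA.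
rewrite key -!mulrA; congr (_ * (_ * _)).
transitivity (afac d i.+2 x *
  (hfac i.+1 (x - y) * hfac i x * hfac i.+1 y) * hfac i y); first by rewrite !mulrA.
rewrite yb -!mulrA hfac_hfac subrK [LHS]mulrA -hfac_afac ?mulrA //.
Qed.

(** Pairs are (parameter, letter). Later arguments use only which letters occur, or the product or
    partial sums of the parameters. *)
Definition hprod (l : seq (R * nat)) : B := \prod_(p <- l) hfac p.2 p.1.

Lemma hprod_cat l l' : hprod (l ++ l') = hprod l * hprod l'.
Proof. exact: big_cat. Qed.

Lemma hprod1 p : hprod [:: p] = hfac p.2 p.1.
Proof. by rewrite /hprod big_seq1. Qed.

Lemma afac_hprod d i x : exists2 l, afac d i x = hprod l &
  all (fun p => i <= p.2 < i + d)%N l.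
Proof.
elim: d i => [|d IH] i /=; first by exists [::] => //; rewrite /hprod big_nil.
have [l -> hl] := IH i.+1; exists (l ++ [:: (x, i)]).
  by rewrite hprod_cat hprod1.
rewrite all_cat /= leqnn -[X in (X < _)%N]addn0 ltn_add2l !andbT.
by apply: sub_all hl => p; lia.
Qed.

Lemma hprod_comm l (X : B) :
  {in l, forall p, hfac p.2 p.1 * X = X * hfac p.2 p.1} ->
  hprod l * X = X * hprod l.
Proof.
move=> H; rewrite /hprod big_seq.
apply: (big_ind (fun Y => Y * X = X * Y)) => [|a b ha hb|p /H //].
  by rewrite mul1r mulr1.
by rewrite -mulrA hb mulrA ha mulrA.
Qed.

(* The Fomin-Stanley factor A_i(x) = (1 + x u_(n-1)) .. (1 + x u_i). *)
Definition afrom n i (x : R) : B := afac (n - i) i x.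

Lemma afrom_far n i j x y : (i.+1 < j)%N ->
  hfac i x * afrom n j y = afrom n j y * hfac i x.
Proof. exact: hfac_afac. Qed.

Lemma afromC n i x y : afrom n i x * afrom n i y = afrom n i y * afrom n i x.
Proof. exact: afacC. Qed.

Lemma afrom_ge n i x : (n <= i)%N -> afrom n i x = 1.
Proof. by rewrite /afrom -subn_eq0 => /eqP->. Qed.

Lemma afromS n i x : (i < n)%N -> afrom n i x = afrom n i.+1 x * hfac i x.
Proof. by rewrite /afrom => ni; rewrite -subnSK. Qed.

Lemma afrom_drop n b r x : exists2 l,
  afrom n b x = afrom n (b + r) x * hprod l &
  all (fun p => b <= p.2 < b + r)%N l.
Proof.
elim: r => [|r [l IH hl]].
  by exists [::] => //; rewrite /hprod big_nil mulr1 addn0.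
case: (leqP n (b + r)) => nbr.
  exists l; last by apply: sub_all hl => p; lia.
  by rewrite IH !afrom_ge //; lia.
exists ((x, b + r)%N :: l); last first.
  by rewrite /= ltn_add2l ltnSn leq_addr; apply: sub_all hl => p; lia.
by rewrite IH afromS // addnS /hprod big_cons mulrA.
Qed.

(* Replacing A_(b+1) by A_(b+i) in the i-th factor of a block only costs letters
   b < j < b + r on the right: these commute with the factors they cross. *)
Lemma block_staircase n b r (x : nat -> R) : exists2 l,
  \prod_(b.+1 <= i < (b + r).+1) afrom n b.+1 (x i) =
  \prod_(b.+1 <= i < (b + r).+1) afrom n i (x i) * hprod l &
  all (fun p => b < p.2 < b + r)%N l.
Proof.
elim: r => [|r [l IH hl]].
  by exists [::] => //; rewrite addn0 !big_geq // /hprod big_nil mulr1.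
have [l' E hl'] := afrom_drop n b.+1 r (x (b + r).+1).
exists (l ++ l'); last first.
  by rewrite all_cat; apply/andP; split; [apply: sub_all hl|apply: sub_all hl'] => p; lia.
rewrite addnS !(@big_nat_recr _ _ _ (b + r).+1) ?ltnS ?leq_addr //= IH E.
rewrite hprod_cat -!mulrA; congr (_ * _); rewrite !mulrA; congr (_ * _).
rewrite addSn; apply: hprod_comm => p /(allP hl) hp; apply: afrom_far; lia.
Qed.

Fixpoint block_prod n (x : nat -> R) (b : nat) (a : seq nat) : B :=
  if a is c :: a' then
    \prod_(b.+1 <= i < c.+1) afrom n b.+1 (x i) * block_prod n x c a'
  else 1.

Lemma block_prod_staircase n x b a : path ltn b a -> exists2 l,
  block_prod n x b a =
  \prod_(b.+1 <= i < (last b a).+1) afrom n i (x i) * hprod l &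
  all (fun p => (b < p.2 < last b a)%N && (p.2 \notin a)) l.
Proof.
elim: a b => [|c a IH] b /=.
  by exists [::] => //; rewrite big_geq // /hprod big_nil mulr1.
move=> /andP[bc hpath]; have [l E hl] := IH c hpath.
have hmin : all (ltn c) a := order_path_min ltn_trans hpath.
have hlast : (c <= last c a)%N.
  by case: (lastP a) hmin => // s z; rewrite all_rcons last_rcons => /andP[/ltnW].
have [l' E' hl'] := block_staircase n b (c - b) x.
rewrite (subnKC (ltnW bc)) in E' hl'.
exists (l' ++ l).
  rewrite E E' hprod_cat (@big_cat_nat _ _ _ c.+1 b.+1 (last c a).+1) //=; last exact: ltnW.
  rewrite -!mulrA; congr (_ * _); rewrite !mulrA; congr (_ * _).
  apply: hprod_comm => p /(allP hl') hp.
  rewrite big_nat_cond; apply: (big_ind (fun Y => _ * Y = Y * _)).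
  - by rewrite mulr1 mul1r.
  - by move=> X Y hX hY; rewrite mulrA hX -mulrA hY mulrA.
  - by move=> i; rewrite andbT => hi; apply: afrom_far; lia.
rewrite all_cat; apply/andP; split.
  apply: sub_all hl' => p hp; rewrite inE negb_or; apply/andP; split; first by lia.
  apply/andP; split; first by lia.
  by apply/negP => /(allP hmin) /=; lia.
by apply: sub_all hl => p /andP[hp hpa]; rewrite inE negb_or hpa; lia.
Qed.

End NilCoxeter.

(** * Permutations and reduced words *)

Lemma s_natK k : involutive (s_nat k).
Proof. by move=> i; rewrite /s_nat; do ?case: eqP; lia. Qed.

Lemma s_nat_leq k m i : k != m -> (s_nat k i <= m)%N = (i <= m)%N.
Proof. by rewrite /s_nat; do ?case: eqP; lia. Qed.

Lemma word_fun_cat e e' i : word_fun (e ++ e') i = word_fun e (word_fun e' i).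
Proof. by elim: e => //= k e ->. Qed.

(** Among the generators only s_m moves a number across the gap between m and m + 1; this serves as
    a test for the presence of a letter. *)
Lemma word_fun_leq m e i : m \notin e -> (word_fun e i <= m)%N = (i <= m)%N.
Proof.
elim: e => //= k e IH; rewrite inE negb_or eq_sym => /andP[km me].
by rewrite s_nat_leq // IH.
Qed.

(* Positions are 1-based, hence the shifts. *)
Definition invn L (f : nat -> nat) : nat :=
  (\sum_(i < L) \sum_(j < L) ((i < j) && (f j.+1 < f i.+1)))%N.

Lemma eq_invn L f g : f =1 g -> invn L f = invn L g.
Proof. by move=> E; apply: eq_bigr => i _; apply: eq_bigr => j _; rewrite !E. Qed.

(** Reindexing by s_k keeps the order of every pair of positions other than k, k + 1, which
    contributes the two booleans. The additive form avoids truncated subtraction and covers f k = f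
    (k + 1), so injectivity is not assumed. *)
Lemma invn_s_nat L f k : (0 < k < L)%N ->
  (invn L (f \o s_nat k) + (f k.+1 < f k) = invn L f + (f k < f k.+1))%N.
Proof.
move=> kL; have aL : (k.-1 < L)%N by lia.
have bL : (k < L)%N by lia.
pose a := Ordinal aL; pose b := Ordinal bL; pose s := tperm a b.
have ab : a != b by rewrite -val_eqE /=; lia.
have sE (i : 'I_L) : s_nat k i.+1 = (s i).+1.
  rewrite /s; case: tpermP => [->|->|/eqP + /eqP]; rewrite /s_nat /=.
  - by do ?case: eqP; lia.
  - by do ?case: eqP; lia.
  - by rewrite -!val_eqE /=; do ?case: eqP; lia.
have -> : invn L (f \o s_nat k) =
    (\sum_(p : 'I_L * 'I_L) ((s p.1 < s p.2) && (f p.2.+1 < f p.1.+1)))%N.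
  rewrite /invn pair_bigA /= [RHS](reindex_inj (h := fun p => (s p.1, s p.2))) /=.
    by apply: eq_bigr => p _; rewrite !sE /s !tpermK.
  by move=> [i j] [i' j'] /= [/perm_inj-> /perm_inj->].
rewrite /invn pair_bigA /=.
rewrite (bigD1 (a, b)) //= (bigD1 (b, a)) /=; last by rewrite xpair_eqE eq_sym (negbTE ab).
rewrite [in RHS](bigD1 (a, b)) //= [in RHS](bigD1 (b, a)) /=; last first.
  by rewrite xpair_eqE eq_sym (negbTE ab).
rewrite /s tpermL tpermR.
have -> : (\sum_(i | (i != (a, b)) && (i != (b, a)))
  ((tperm a b i.1 < tperm a b i.2) && (f i.2.+1 < f i.1.+1)) =
  \sum_(i | (i != (a, b)) && (i != (b, a))) ((i.1 < i.2) && (f i.2.+1 < f i.1.+1)))%N.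
  apply: eq_bigr => -[i j] /=; rewrite !xpair_eqE !negb_and => /andP[h1 h2].
  congr (nat_of_bool (_ && _)).
  have [va vb] : a = k.-1 :> nat /\ b = k :> nat by [].
  move: h1 h2; rewrite -!val_eqE /= -/(nat_of_ord a) -/(nat_of_ord b).
  case: tpermP => [->|->|/eqP + /eqP]; case: tpermP => [->|->|/eqP + /eqP];
     rewrite -?(inj_eq (@ord_inj L)) ?va ?vb; lia.
have -> : (k.-1.+1 = k)%N by lia.
by rewrite /=; lia.
Qed.

Section Perm.
Variable n : nat.
Implicit Types u v w : 'S_n.

Arguments pfun : simpl never.

Lemma pfunS w (i : 'I_n) : pfun w i.+1 = (w i).+1.
Proof. by rewrite /pfun valK. Qed.

Lemma pfun_gt w k : (n < k)%N -> pfun w k = k.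
Proof. by case: k => //= k nk; rewrite /pfun insubN // -leqNgt. Qed.

Lemma pfun_leq w k m : (n <= m)%N -> (pfun w k <= m)%N = (k <= m)%N.
Proof.
move=> nm; case: k => // k; case: (ltnP k n) => kn; last by rewrite pfun_gt.
by rewrite (pfunS w (Ordinal kn)) /= !(leq_trans _ nm).
Qed.

Lemma pfun_comp u v : pfun (pcomp u v) =1 pfun u \o pfun v.
Proof.
move=> [//|k] /=; case: (ltnP k n) => kn; last by rewrite !pfun_gt.
by rewrite !(pfunS _ (Ordinal kn)) pfunS permM.
Qed.

Lemma pfun1 : pfun (1%g : 'S_n) =1 id.
Proof. by move=> [//|k] /=; rewrite /pfun; case: insubP => [i _ <-|//]; rewrite perm1. Qed.

Lemma pfun_inj u v : pfun u =1 pfun v -> u = v.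
Proof. by move=> E; apply/permP => i; apply/val_inj; move: (E i.+1); rewrite !pfunS => -[]. Qed.

Lemma pfun_injective w : injective (pfun w).
Proof.
apply: (can_inj (g := pfun w^-1)) => k.
by have := pfun_comp w^-1 w k; rewrite /pcomp mulgV pfun1.
Qed.

(** Letters are 1-based; any letter outside 1, .., n - 1 gives the identity, including 0, where both
    indices coincide. The nilCoxeter generator of such a letter is then 0, so the relations hold for
    all letters without bounds. *)
Definition sref k : 'S_n :=
  if insub k.-1 is Some i then if insub k is Some j then tperm i j else 1%g
  else 1%g.

Lemma sref_out k : ~~ (0 < k < n)%N -> sref k = 1%g.
Proof.
rewrite /sref; case: k => [|k] /=; first by case: insubP => // *; rewrite tperm1.
move=> nk; case: insubP => // i _ _; case: insubP => // j; lia.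
Qed.

Lemma pfun_sref k : (0 < k < n)%N -> pfun (sref k) =1 s_nat k.
Proof.
rewrite /sref; case: k => // k kn [|i]; first by rewrite /s_nat.
rewrite /s_nat /pfun /=; case: insubP => [c _ cE|ni]; last by move: ni; do ?case: eqP; lia.
have {cE} cE : c = i :> nat := cE.
case: insubP => [a _ aE|h]; last by exfalso; move: h kn => /=; lia.
case: insubP => [b _ bE|h]; last by exfalso; move: h kn => /=; lia.
have {aE} aE : a = k :> nat := aE; have {bE} bE : b = k.+1 :> nat := bE.
case: tpermP => [E|E|/eqP + /eqP].
- by move: cE; rewrite E; do ?case: eqP; lia.
- by move: cE; rewrite E; do ?case: eqP; lia.
- by rewrite -!(inj_eq (@ord_inj n)); do ?case: eqP; lia.
Qed.

Lemma srefK k : pcomp (sref k) (sref k) = 1%g.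
Proof.
case: (boolP (0 < k < n)%N) => kn; last by rewrite sref_out // /pcomp mulg1.
apply: pfun_inj => i; rewrite pfun_comp /= !pfun_sref // s_natK pfun1 //.
Qed.

Lemma pcompA u v w : pcomp u (pcomp v w) = pcomp (pcomp u v) w.
Proof. by rewrite /pcomp mulgA. Qed.

Lemma pcomp_srefK w k : pcomp (pcomp w (sref k)) (sref k) = w.
Proof. by rewrite -pcompA srefK /pcomp mul1g. Qed.

Lemma tperm_sref (i j : 'I_n) : j = i.+1 :> nat -> tperm i j = sref j.
Proof.
by move=> E; rewrite /sref E /= valK -E valK.
Qed.

Lemma ell_invn w : ell w = invn n (pfun w).
Proof.
rewrite /ell -sum1_card /invn pair_bigA /= big_mkcond /=.
by apply: eq_bigr => p _; rewrite inE !pfunS ltnS; case: ifP.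
Qed.

(** Positions above n are fixed and create no inversions. The larger window allows a comparison with
    words whose letters are not yet known to be below n. *)
Lemma invn_widen w L : (n <= L)%N -> invn L (pfun w) = ell w.
Proof.
move=> nL; rewrite ell_invn /invn.
pose F i j : nat := (i < j)%N && (pfun w j.+1 < pfun w i.+1)%N.
rewrite -!/(F _ _) [RHS](big_ord_widen L (fun i => \sum_(j < n) F i j)%N) //.
rewrite [RHS]big_mkcond; apply: eq_bigr => i _; case: (ltnP i n) => iL.
  rewrite [RHS](big_ord_widen L (F i)) //.
  rewrite [RHS]big_mkcond; apply: eq_bigr => j _; case: (ltnP j n) => // jn.
  have hi : (pfun w i.+1 <= n)%N by rewrite pfun_leq.
  by rewrite /F (@pfun_gt w j.+1) //; lia.
rewrite big1 // => j _; rewrite /F; case: ltnP => //= ij.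
by rewrite !pfun_gt //; lia.
Qed.

Lemma ell_sref w k : (0 < k < n)%N ->
  (ell (pcomp w (sref k)) + (pfun w k.+1 < pfun w k) =
   ell w + (pfun w k < pfun w k.+1))%N.
Proof.
move=> kn; rewrite !ell_invn -(invn_s_nat _ kn); congr (_ + _)%N; apply: eq_invn => i.
by rewrite pfun_comp /= pfun_sref.
Qed.

Definition descent w k := [&& 0 < k, k < n & pfun w k.+1 < pfun w k]%N.

Lemma descent_ell w k :
  descent w k = ((0 < k < n)%N && (ell w == (ell (pcomp w (sref k))).+1)).
Proof.
rewrite /descent; case: (boolP (0 < k < n)%N) => [kn|]; last by case: (0 < k)%N => //= /negbTE->.
have /andP[-> ->] /= := kn.
have := ell_sref w kn; have := @pfun_injective w k k.+1; lia.
Qed.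

Lemma ascent_ell w k : (0 < k < n)%N ->
  ~~ descent w k = (ell (pcomp w (sref k)) == (ell w).+1).
Proof.
rewrite /descent => kn; have /andP[-> ->] /= := kn.
have := ell_sref w kn; have := @pfun_injective w k k.+1; lia.
Qed.

Lemma ell_sref_leq w k : (ell (pcomp w (sref k)) <= (ell w).+1)%N.
Proof.
case: (boolP (0 < k < n)%N) => kn; last by rewrite sref_out // /pcomp mul1g.
have := ell_sref w kn; lia.
Qed.

Lemma ell1 : ell (1%g : 'S_n) = 0%N.
Proof.
apply/eqP; rewrite /ell cards_eq0; apply/eqP/setP => p; rewrite !inE !perm1; lia.
Qed.

Definition wcomp v e := foldl (fun v k => pcomp v (sref k)) v e.

Lemma ell_wcomp v e : (ell (wcomp v e) <= ell v + size e)%N.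
Proof.
elim: e v => [|k e IH] v /=; first by rewrite addn0.
by apply: leq_trans (IH _) _; have := ell_sref_leq v k; lia.
Qed.

Definition letters e := all (fun k => 0 < k < n)%N e.

Lemma pfun_wcomp v e : letters e -> pfun (wcomp v e) =1 pfun v \o word_fun e.
Proof.
elim: e v => //= k e IH v /andP[kn he] i.
by rewrite IH //= pfun_comp /= pfun_sref.
Qed.

(** In a reduced word every letter m leaves a trace: some i <= m is sent above m. A permutation of
    1, .., n sends nothing across m when m >= n, so all letters are below n. *)
Lemma letters_reduced w e : reduced_word w e -> letters e.
Proof.
(* A window large enough for the permutation and for all letters of [e]. *)
case=> e1 se wE; set L := maxn n (\max_(k <- e) k.+1).
have eL : all (fun k => 0 < k < L)%N e.
  apply/allP => k ke; rewrite (allP e1 _ ke) /= leq_max; apply/orP; right.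
  exact: (@leq_bigmax_seq _ _ xpredT (fun k => k.+1)).
have nL : (n <= L)%N by rewrite leq_maxl.
have sL : invn L (word_fun e) = size e.
  by rewrite se -(invn_widen w nL); apply: eq_invn => i; rewrite wE.
have invL e' : all (fun k => 0 < k < L)%N e' -> (invn L (word_fun e') <= size e')%N.
  elim/last_ind: e' => [|e' k IH].
    by move=> _; rewrite /invn big1 // => i _; rewrite big1 // => j _ /=; lia.
  rewrite all_rcons size_rcons => /andP[kL /IH]; have := invn_s_nat (word_fun e') kL.
  rewrite (@eq_invn L (word_fun (rcons e' k)) (word_fun e' \o s_nat k)); last first.
    by move=> i; rewrite -cats1 word_fun_cat.
  lia.
(* Induction on the last letter k. For m different from k, s_k preserves the numbers up to m. For m
   = k, either k is new and k + 1 stayed above k, or an old crossing survives, with position k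
   improved by the ascent. *)
have cross e' m : all (fun k => 0 < k < L)%N e' -> invn L (word_fun e') = size e' ->
    m \in e' -> exists2 i, (i <= m)%N & (m < word_fun e' i)%N.
  elim/last_ind: e' m => // e' k IH m; rewrite all_rcons size_rcons => /andP[kL eL'].
  have := invn_s_nat (word_fun e') kL; have := invL _ eL'.
  have E i : word_fun (rcons e' k) i = word_fun e' (s_nat k i).
    by rewrite -cats1 word_fun_cat.
  rewrite (@eq_invn L (word_fun (rcons e' k)) (word_fun e' \o s_nat k)) // => h1 h2 h3.
  (* Equality in the length bound forces the prefix to be reduced and the last letter to be an
     ascent. *)
  have {h1 h2 h3} [h4 asc] : invn L (word_fun e') = size e' /\ (word_fun e' k < word_fun e' k.+1)%N.
    by move: h1 h2 h3; case: ltnP; case: ltnP; lia.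
  rewrite mem_rcons inE; case: (eqVneq m k) => [-> _|mk /= me'].
    have Ek : word_fun (rcons e' k) k = word_fun e' k.+1 by rewrite E /s_nat eqxx.
    case: (boolP (k \in e')) => ke'; last first.
      by exists k => //; rewrite Ek ltnNge word_fun_leq // ltnn.
    have [i ik hi] := IH k eL' h4 ke'; case: (eqVneq i k) hi => [->|ik'] hi.
      by exists k => //; rewrite Ek (ltn_trans hi).
    by exists i => //; rewrite E /s_nat (negbTE ik'); case: eqP => //; lia.
  have [i im hi] := IH m eL' h4 me'; exists (s_nat k i); last by rewrite E s_natK.
  by rewrite s_nat_leq // eq_sym.
apply/allP => k ke; have /andP[-> _] /= := allP eL _ ke.
rewrite ltnNge; apply/negP => nk; have [i ik] := cross e k eL sL ke.
by rewrite -wE ltnNge pfun_leq // ik.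
Qed.

(** The decidable counterpart of [reduced_word], with the bound from [letters_reduced] built in. *)
Definition redw w e := [&& letters e, w == wcomp 1%g e & size e == ell w].

Lemma redwP w e : reduced_word w e <-> redw w e.
Proof.
split=> [h|/and3P[he /eqP wE /eqP se]].
  have he := letters_reduced h; case: h => _ se wE.
  rewrite /redw he se eqxx andbT /=; apply/eqP/pfun_inj => i.
  by rewrite (pfun_wcomp _ he) /= pfun1 wE.
split=> //; first by apply: sub_all he => k /andP[].
by move=> i; rewrite wE (pfun_wcomp _ he) /= pfun1.
Qed.

End Perm.

(** * The nilCoxeter algebra and Schubert polynomials *)

Section NilCoxeterMatrix.
Variables (R : comNzRingType) (n : nat).
Implicit Types v w : 'S_n.

Local Notation N := (#|{perm 'I_n}|.-1).
Local Notation mat := 'M[R]_N.+1.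

Let card_gt : (0 < #|{perm 'I_n}|)%N.
Proof. by apply/card_gt0P; exists 1%g. Qed.

Definition permidx w : 'I_N.+1 := cast_ord (esym (prednK card_gt)) (enum_rank w).
Definition idxperm (i : 'I_N.+1) : 'S_n := enum_val (cast_ord (prednK card_gt) i).

Lemma permidxK : cancel permidx idxperm.
Proof. by move=> w; rewrite /idxperm /permidx cast_ordKV enum_rankK. Qed.

Lemma idxpermK : cancel idxperm permidx.
Proof. by move=> i; rewrite /idxperm /permidx enum_valK cast_ordK. Qed.

(** Right multiplication by u_k on the basis of permutations, acting on row vectors: row v has a 1
    at v s_k if this is longer than v, and is 0 otherwise. *)
Definition umat k : mat :=
  \matrix_(a, b) ((idxperm b == pcomp (idxperm a) (sref n k))
                  && (ell (idxperm b) == (ell (idxperm a)).+1))%:R.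

Definition entry v w (X : mat) : R := X (permidx v) (permidx w).

Lemma entryM v w X Y : entry v w (X * Y) = \sum_x entry v x X * entry x w Y.
Proof.
rewrite /entry mxE (reindex permidx) //; exists idxperm => x _; [exact: permidxK|exact: idxpermK].
Qed.

Lemma entry_umat v w k : entry v w (umat k) =
  ((w == pcomp v (sref n k)) && (ell w == (ell v).+1))%:R.
Proof. by rewrite /entry mxE !permidxK. Qed.

Lemma entry1 v w : entry v w 1 = (w == v)%:R.
Proof. by rewrite /entry mxE (can_eq permidxK) eq_sym. Qed.

Lemma entryD v w X Y : entry v w (X + Y) = entry v w X + entry v w Y.
Proof. by rewrite /entry mxE. Qed.

Lemma entryZ v w a X : entry v w (a *: X) = a * entry v w X.
Proof. by rewrite /entry mxE. Qed.

Lemma entry0 v w : entry v w 0 = 0.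
Proof. by rewrite /entry mxE. Qed.

Lemma entry_sum I (s : seq I) (P : pred I) (F : I -> mat) v w :
  entry v w (\sum_(i <- s | P i) F i) = \sum_(i <- s | P i) entry v w (F i).
Proof. by apply: (big_morph (entry v w)) => [X Y|]; [exact: entryD|exact: entry0]. Qed.

Lemma entryP X Y : (forall v w, entry v w X = entry v w Y) -> X = Y.
Proof. by move=> E; apply/matrixP => a b; have := E (idxperm a) (idxperm b); rewrite /entry !idxpermK. Qed.

(** A letter raises the length by at most one, so a total increase of [size e] means that every
    single step was an ascent; testing the end point is enough. *)
Lemma entry_word v w e : entry v w (\prod_(k <- e) umat k) =
  ((w == wcomp v e) && (ell w == ell v + size e)%N)%:R.
Proof.
elim: e v => [|k e IH] v.
  by rewrite big_nil entry1 /= addn0; case: eqP => //= ->; rewrite eqxx.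
rewrite big_cons entryM (bigD1 (pcomp v (sref n k))) //= [X in _ + X]big1 ?addr0; last first.
  by move=> x /negbTE xE; rewrite entry_umat xE mul0r.
rewrite entry_umat eqxx IH -natrM mulnb /=; congr ((_ : bool)%:R).
have := ell_sref_leq v k; have := ell_wcomp (pcomp v (sref n k)) e.
case: (w =P _) => /= [->|_]; last by rewrite andbF.
lia.
Qed.

Lemma umat_out k : ~~ (0 < k < n)%N -> umat k = 0.
Proof.
move=> kn; apply: entryP => v w; rewrite entry_umat entry0 sref_out // /pcomp mul1g.
by case: eqP => //= ->; rewrite eqn_leq ltnn andbF.
Qed.

(** This reduces the commutation and braid relations to identities between functions on integers. *)
Lemma eq_umat_word e e' : letters n e -> letters n e' -> size e = size e' ->
  word_fun e =1 word_fun e' -> \prod_(k <- e) umat k = \prod_(k <- e') umat k.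
Proof.
move=> he he' se E; apply: entryP => v w; rewrite !entry_word se.
suff -> : wcomp v e = wcomp v e' by [].
by apply: pfun_inj => i; rewrite !pfun_wcomp //= E.
Qed.

Lemma umat_nil k : umat k * umat k = 0.
Proof.
apply: entryP => v w; have -> : umat k * umat k = \prod_(i <- [:: k; k]) umat i.
  by rewrite !big_cons big_nil mulr1.
rewrite entry_word entry0 /= pcomp_srefK; case: eqP => //= ->.
by rewrite -{1}[ell v]addn0 eqn_add2l.
Qed.

Lemma umat_far i j : (i.+1 < j)%N -> umat i * umat j = umat j * umat i.
Proof.
move=> ij; case: (boolP (0 < i < n)%N) => hi; last by rewrite umat_out // mul0r mulr0.
case: (boolP (0 < j < n)%N) => hj; last by rewrite (umat_out hj) mul0r mulr0.
have := @eq_umat_word [:: i; j] [:: j; i].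
rewrite !big_cons !big_nil !mulr1 /= hi hj; apply=> // k /=.
by rewrite /s_nat; do ?case: eqP; lia.
Qed.

Lemma umat_braid i : umat i * umat i.+1 * umat i = umat i.+1 * umat i * umat i.+1.
Proof.
case: (boolP (0 < i < n)%N) => hi; last by rewrite umat_out // !(mul0r, mulr0).
case: (boolP (0 < i.+1 < n)%N) => hj; last by rewrite (umat_out hj) !(mul0r, mulr0).
have := @eq_umat_word [:: i; i.+1; i] [:: i.+1; i; i.+1].
rewrite !big_cons !big_nil !mulr1 /= !mulrA hi; move: hj => /= ->; apply=> // k /=.
by rewrite /s_nat; do ?case: eqP; lia.
Qed.

(** In the regular representation the row of the identity lists the coefficients of an element in
    the basis of permutations. *)
Definition wcoef w (X : mat) : R := entry 1%g w X.

Lemma wcoef_word w e : wcoef w (\prod_(k <- e) umat k) = (redw w e)%:R.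
Proof.
rewrite /wcoef entry_word ell1 add0n /redw.
case: (boolP (letters n e)) => he /=; first by rewrite [ell w == _]eq_sym.
case: eqP => //= wE; case: eqP => //= ew; exfalso.
(* An out-of-range letter acts as the identity and wastes a step, so the word falls short of length
   [size e]. *)
have [k ke kn] := allPn he.
have [e1 [e2 E]] : exists e1 e2, e = e1 ++ k :: e2 by case/splitPr: ke => e1 e2; exists e1, e2.
have := ell_wcomp (pcomp (wcomp 1%g e1) (sref n k)) e2; have := ell_wcomp (1%g : 'S_n) e1.
move: wE ew; rewrite E /wcomp foldl_cat /= -!/(wcomp _ _) => <- ->.
rewrite sref_out // /Defs.pcomp mul1g ell1 size_cat /=; lia.
Qed.

Lemma wcoef_umat w k X :
  wcoef w (X * umat k) = if descent w k then wcoef (pcomp w (sref n k)) X else 0.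
Proof.
rewrite /wcoef entryM (bigD1 (pcomp w (sref n k))) //= [X in _ + X]big1 ?addr0; last first.
  move=> x /eqP xE; rewrite entry_umat; case: eqP => [wE|_]; last by rewrite mulr0.
  by case: xE; rewrite wE pcomp_srefK.
rewrite entry_umat pcomp_srefK eqxx descent_ell /=.
case: (boolP (0 < k < n)%N) => kn /=; first by case: eqP; rewrite ?mulr1 ?mulr0.
by rewrite sref_out // /Defs.pcomp mul1g eqn_leq ltnn andbF mulr0.
Qed.

End NilCoxeterMatrix.

Section CoefHprod.
Variables (R : comNzRingType) (n : nat).
Local Notation u := (umat R n).

Lemma wcoefD (w : 'S_n) (X Y : 'M[R]__) : wcoef w (X + Y) = wcoef w X + wcoef w Y.
Proof. exact: entryD. Qed.

Lemma wcoefZ (w : 'S_n) a (X : 'M[R]__) : wcoef w (a *: X) = a * wcoef w X.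
Proof. exact: entryZ. Qed.

Lemma wcoefB (w : 'S_n) (X Y : 'M[R]__) : wcoef w (X - Y) = wcoef w X - wcoef w Y.
Proof. by rewrite -scaleN1r wcoefD wcoefZ mulN1r. Qed.

Lemma wcoef_hfac (w : 'S_n) X x k : wcoef w (X * hfac u k x) =
  wcoef w X + x * (if descent w k then wcoef (pcomp w (sref n k)) X else 0).
Proof. by rewrite /hfac mulrDr mulr1 wcoefD -scalerAr wcoefZ wcoef_umat. Qed.

Lemma wcoef_hprod_nondescent (w : 'S_n) X l : all (fun p => ~~ descent w p.2) l ->
  wcoef w (X * hprod u l) = wcoef w X.
Proof.
elim/last_ind: l => [|l p IH]; first by rewrite /hprod big_nil mulr1.
rewrite all_rcons => /andP[/negbTE hp /IH {}IH].
by rewrite -cats1 hprod_cat mulrA hprod1 wcoef_hfac hp mulr0 addr0.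
Qed.

Lemma wcoef1_1 : wcoef (1%g : 'S_n) (1 : 'M[R]__) = 1.
Proof. by rewrite /wcoef entry1 eqxx. Qed.

Lemma wcoef_1 w : wcoef (w : 'S_n) (1 : 'M[R]__) = (w == 1%g)%:R.
Proof. exact: entry1. Qed.

(** With no more factors than the length of w, every factor must contribute its letter. The
    coefficient is then the product of all parameters or 0, and [b] records whether the letters
    spell w. *)
Lemma wcoef_hprod_long w l : (size l <= ell w)%N -> exists b : bool,
  wcoef w (hprod u l) = \prod_(p <- l) p.1 * ((size l == ell w) && b)%:R.
Proof.
elim/last_ind: l w => [|l p IH] w.
  move=> _; exists (w == 1%g); rewrite /hprod !big_nil wcoef_1 mul1r /=.
  by case: eqP => [->|]; rewrite ?ell1 ?andbF.
rewrite size_rcons => hl; have [b] := IH w (ltnW hl).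
rewrite (ltn_eqF hl) mulr0 => E.
rewrite -cats1 hprod_cat hprod1 wcoef_hfac E add0r.
case: (boolP (descent w p.2)) => hd; last by exists false; rewrite andbF !mulr0.
move: hd; rewrite descent_ell => /andP[_ /eqP ew].
have /IH[b' E'] : (size l <= ell (pcomp w (sref n p.2)))%N by rewrite -ltnS -ew.
by exists b'; rewrite E' ew eqSS big_cat big_seq1 /= mulrA [p.1 * _]mulrC.
Qed.

Definition stanley (y : nat -> R) := \prod_(1 <= i < n) afrom u n i (y i).

Lemma stanleyE M y : (n <= M)%N ->
  stanley y = \prod_(1 <= i < M) afrom u n i (y i).
Proof.
move=> nM; case: (posnP n) => [n0|n0].
  rewrite /stanley big_geq ?n0 // big_nat; apply/esym/big1 => i hi.
  by rewrite afrom_ge // n0.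
rewrite [RHS](@big_cat_nat _ _ _ n 1 M) //= [X in _ * X]big_nat [X in _ * X]big1 ?mulr1 // => i /andP[hi _].
by rewrite afrom_ge.
Qed.

(** Adjacent factors equal A_k(y_k) A_k(y_(k+1)) (1 - y_(k+1) u_k), where the first two commute.
    Exchanging the variables thus only alters the last factor, by a multiple of u_k, which commutes
    with all later factors. *)
Lemma stanley_swap y k : (0 < k < n)%N ->
  stanley y - stanley (y \o s_nat k) =
  (y k - y k.+1) *: (stanley y * u k).
Proof.
(* Including the trivial factor of index n makes the factors k and k + 1 both present even when k =
   n - 1. *)
move=> /andP[k0 kn]; rewrite !(@stanleyE n.+1) //.
have pair a b : afrom u n k a * afrom u n k.+1 b =
                afrom u n k a * afrom u n k b * hfac u k (- b).
  rewrite -[RHS]mulrA [afrom u n k b]afromS // -[X in _ = _ * X]mulrA hfac_inv ?mulr1 //.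
  exact: umat_nil.
have E (z : nat -> R) : \prod_(1 <= i < n.+1) afrom u n i (z i) =
  \prod_(1 <= i < k) afrom u n i (z i) * (afrom u n k (z k) * afrom u n k (z k.+1) *
  hfac u k (- z k.+1)) * \prod_(k.+2 <= i < n.+1) afrom u n i (z i).
  rewrite (@big_cat_nat _ _ _ k) //=; last by lia.
  rewrite (@big_ltn _ _ _ k) ?(@big_ltn _ _ _ k.+1); try lia.
  by rewrite [afrom u n k _ * _]mulrA pair !mulrA.
rewrite !E /=.
have -> : \prod_(1 <= i < k) afrom u n i (y (s_nat k i)) = \prod_(1 <= i < k) afrom u n i (y i).
  by apply: eq_big_nat => i hi; rewrite /s_nat; do ?case: eqP => //; lia.
have -> : \prod_(k.+2 <= i < n.+1) afrom u n i (y (s_nat k i)) =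
          \prod_(k.+2 <= i < n.+1) afrom u n i (y i).
  by apply: eq_big_nat => i hi; rewrite /s_nat; do ?case: eqP => //; lia.
have -> : s_nat k k = k.+1 by rewrite /s_nat eqxx.
have -> : s_nat k k.+1 = k by rewrite /s_nat eqxx; case: eqP; lia.
rewrite [in X in _ - X]afromC; try by [exact: umat_nil|exact: umat_far|exact: umat_braid].
set P := \prod_(_ <= i < k) _; set Q := \prod_(_ <= i < _) _; set S := _ * afrom _ _ _ _.
have hu : Q * u k = u k * Q.
  apply/esym; rewrite /Q big_nat_cond; apply: (big_ind (fun Y => u k * Y = Y * u k)).
  - by rewrite mulr1 mul1r.
  - by move=> a b ha hb; rewrite mulrA ha -mulrA hb mulrA.
  - by move=> i; rewrite andbT => hi; apply: (u_afac (@umat_far R n)); lia.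
have hSu a : S * hfac u k a * u k = S * u k.
  by rewrite -mulrA /hfac mulrDl -scalerAl umat_nil scaler0 addr0 mul1r.
have -> : P * (S * hfac u k (- y k.+1)) * Q * u k = P * (S * u k) * Q.
  by rewrite -[LHS]mulrA hu [LHS]mulrA -[P * _ * u k]mulrA hSu.
rewrite -mulrBl -mulrBr -mulrBr /hfac opprD addrACA subrr add0r.
by rewrite -scaleNr -scalerDl opprK addrC -!scalerAr -scalerAl.
Qed.

End CoefHprod.

Lemma wcoef_stanley1 (R : comNzRingType) n (y : nat -> R) : wcoef (1%g : 'S_n) (stanley n y) = 1.
Proof.
rewrite -(@wcoef1_1 R n) -[stanley n y]mul1r /stanley.
apply: (big_ind (fun Y => forall X, wcoef 1%g (X * Y) = wcoef 1%g X)) => // [X|Y Y' hY hY' X|i _ X].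
- by rewrite mulr1.
- by rewrite mulrA hY' hY.
have [l] := afac_hprod (umat R n) (n - i) i (y i); rewrite /afrom => -> hl.
apply: wcoef_hprod_nondescent; apply/allP => p _.
by rewrite descent_ell ell1 andbF.
Qed.

Lemma afac_hprod_seq (R : comNzRingType) (B : algType R) (u : nat -> B) d i x :
  exists2 l, afac u d i x = hprod u l & size l = d /\ \prod_(p <- l) p.1 = x ^+ d.
Proof.
elim: d i => [|d IH] i /=; first by exists [::]; rewrite /hprod !big_nil.
have [l -> [sl pl]] := IH i.+1; exists (l ++ [:: (x, i)]).
  by rewrite hprod_cat hprod1.
by rewrite size_cat addn1 sl big_cat big_seq1 pl exprSr.
Qed.

(** The number of factors is exactly the length of the longest element, the case of equality in
    [wcoef_hprod_long], and the product of the parameters is the staircase monomial. *)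
Lemma stanley_hprod (R : comNzRingType) n (y : nat -> R) :
  exists2 l, stanley n y = hprod (umat R n) l &
    size l = (\sum_(1 <= i < n) (n - i))%N /\
    \prod_(p <- l) p.1 = \prod_(1 <= i < n) y i ^+ (n - i).
Proof.
rewrite /stanley.
suff /(_ n) : forall m, exists2 l, \prod_(1 <= i < m) afrom (umat R n) n i (y i) = hprod (umat R n) l &
    size l = (\sum_(1 <= i < m) (n - i))%N /\
    \prod_(p <- l) p.1 = \prod_(1 <= i < m) y i ^+ (n - i) by [].
elim=> [|m [l IH [sl pl]]].
  by exists [::]; rewrite /hprod !big_nil ?big_geq.
case: m IH sl pl => [|m] IH sl pl.
  by exists [::]; rewrite /hprod !big_nil ?big_geq.
have [l' E [sl' pl']] := afac_hprod_seq (umat R n) (n - m.+1) m.+1 (y m.+1).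
exists (l ++ l'); first by rewrite hprod_cat big_nat_recr //= IH /afrom E.
split; first by rewrite size_cat [RHS]big_nat_recr // sl sl'.
by rewrite big_cat [RHS]big_nat_recr // pl pl'.
Qed.

Section Longest.
Variable n : nat.
Implicit Types w : 'S_n.

Lemma ell_max w : (ell w <= ell (longest n))%N.
Proof.
apply/subset_leq_card/subsetP => -[i j]; rewrite !inE /= => /andP[ij _].
by rewrite ij !permE /=; move: (ltn_ord j); lia.
Qed.

Lemma ell_longest : ell (longest n) = (\sum_(1 <= i < n) (n - i))%N.
Proof.
have cnt m i : (\sum_(j < m) (i < j) = m - i.+1)%N.
  elim: m => [|m IH]; first by rewrite big_ord0.
  by rewrite big_ord_recr /= IH; case: ltnP; lia.
rewrite ell_invn /invn.
rewrite (eq_bigr (fun i : 'I_n => n - i.+1)%N); last first.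
  move=> i _; rewrite -cnt; apply: eq_bigr => j _; rewrite !pfunS !permE /=.
  by move: (ltn_ord j) (ltn_ord i); case: ltnP => //=; case: ltnP; lia.
rewrite -(big_mkord xpredT (fun i => n - i.+1)%N).
case: n => [|m]; first by rewrite !big_geq.
by rewrite big_nat_recr //= subnn addn0 big_add1.
Qed.

Lemma descents_longest w : (forall k, (0 < k < n)%N -> descent w k) -> w = longest n.
Proof.
move=> H; apply/permP => i; apply/val_inj; rewrite permE /=.
(* A strictly decreasing sequence with values in 1, .., n is squeezed: [lo] climbs from the right
   end and [hi] falls from the left end. *)
have lo m : (m < n)%N -> (m < pfun w (n - m))%N.
  elim: m => [|m IH] mn.
    by rewrite subn0 lt0n; apply/eqP => /(@pfun_injective _ w n 0) n0; rewrite n0 in mn.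
  have := IH (ltnW mn); have := H (n - m.+1)%N; rewrite /descent.
  have -> : (n - m.+1).+1 = (n - m)%N by lia.
  lia.
have hi m : (m < n)%N -> (pfun w m.+1 <= n - m)%N.
  elim: m => [|m IH] mn; first by rewrite subn0 pfun_leq.
  have := IH (ltnW mn); have := H m.+1; rewrite /descent; lia.
have := hi i (ltn_ord i); have := lo (n - i.+1)%N; have -> : (n - (n - i.+1) = i.+1)%N by move: (ltn_ord i); lia.
rewrite pfunS => /(_ _); have := ltn_ord i; lia.
Qed.

End Longest.

Arguments xvar : simpl never.

Lemma xvarS M (i : 'I_M) : xvar M i.+1 = 'X_i.
Proof. by rewrite /xvar valK. Qed.

Section MapMatrix.
Variables (R S : comNzRingType) (f : {rmorphism R -> S}) (n : nat).

Lemma wcoef_map (w : 'S_n) (X : 'M[R]__) : wcoef w (map_mx f X) = f (wcoef w X).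
Proof. by rewrite /wcoef /entry mxE. Qed.

Lemma map_umat k : map_mx f (umat R n k) = umat S n k.
Proof. by apply/matrixP => a b; rewrite !mxE rmorph_nat. Qed.

Lemma map_afac d k x :
  map_mx f (afac (umat R n) d k x) = afac (umat S n) d k (f x).
Proof.
elim: d k => [|d IH] k /=; first exact: rmorph1.
by rewrite rmorphM /= IH /hfac rmorphD rmorph1 /= map_mxZ map_umat.
Qed.

Lemma map_stanley (y : nat -> R) : map_mx f (stanley n y) = stanley n (f \o y).
Proof. by rewrite /stanley rmorph_prod; apply: eq_bigr => i _; apply: map_afac. Qed.

Lemma wcoef_map_stanley w (y : nat -> R) :
  f (wcoef w (stanley n y)) = wcoef w (stanley n (f \o y)).
Proof. by rewrite -wcoef_map map_stanley. Qed.

End MapMatrix.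

Lemma eq_stanley (R : comNzRingType) n (y z : nat -> R) :
  {in [pred i | 0 < i < n]%N, y =1 z} -> stanley n y = stanley n z.
Proof. by move=> E; apply: eq_big_nat => i hi; rewrite E. Qed.

Lemma mpolyX_sub_neq0 n (i j : 'I_n) : i != j -> 'X_i - 'X_j != 0 :> {mpoly int[n]}.
Proof.
move=> /negbTE nij; rewrite subr_eq0; apply/eqP => /(congr1 (mcoeff U_(i)%MM)) /eqP.
by rewrite !mcoeffX eqxx eq_mnm1 [j == i]eq_sym nij.
Qed.

(** * Schubert polynomials as coefficients of the Fomin-Stanley product *)

Section Schubert.
Variable n : nat.
Local Notation Phi := (stanley n (xvar n)).

(** This is [stanley_swap] read at w s_j: that permutation has a descent at j, so its coefficient in
    Phi u_j is the one of w in Phi. Ordinals are 0-based, hence exchanging i and j = i + 1 is the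
    letter [j]. *)
Lemma ddiff_stanley (w : 'S_n) (i j : 'I_n) : j = i.+1 :> nat ->
  ell (pcomp w (tperm i j)) = (ell w).+1 ->
  ddiff i j (wcoef (pcomp w (tperm i j)) Phi) = wcoef w Phi.
Proof.
move=> ij ew; have jn : (0 < j < n)%N by rewrite ltn_ord ij.
have nij : i != j by rewrite -val_eqE /= ij ltn_eqF.
have X0 := mpolyX_sub_neq0 nij.
apply: (mulIf X0); rewrite ddiffP.
have -> : msym (tperm i j) (wcoef (pcomp w (tperm i j)) Phi) =
          wcoef (pcomp w (tperm i j)) (stanley n (xvar n \o s_nat j)).
  rewrite (wcoef_map_stanley (msym (tperm i j))); congr wcoef; apply: eq_stanley => k /andP[k0 kn].
  case: k k0 kn => // k _ kn; rewrite /= -(pfun_sref jn) -(tperm_sref ij).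
  have kn' := ltnW kn.
  rewrite (pfunS _ (Ordinal kn')) (xvarS (Ordinal kn')) xvarS msymX; congr mpolyX.
  apply/mnmP => l; rewrite mnmE !mnm1E tpermV.
  by rewrite (can2_eq (tpermK i j) (tpermK i j)).
rewrite -wcoefB stanley_swap // wcoefZ wcoef_umat -(tperm_sref ij).
rewrite descent_ell -(tperm_sref ij) jn ew /= /Defs.pcomp mulgA tperm2 mul1g eqxx.
by rewrite -[j in xvar n j]/(nat_of_ord j) ij xvarS -ij xvarS mulrC.
Qed.

Lemma wcoef_longest : exists b : bool, wcoef (longest n) Phi =
  b%:R * \prod_(i < n) 'X_i ^+ (n - i.+1).
Proof.
have [l E [sl pl]] := stanley_hprod n (xvar n).
have [|b] := @wcoef_hprod_long _ n (longest n) l; first by rewrite sl ell_longest.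
rewrite E pl sl ell_longest eqxx /= => ->; exists b; rewrite mulrC; congr (_ * _).
have -> : \prod_(i < n) 'X_i ^+ (n - i.+1) =
  \prod_(0 <= i < n) xvar n i.+1 ^+ (n - i.+1).
  by rewrite big_mkord; apply: eq_bigr => i _; rewrite xvarS.
case: n => [|m]; first by rewrite !big_geq.
by rewrite [RHS]big_nat_recr //= subnn expr0 mulr1 big_add1.
Qed.

Lemma schubert_wcoef (w : 'S_n) : schubert w = wcoef w Phi.
Proof.
have [b hb] := wcoef_longest.
have top v : [pick ij | is_ascent v ij] = None -> v = longest n.
  case: pickP => // noasc _; apply: descents_longest => k kn; apply/negPn/negP.
  rewrite (ascent_ell _ kn) => hk.
  have jn : (k < n)%N by lia.
  have iN : (k.-1 < n)%N by lia.
  have E : Ordinal jn = (Ordinal iN).+1 :> nat by rewrite /=; lia.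
  by move: (noasc (Ordinal iN, Ordinal jn)); rewrite /is_ascent /= (tperm_sref E) hk andbT -E eqxx.
(* The unknown boolean [b] is carried down the recursion, which spares exhibiting a reduced word of
   the longest element. *)
have key k v : (ell (longest n) - ell v <= k)%N -> b%:R * schubert_rec k v = wcoef v Phi.
  elim: k v => [|k IH] v hk.
    rewrite (top v) //; case: pickP => // -[i j].
    rewrite /is_ascent => /andP[_ /eqP /= h].
    by have := ell_max (pcomp v (tperm i j)); lia.
  rewrite /=; case E: [pick ij | is_ascent v ij] => [[i j]|]; last by rewrite (top _ E) hb.
  move: E; case: pickP => // -[i' j'] + [ii jj]; rewrite {}ii {}jj.
  rewrite /is_ascent /= => /andP[/eqP ij /eqP ev].
  rewrite -(ddiff_stanley ij ev) -IH; last by rewrite ev; lia.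
  have nij : i != j by rewrite -val_eqE /= ij ltn_eqF.
  case: (b) => /=; rewrite ?mul1r // !mul0r.
  by apply: (mulIf (mpolyX_sub_neq0 nij)); rewrite ddiffP mul0r msym0 subrr.
(* The coefficient at the identity is 1, which excludes [b = false]. *)
have := key (ell (longest n)) 1%g (leq_subr _ _).
rewrite wcoef_stanley1; case: (b) key => key; last by move/eqP; rewrite mul0r eq_sym oner_eq0.
by move=> _; rewrite -(key (ell (longest n)) w) ?mul1r // leq_subr.
Qed.

End Schubert.

Lemma schubertX_wcoef M n (w : 'S_n) : (n <= M)%N ->
  schubertX M w = wcoef w (stanley n (xvar M)).
Proof.
move=> nM; rewrite /schubertX schubert_wcoef (wcoef_map_stanley (comp_mpoly _)).
congr wcoef; apply: eq_stanley => -[|i] //= /andP[_ hi].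
by rewrite (xvarS (Ordinal (ltnW hi))) comp_mpolyXU -tnth_nth tnth_mktuple.
Qed.

(** * Products of equal factors and semistandard tableaux *)

Lemma perm_big_comm (B : pzRingType) (I : eqType) (s t : seq I) (F : I -> B) :
  (forall i j, F i * F j = F j * F i) -> perm_eq s t ->
  \prod_(i <- s) F i = \prod_(i <- t) F i.
Proof.
move=> FC; elim: s t => [|x s IH] t st.
  by have -> : t = [::] by apply/nilP; rewrite /nilp -(perm_size st).
have xt : x \in t by rewrite -(perm_mem st) mem_head.
case/splitPr: xt st => t1 t2 st.
have {}st : perm_eq s (t1 ++ t2).
  by rewrite -(perm_cons x) (perm_trans st) // -cat1s perm_catCA.
rewrite big_cons (IH _ st) !big_cat big_cons /= !mulrA; congr (_ * _).
elim: t1 {st} => [|z t1 IH1]; first by rewrite !big_nil mulr1 mul1r.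
by rewrite big_cons mulrA FC -mulrA IH1 mulrA.
Qed.

Lemma eq_prod_adjacent (B : pzRingType) r (f g : 'I_r -> B) (i j : 'I_r) :
  j = i.+1 :> nat -> (forall k : 'I_r, k != i -> k != j -> f k = g k) ->
  f i * f j = g i * g j -> \prod_(k < r) f k = \prod_(k < r) g k.
Proof.
move=> ij E Eij; pose ext (h : 'I_r -> B) k := if insub k is Some k' then h k' else 1.
have extE h : \prod_(k < r) h k = \prod_(0 <= k < r) ext h k.
  by rewrite big_mkord; apply: eq_bigr => k _; rewrite /ext valK.
have eqext (k : nat) : k != i :> nat -> k != j :> nat -> ext f k = ext g k.
  move=> ki kj; rewrite /ext; case: insubP => // k' _ kE.
  by apply: E; rewrite -val_eqE /= kE.
rewrite !extE; have jr := ltn_ord j.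
rewrite !(@big_cat_nat _ _ _ i 0 r) //=; try lia.
rewrite !(@big_ltn _ _ _ i) ?(@big_ltn _ _ _ i.+1) -?ij; try lia.
rewrite [ext f i * (ext f j * _)]mulrA [ext g i * (ext g j * _)]mulrA.
congr (_ * (_ * _)).
- by apply: eq_big_nat => k hk; apply: eqext; lia.
- by rewrite /ext !valK.
- by apply: eq_big_nat => k hk; apply: eqext; lia.
Qed.

Definition altr (R : comNzRingType) r (y : 'I_r -> R) (l : 'I_r -> nat) : R :=
  \sum_(s : 'S_r) (-1) ^+ s * \prod_(j < r) y (s j) ^+ l j.

Lemma sorted_ltn_rcons s x : sorted ltn (rcons s x) = sorted ltn s && all (ltn^~ x) s.
Proof. by rewrite !(sorted_pairwise ltn_trans) pairwise_rcons andbC. Qed.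

Lemma sorted_split_max m C : sorted ltn C -> all (fun k => k <= m)%N C ->
  C = if m \in C then rcons [seq k <- C | k < m]%N m else [seq k <- C | k < m]%N.
Proof.
elim/last_ind: C => // C k _; rewrite all_rcons sorted_ltn_rcons mem_rcons inE.
rewrite filter_rcons => /andP[_ hC] /andP[+ _]; rewrite leq_eqVlt => /predU1P[E|km].
  by rewrite E eqxx ltnn; rewrite -E; congr rcons; apply/esym/all_filterP.
have hm : all (fun k => k < m)%N C by apply: sub_all hC => ? /ltn_trans; apply.
rewrite gtn_eqF // km (_ : _ \in _ = false); first by rewrite (all_filterP _).
by apply/negP => /(allP hm); rewrite ltnn.
Qed.

Section Reflection.
Context (R : comNzRingType) (B : algType R) (u : nat -> B).
Hypothesis u_nil : forall i, u i * u i = 0.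
Hypothesis u_far : forall i j, (i.+1 < j)%N -> u i * u j = u j * u i.
Hypothesis u_braid : forall i, u i * u i.+1 * u i = u i.+1 * u i * u i.+1.
Variables (r n t0 : nat) (y : 'I_r -> R).

Definition columns := {ffun 'I_r -> seq nat}.
Implicit Types c : columns.

Definition uword (e : seq nat) : B := \prod_(k <- e) u k.

Definition stair (j : 'I_r) : nat := (r - j.+1)%N.

(** One factor of the partly expanded product: [c j] holds the letters below t already chosen, each
    with a power of x, while [afrom u n t x] is still unexpanded. The exponent [stair j] comes from
    the Vandermonde determinant. *)
Definition col_factor t x c (j : 'I_r) : B :=
  x ^+ (stair j + size (c j)) *: (afrom u n t x * uword (rev (c j))).

Definition gsum t c : B :=
  \sum_(s : 'S_r) (-1) ^+ s *: \prod_(j < r) col_factor t (y (s j)) c j.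

Definition add_letter t c (Z : {ffun 'I_r -> bool}) : columns :=
  [ffun j => if Z j then rcons (c j) t else c j].

Definition part_cols c :=
  [forall i : 'I_r, forall j : 'I_r, (j == i.+1 :> nat) ==> (size (c j) <= size (c i))%N].

(** Letters are added in increasing order, at most one per column, and only the shape is tested; by
    [rowle_rcons] this already makes the rows weakly increasing. *)
Fixpoint ssyt_cols d : seq columns :=
  if d is d'.+1 then
    [seq c <- [seq add_letter (t0 + d') c Z | c <- ssyt_cols d', Z <- enum {ffun 'I_r -> bool}]
     | part_cols c]
  else [:: [ffun=> [::]]].

Lemma gsum_split t c : (t < n)%N ->
  gsum t c = \sum_(Z : {ffun 'I_r -> bool}) gsum t.+1 (add_letter t c Z).
Proof.
move=> tn; rewrite /gsum exchange_big /=; apply: eq_bigr => s _.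
rewrite -scaler_sumr; congr (_ *: _).
pose F j (z : bool) := y (s j) ^+ (stair j + size (if z then rcons (c j) t else c j)) *:
  (afrom u n t.+1 (y (s j)) * uword (rev (if z then rcons (c j) t else c j))).
transitivity (\prod_(j < r) \sum_(z : bool) F j z).
  apply: eq_bigr => j _; rewrite big_bool /F /= size_rcons addnS exprSr.
  rewrite rev_rcons /uword big_cons /col_factor afromS // /hfac -mulrA mulrDl mul1r mulrDr scalerDr addrC.
  by congr (_ + _); rewrite -scalerAl -scalerAr scalerA.
rewrite bigA_distr_bigA; apply: eq_bigr => Z _; apply: eq_bigr => j _.
by rewrite /col_factor ffunE.
Qed.

(** A column longer by one than its left neighbour makes the two exponents of the alternant equal.
    Exchanging the two variables then only flips the sign: the letters of [c i] are below t - 1 and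
    commute with [afrom u n t], and the two [afrom] factors commute with each other. *)
Lemma gsum_reflect t c (i j : 'I_r) : j = i.+1 :> nat ->
  size (c j) = (size (c i)).+1 -> all (fun k => k.+1 < t)%N (c i) ->
  gsum t c = 0.
Proof.
move=> ij sij ci; pose w := tperm i j.
have nij : i != j by rewrite -val_eqE /= ij ltn_eqF.
have oddMt (s : 'S_r) : (w * s)%g = ~~ s :> bool by rewrite odd_permM odd_tperm nij.
rewrite /gsum (bigID (@odd_perm _)) /=.
apply: canLR (subrK _) _; rewrite add0r -sumrN.
rewrite (reindex_inj (mulgI w)); apply: eq_big => //= s.
rewrite oddMt => /negPf->; rewrite scaleN1r scale1r; congr (- _).
apply: (eq_prod_adjacent ij) => [k ki kj|].
  by rewrite permM tpermD // eq_sym.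
rewrite !permM tpermL tpermR /col_factor.
have -> : (stair j + size (c j) = stair i + size (c i))%N.
  by rewrite sij /stair ij; have := ltn_ord j; lia.
rewrite -!scalerAl -!scalerAr !scalerA [X in X *: _]mulrC; congr (_ *: _).
have uC x : uword (rev (c i)) * afrom u n t x = afrom u n t x * uword (rev (c i)).
  rewrite /uword big_seq; apply: (big_ind (fun Y => Y * _ = _ * Y)).
  - by rewrite mul1r mulr1.
  - by move=> X Y hX hY; rewrite -mulrA hY mulrA hX mulrA.
  - by move=> k; rewrite mem_rev => /(allP ci) hk; apply: u_afac.
have key x z : afrom u n t x * uword (rev (c i)) * (afrom u n t z * uword (rev (c j))) =
  afrom u n t x * afrom u n t z * (uword (rev (c i)) * uword (rev (c j))).
  by rewrite -mulrA [uword (rev (c i)) * (_ * _)]mulrA uC !mulrA.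
by rewrite !key (afromC u_nil u_far u_braid).
Qed.

Lemma part_colsP c :
  reflect (forall i j : 'I_r, j = i.+1 :> nat -> (size (c j) <= size (c i))%N) (part_cols c).
Proof.
apply: (iffP forallP) => [H i j ij|H i].
  by have /forallP/(_ j)/implyP := H i; apply; apply/eqP.
by apply/forallP => j; apply/implyP => /eqP; apply: H.
Qed.

Definition rowle (C D : seq nat) :=
  (size D <= size C)%N && all (fun k => nth 0%N C k <= nth 0%N D k)%N (iota 0 (size D)).

Definition ssyt_colsb m (c : columns) :=
  [forall j, sorted ltn (c j) && all (fun k => t0 <= k < m)%N (c j)] &&
  [forall i : 'I_r, forall j : 'I_r, (j == i.+1 :> nat) ==> rowle (c i) (c j)].

(** The new entry m exceeds all others, so at the right of an entry it is harmless, and at its left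
    only the shape can forbid it. *)
Lemma rowle_rcons m C D (z z' : bool) : all (fun k => k < m)%N C -> all (fun k => k < m)%N D ->
  let C' := if z then rcons C m else C in let D' := if z' then rcons D m else D in
  rowle C' D' = rowle C D && (size D' <= size C')%N.
Proof.
move=> hC hD C' D'; rewrite /rowle.
have nC k : (k < size C)%N -> nth 0%N C' k = nth 0%N C k.
  by rewrite /C'; case: z {C'} => // kC; rewrite nth_rcons kC.
have nD k : (k < size D)%N -> nth 0%N D' k = nth 0%N D k.
  by rewrite /D'; case: z' {D'} => // kC; rewrite nth_rcons kC.
have nC' k : (nth 0%N C' k <= m)%N.
  case: (ltnP k (size C')) => kC; last by rewrite nth_default.
  have : all (fun k => k <= m)%N C'.
    by rewrite /C'; case: (z); rewrite ?all_rcons ?leqnn; apply: sub_all hC => ? /ltnW.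
  by move/(all_nthP 0%N)/(_ k kC).
have sD : (size D <= size D')%N by rewrite /D'; case: (z'); rewrite ?size_rcons.
apply/idP/idP => [/andP[h1 /allP h2]|/andP[/andP[h1 /allP h2] h3]].
  rewrite h1 andbT.
  have H k : (k < size D)%N -> (k < size C)%N && (nth 0%N C k <= nth 0%N D k)%N.
    move=> kD; have /h2 : k \in iota 0 (size D') by rewrite mem_iota /= (leq_trans kD).
    rewrite nD // => hk; have hDm := all_nthP 0%N hD k kD.
    (* Otherwise the entry of D at height k would have the new entry m of C to its left, although it
       is smaller than m. *)
    have kC : (k < size C)%N.
      rewrite ltnNge; apply/negP => Ck; move: hk.
      rewrite /C'; have : (k < size C')%N by apply: leq_trans h1; apply: leq_trans sD.
      rewrite /C'; case: (z) => [|]; last by rewrite ltnNge Ck.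
      rewrite size_rcons ltnS => kC; have kE : k == size C by rewrite eqn_leq kC.
      by rewrite nth_rcons ltnNge Ck kE /= leqNgt hDm.
    by rewrite kC -(nC k kC).
  apply/andP; split.
    case: (posnP (size D)) => [->//|D0].
    have /H/andP[+ _] : ((size D).-1 < size D)%N by rewrite ltn_predL.
    by rewrite prednK.
  by apply/allP => k; rewrite mem_iota /= => /H/andP[].
rewrite h3; apply/allP => k; rewrite mem_iota /= add0n => kD'.
case: (ltnP k (size D)) => kD.
  by rewrite nD // nC; [apply: h2; rewrite mem_iota|apply: leq_trans h1].
have -> : nth 0%N D' k = m; last exact: nC'.
move: kD'; rewrite /D'; case: (z') => [|]; last by rewrite ltnNge kD.
by rewrite size_rcons ltnS nth_rcons => kD'; rewrite ltnNge kD /= eqn_leq kD kD'.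
Qed.

(** The letters t0, t0 + 1, .. are split off one after another, and the terms whose shape stops
    being a partition vanish by [gsum_reflect]. *)
Lemma gsum_ssyt d : (d <= n - t0)%N ->
  gsum t0 [ffun=> [::]] = \sum_(c <- ssyt_cols d) gsum (t0 + d) c /\
  {in ssyt_cols d, forall c, part_cols c && [forall j, all (fun k => k < t0 + d)%N (c j)]}.
Proof.
elim: d => [|d IH] hd.
  rewrite big_seq1 addn0; split=> // c; rewrite inE => /eqP->.
  by apply/andP; split; [apply/part_colsP => i j _|apply/forallP => j]; rewrite !ffunE.
have [-> hc] := IH (ltnW hd); rewrite addnS; split; last first.
  move=> c; rewrite mem_filter => /andP[-> /allpairsP[[c0 Z] /= [c0L _ ->]]] /=.
  have /andP[_ /forallP hl] := hc _ c0L.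
  apply/forallP => j; rewrite ffunE; have := hl j; case: ifP => _ h.
    by rewrite all_rcons ltnSn; apply: sub_all h => k; rewrite ltnS; apply: ltnW.
  by apply: sub_all h => k; rewrite ltnS; apply: ltnW.
rewrite [RHS]big_filter [RHS]big_mkcond big_allpairs_dep /=.
rewrite [LHS]big_seq [RHS]big_seq; apply: eq_bigr => c cL.
have /andP[/part_colsP hp /forallP hl] := hc _ cL.
rewrite gsum_split; last by lia.
rewrite -[RHS]/(\sum_(Z <- enum {: {ffun 'I_r -> bool}}) _) [RHS]big_enum /=; apply: eq_bigr => Z _.
case: ifPn => // /forallPn[i /forallPn[j]]; rewrite negb_imply -ltnNge => /andP[/eqP ij].
rewrite !ffunE => hs; have := hp _ _ ij.
(* The old heights were weakly decreasing, so a violation means equal heights and a letter added to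
   column j only. *)
have [Zj Zi] : Z j /\ ~~ Z i.
  by move: hs; have := hp _ _ ij; case: (Z i); case: (Z j); rewrite ?size_rcons; lia.
move: hs; rewrite Zj (negbTE Zi) size_rcons => hs hs'.
apply: (gsum_reflect ij); rewrite !ffunE ?Zj (negbTE Zi) ?size_rcons; first by lia.
by apply: sub_all (hl i) => k; rewrite ltnS.
Qed.

Lemma perm_index_enum_map (s : 'S_r) :
  perm_eq [seq s j | j <- index_enum 'I_r] (index_enum 'I_r).
Proof.
apply: uniq_perm; [by rewrite (map_inj_uniq perm_inj) index_enum_uniq|exact: index_enum_uniq|].
move=> j; rewrite mem_index_enum; apply/mapP.
by exists (s^-1 j)%g; rewrite ?mem_index_enum ?permKV.
Qed.

(** At t = n the unexpanded factors are 1, so each surviving term is a word times an alternant. *)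
Lemma reflection_principle :
  altr y stair *: \prod_(j < r) afrom u n t0 (y j) =
  \sum_(c <- ssyt_cols (n - t0)) altr y (fun j => stair j + size (c j))%N *:
     \prod_(j < r) uword (rev (c j)).
Proof.
have [E _] := gsum_ssyt (leqnn (n - t0)).
transitivity (gsum t0 [ffun=> [::]]).
  rewrite /altr scaler_suml; apply: eq_bigr => s _; rewrite -scalerA; congr (_ *: _).
  under [RHS]eq_bigr => j _ do rewrite /col_factor ffunE /= addn0 /uword big_nil mulr1.
  rewrite scaler_prod; congr (_ *: _).
  rewrite -[RHS](big_map s xpredT (fun i => afrom u n t0 (y i))).
  (* The factors commute, so every assignment [s] of the variables gives the same product and the
     signed monomials form an alternant. *)
  apply/esym/perm_big_comm; last exact: perm_index_enum_map.
  by move=> i j; apply: (afromC u_nil u_far u_braid).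
rewrite E; apply: eq_bigr => c _; rewrite /gsum /altr scaler_suml.
apply: eq_bigr => s _; rewrite -scalerA -scaler_prod; congr (_ *: _).
apply: eq_bigr => j _; rewrite /col_factor afrom_ge ?mul1r //; lia.
Qed.

Lemma ssyt_colsbP m c : reflect
  ((forall j, sorted ltn (c j) /\ all (fun k => t0 <= k < m)%N (c j)) /\
   (forall i j : 'I_r, j = i.+1 :> nat -> rowle (c i) (c j))) (ssyt_colsb m c).
Proof.
apply: (iffP andP) => [[/forallP h1 /forallP h2]|[h1 h2]]; split.
- by move=> j; apply/andP/h1.
- by move=> i j ij; have /forallP/(_ j)/implyP := h2 i; apply; apply/eqP.
- by apply/forallP => j; apply/andP/h1.
- by apply/forallP => i; apply/forallP => j; apply/implyP => /eqP; apply: h2.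
Qed.

Lemma mem_ssyt_cols d c : (c \in ssyt_cols d) = ssyt_colsb (t0 + d) c.
Proof.
elim: d c => [|d IH] c.
  rewrite inE addn0; apply/eqP/ssyt_colsbP => [->|[h _]].
    by split=> [j|i j _]; rewrite !ffunE.
  apply/ffunP => j; rewrite ffunE; have [_] := h j.
  by case: (c j) => //= k C /andP[]; lia.
have lt_all C : all (fun k => t0 <= k < t0 + d)%N C -> all (fun k => k < t0 + d)%N C.
  by apply: sub_all => k /andP[].
rewrite /= mem_filter; apply/andP/idP => [[/part_colsP hp /allpairsP[[c0 Z] /= []]]|].
  rewrite IH => /ssyt_colsbP[h1 h2] _ E; apply/ssyt_colsbP; split=> [j|i j ij].
    rewrite E ffunE addnS; have [hs ha] := h1 j; case: ifP => _.
      rewrite all_rcons ltnSn leq_addr sorted_ltn_rcons hs lt_all //.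
      by split=> //; apply: sub_all ha => k; lia.
    by split=> //; apply: sub_all ha => k; lia.
  have := hp i j ij; rewrite E !ffunE => hij.
  rewrite (@rowle_rcons (t0 + d)) ?lt_all ?hij ?h2 //; first by have [] := h1 i.
  by have [] := h1 j.
move=> /ssyt_colsbP[h1 h2]; split.
  by apply/part_colsP => i j ij; have /andP[] := h2 i j ij.
pose c0 : columns := [ffun j => [seq k <- c j | k < t0 + d]%N].
pose Z : {ffun 'I_r -> bool} := [ffun j => (t0 + d)%N \in c j].
have E : c = add_letter (t0 + d) c0 Z.
  apply/ffunP => j; rewrite !ffunE; have [hs ha] := h1 j.
  by apply: sorted_split_max => //; apply: sub_all ha => k; rewrite addnS => /andP[].
apply/allpairsP; exists (c0, Z); split=> //=; last by rewrite mem_enum.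
have hc0 j : sorted ltn (c0 j) /\ all (fun k => t0 <= k < t0 + d)%N (c0 j).
  rewrite ffunE; have [hs ha] := h1 j; split; first exact: sorted_filter ltn_trans _ _ hs.
  by apply/allP => k; rewrite mem_filter => /andP[-> /(allP ha)/andP[->]].
rewrite IH; apply/ssyt_colsbP; split=> // i j ij; have := h2 i j ij.
rewrite E ![add_letter _ _ _ _]ffunE (@rowle_rcons (t0 + d)) ?lt_all //; try by case: (hc0 i); case: (hc0 j).
by case/andP.
Qed.

(** The occurrences of the newest letter recover [Z], and the smaller letters recover the previous
    columns. *)
Lemma ssyt_cols_uniq d : uniq (ssyt_cols d).
Proof.
elim: d => //= d IH; apply/filter_uniq/allpairs_uniq => //; first exact: enum_uniq.
have small c j : c \in ssyt_cols d -> all (fun k => k < t0 + d)%N (c j).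
  by rewrite mem_ssyt_cols => /ssyt_colsbP[/(_ j)[_ ha] _]; apply: sub_all ha => k /andP[].
have memZ c Z j : c \in ssyt_cols d -> ((t0 + d)%N \in add_letter (t0 + d) c Z j) = Z j.
  move=> cL; rewrite ffunE; case: (Z j); first by rewrite mem_rcons mem_head.
  by apply/negP => /(allP (small c j cL)); rewrite ltnn.
have filZ c Z j : c \in ssyt_cols d ->
    [seq k <- add_letter (t0 + d) c Z j | k < t0 + d]%N = c j.
  move=> cL; rewrite ffunE; case: (Z j); rewrite ?filter_rcons ?ltnn; apply/all_filterP/small => //.
move=> [? ?] [? ?] /allpairsP[[c Z] /= [h _ [-> ->]]] /allpairsP[[c' Z'] /= [h' _ [-> ->]]] /= E.
congr (_, _); apply/ffunP => j; first by rewrite -(filZ _ Z j h) E filZ.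
by rewrite -(memZ _ _ _ h) E memZ.
Qed.

End Reflection.

(** * Schur polynomials as ratios of alternants *)

Section ListProducts.
Variables (T : Type).

Fixpoint seqprod (rs : seq (seq T)) : seq (seq T) :=
  if rs is r :: rs' then [seq a :: v | a <- r, v <- seqprod rs'] else [:: [::]].

Lemma big_seqprod_cons (V : nmodType) r rs (g : seq T -> V) :
  \sum_(v <- seqprod (r :: rs)) g v = \sum_(a <- r) \sum_(v <- seqprod rs) g (a :: v).
Proof. exact: big_allpairs_dep. Qed.

Lemma big_seqprod_rcons (V : nmodType) r rs (g : seq T -> V) :
  \sum_(v <- seqprod (rcons rs r)) g v = \sum_(v <- seqprod rs) \sum_(a <- r) g (rcons v a).
Proof.
elim: rs g => [|r' rs IH] g; first by rewrite big_seqprod_cons !big_seq1; under eq_bigr do rewrite big_seq1.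
by rewrite rcons_cons !big_seqprod_cons; apply: eq_bigr => a _; rewrite IH.
Qed.

Lemma prod_sum_seqprod (R : pzSemiRingType) (x0 : T) r rs (G : 'I_r -> T -> R) : size rs = r ->
  \prod_(j < r) \sum_(a <- nth [::] rs j) G j a =
  \sum_(v <- seqprod rs) \prod_(j < r) G j (nth x0 v j).
Proof.
elim: rs r G => [|r1 rs IH] [|r] G // => [_|[sr]].
  by rewrite big_seq1 !big_ord0.
rewrite big_ord_recl big_seqprod_cons mulr_suml; apply: eq_bigr => a _ /=.
rewrite (IH r (fun j => G (lift ord0 j))) // mulr_sumr; apply: eq_bigr => v _.
by rewrite big_ord_recl.
Qed.

End ListProducts.

Lemma size_seqprod (T : eqType) (rs : seq (seq T)) v : v \in seqprod rs -> size v = size rs.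
Proof.
elim: rs v => [|r rs IH] v /=; first by rewrite inE => /eqP->.
by case/allpairsP=> -[a w] /= [_ /IH <- ->].
Qed.

Lemma nth_seqprod (T : eqType) (x0 : T) (rs : seq (seq T)) v j : v \in seqprod rs ->
  (j < size rs)%N -> nth x0 v j \in nth [::] rs j.
Proof.
elim: rs v j => [|r rs IH] v j //=.
by case/allpairsP=> -[a w] /= [ar wr ->]; case: j => //= j; apply: IH.
Qed.

Lemma mem_seqprod_cons (T : eqType) a v r (rs : seq (seq T)) :
  (a :: v \in seqprod (r :: rs)) = (a \in r) && (v \in seqprod rs).
Proof.
apply/allpairsP/andP => [[[x w] /= [xr wr [-> ->]]] //|[ar vr]].
by exists (a, v).
Qed.

Lemma mem_seqprod_rcons (T : eqType) a v r (rs : seq (seq T)) : size v = size rs ->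
  (rcons v a \in seqprod (rcons rs r)) = (v \in seqprod rs) && (a \in r).
Proof.
elim: rs v => [|r' rs IH] [|x v] // => [_|[sv]].
  by rewrite mem_seqprod_cons !inE andbT.
by rewrite !rcons_cons !mem_seqprod_cons IH // andbA.
Qed.

Section RowSums.
Variables (R : comNzRingType) (wt : nat -> R).

Definition wrow (r : seq nat) : R := \prod_(x <- r) wt x.

(** The tableau sum of a Schur polynomial, unrolled row by row; [p] is the row just above the
    remaining ones. *)
Fixpoint rowsum (A : seq nat) (p : seq nat) (sh : seq nat) : R :=
  if sh is k :: sh' then
    \sum_(r <- words A k | sorted leq r && above_row p r) wrow r * rowsum A r sh'
  else 1.

Lemma big_wordsS (V : nmodType) A k (P : pred (seq nat)) (g : seq nat -> V) :
  \sum_(r <- words A k.+1 | P r) g r = \sum_(x <- A) \sum_(r <- words A k | P (x :: r)) g (x :: r).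
Proof.
rewrite [words A k.+1]iterS -/(words A k) big_mkcond big_allpairs_dep.
by apply: eq_bigr => x _; rewrite [RHS]big_mkcond.
Qed.

(** A weakly increasing row carries its copies of the largest letter m at the end. The lower bound x
    on the first entry is what the induction needs. *)
Lemma words_top (V : nmodType) A m k x (g : seq nat -> V) : all (ltn^~ m) A -> (x <= m)%N ->
  \sum_(r <- words (rcons A m) k | path leq x r) g r =
  if (x == m) then g (nseq k m) else
  \sum_(0 <= a < k.+1) \sum_(q <- words A a | path leq x q) g (q ++ nseq (k - a) m).
Proof.
move=> hA; elim: k x g => [|k IH] x g xm.
  rewrite big_cons big_nil /= addr0; case: eqP => // _.
  by rewrite big_nat1 big_cons big_nil /= addr0.
have last_eq (y : nat) : \sum_(r <- words (rcons A m) k | path leq y (m :: r)) g (m :: r) =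
    if (y <= m)%N then g (nseq k.+1 m) else 0.
  rewrite /=; case: leqP => _; last by rewrite big_pred0.
  by rewrite (IH m (fun r => g (m :: r))) // eqxx.
rewrite big_wordsS -cats1 big_cat big_seq1 /= cats1 last_eq xm; case: (eqVneq x m) => [->|xm'].
  rewrite big_seq big1 ?add0r // => y yA; apply: big1_seq => r /andP[/= /andP[my _] _].
  by move: (allP hA y yA) => /=; rewrite ltnNge my.
rewrite big_nat_recl // big_cons big_nil /= addr0 ?subn0 addrC; congr (_ + _).
under [RHS]eq_bigr do rewrite big_wordsS.
rewrite exchange_big /= big_seq [RHS]big_seq; apply: eq_bigr => y /(allP hA) /= ym.
case: leqP => _; last by rewrite big_pred0 // big1 // => a _; rewrite big_pred0.
by rewrite (IH y (fun r => g (y :: r))) 1?ltnW // (ltn_eqF ym).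
Qed.

Lemma words_top_sorted (V : nmodType) A m k (g : seq nat -> V) : all (ltn^~ m) A ->
  \sum_(r <- words (rcons A m) k | sorted leq r) g r =
  \sum_(0 <= a < k.+1) \sum_(q <- words A a | sorted leq q) g (q ++ nseq (k - a) m).
Proof.
have p0 r : sorted leq r = path leq 0%N r by case: r.
move=> hA; under eq_bigl do rewrite p0.
under [RHS]eq_bigr do under eq_bigl do rewrite p0.
rewrite words_top //; case: eqP => // m0; case: A hA => [_|a A /andP[]]; last by rewrite -m0.
rewrite big_nat_recl // [X in _ + X]big1 ?addr0; last by move=> i _; rewrite big_wordsS big_nil.
by rewrite [words _ 0]/(words _ _) big_cons big_nil /= addr0 ?subn0.
Qed.

Lemma words_sizeP A k r : r \in words A k -> size r = k /\ all (mem A) r.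
Proof.
elim: k r => [|k IH] r; first by rewrite inE => /eqP->.
rewrite [words A k.+1]iterS -/(words A k) => /allpairsP[[x v] /= [xA /IH[<- h] ->]].
by rewrite /= xA h.
Qed.

(** No entry can stand strictly below an m, so the lower row must end where the letters m of the
    upper row begin. *)
Lemma above_row_top m p c q e : all (ltn^~ m) p -> all (ltn^~ m) q ->
  (size q + e <= size p + c)%N ->
  above_row (p ++ nseq c m) (q ++ nseq e m) = (size q + e <= size p)%N && above_row p q.
Proof.
move=> hp hq hs; rewrite /above_row size_cat size_nseq.
have qm j : (nth 0%N (q ++ nseq e m) j <= m)%N.
  rewrite nth_cat; case: ltnP => hj; first exact/ltnW/(all_nthP 0%N hq).
  by rewrite nth_nseq; case: ifP.
apply/allP/andP => [H|[h1 /allP h2] j].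
  have h1 : (size q + e <= size p)%N.
    rewrite leqNgt; apply/negP => hlt; have /H : size p \in iota 0 (size q + e) by rewrite mem_iota.
    rewrite nth_cat ltnn subnn nth_nseq.
    have -> : (0 < c)%N by lia.
    by rewrite ltnNge qm.
  split=> //; apply/allP => j; rewrite mem_iota /= add0n => jq.
  have /H : j \in iota 0 (size q + e) by rewrite mem_iota /= add0n ltn_addr.
  by rewrite !nth_cat jq (leq_trans jq) //; lia.
rewrite mem_iota /= add0n => jq; have jp : (j < size p)%N by lia.
rewrite !nth_cat jp; case: (ltnP j (size q)) => hj; first by apply: h2; rewrite mem_iota.
by rewrite nth_nseq ltn_subLR // jq; apply: (all_nthP 0%N hp).
Qed.

(** [seqprod (ranges sh)] lists the mu that interlace with [sh], those for which sh / mu is a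
    horizontal strip. *)
Definition ranges (sh : seq nat) : seq (seq nat) :=
  [seq index_iota (nth 0%N sh j.+1) (nth 0%N sh j).+1 | j <- iota 0 (size sh)].

Arguments ranges : simpl never.

Lemma ranges_cons k sh : ranges (k :: sh) = index_iota (head 0%N sh) k.+1 :: ranges sh.
Proof. by rewrite /ranges /= nth0 (iotaDl 1 0) -map_comp. Qed.

Lemma sumn_interlaced sh mu : mu \in seqprod (ranges sh) -> (sumn mu <= sumn sh)%N.
Proof.
elim: sh mu => [|k sh IH] mu; first by rewrite inE => /eqP->.
rewrite ranges_cons => /allpairsP[[a v] /= [+ /IH h ->]] /=.
by rewrite mem_index_iota => /andP[_]; lia.
Qed.

(** The branching rule: the cells containing the largest letter m form a horizontal strip, and
    removing them leaves a tableau of an interlacing shape. *)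
Lemma rowsum_branch A m p c sh : all (ltn^~ m) A -> all (ltn^~ m) p ->
  sorted geq sh -> (head 0 sh <= size p + c)%N ->
  rowsum (rcons A m) (p ++ nseq c m) sh =
  if (head 0 sh <= size p)%N then
    \sum_(mu <- seqprod (ranges sh)) wt m ^+ (sumn sh - sumn mu) * rowsum A p mu
  else 0.
Proof.
move=> hA; elim: sh p c => [|k sh IH] p c hp hsh hk.
  by rewrite /= big_seq1 subnn expr0 mulr1.
rewrite [LHS]/= [head 0 _]/= big_mkcondr.
rewrite (words_top_sorted k (fun r => if above_row (p ++ nseq c m) r then
   wrow r * rowsum (rcons A m) r sh else 0) hA).
rewrite ranges_cons big_seqprod_cons.
have hsk : (head 0 sh <= k)%N by case: (sh) hsh => //= ? ? /andP[].
have {}hsh : sorted geq sh by case: (sh) hsh => //= ? ? /andP[].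
transitivity (\sum_(0 <= a < k.+1) if (k <= size p)%N && (head 0 sh <= a)%N then
   \sum_(q <- words A a | sorted leq q && above_row p q) wrow q * wt m ^+ (k - a) *
     \sum_(mu <- seqprod (ranges sh)) wt m ^+ (sumn sh - sumn mu) * rowsum A q mu else 0).
  rewrite big_nat [RHS]big_nat; apply: eq_bigr => a /andP[_ ak].
  have key q : q \in words A a -> (if above_row (p ++ nseq c m) (q ++ nseq (k - a) m) then
     wrow (q ++ nseq (k - a) m) * rowsum (rcons A m) (q ++ nseq (k - a) m) sh else 0) =
    if (k <= size p)%N && (head 0 sh <= a)%N && above_row p q then
     wrow q * wt m ^+ (k - a) *
     \sum_(mu <- seqprod (ranges sh)) wt m ^+ (sumn sh - sumn mu) * rowsum A q mu else 0.
    move=> /words_sizeP[sq qA]; have hq : all (ltn^~ m) q.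
      by apply/allP => z /(allP qA); apply: (allP hA).
    rewrite above_row_top // ?sq ?subnKC //.
    case: leqP => //= kp; rewrite IH //; last by rewrite sq; lia.
    rewrite sq; case: (leqP (head 0 sh)) => /= _; last by rewrite mulr0 if_same.
    by rewrite /wrow big_cat big_nseq /= iter_mulr_1.
  rewrite big_seq_cond; under eq_bigr => q /andP[qA _] do rewrite key //.
  rewrite -big_seq_cond; case: ifP => _ /=; last by rewrite big1.
  by rewrite big_mkcondr.
case: leqP => kp; last by rewrite big1.
rewrite -big_mkcond.
rewrite (@big_cat_nat _ _ _ (head 0%N sh) 0 k.+1) //=; last exact: leqW.
rewrite [X in X + _]big_nat_cond [X in X + _]big_pred0 ?add0r; last by move=> a; lia.
rewrite big_nat_cond [RHS]big_nat_cond; apply: eq_big => [a|a]; first by lia.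
move=> /andP[/andP[ha1 ha2] _]; under [RHS]eq_bigr do rewrite mulr_sumr.
rewrite exchange_big /=; apply: eq_bigr => q hq; rewrite mulr_sumr big_seq [RHS]big_seq.
apply: eq_bigr => mu /sumn_interlaced hmu.
have -> : (sumn (k :: sh) - sumn (a :: mu) = (k - a) + (sumn sh - sumn mu))%N by rewrite /=; lia.
by rewrite exprD /=; ring.
Qed.

Lemma rowsum_rcons0 A p sh : rowsum A p (rcons sh 0%N) = rowsum A p sh.
Proof.
elim: sh p => [|k sh IH] p /=; last by apply: eq_bigr => r _; rewrite IH.
by rewrite big_cons big_nil /= /wrow big_nil mulr1 addr0.
Qed.

Lemma nth_ranges sh j : (j < size sh)%N ->
  nth [::] (ranges sh) j = index_iota (nth 0%N sh j.+1) (nth 0%N sh j).+1.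
Proof. by move=> hj; rewrite (nth_map 0%N) ?size_iota // nth_iota. Qed.

Lemma seqprod_ranges sh mu j : mu \in seqprod (ranges sh) -> (j < size sh)%N ->
  (nth 0%N sh j.+1 <= nth 0%N mu j <= nth 0%N sh j)%N.
Proof.
move=> hmu hj; have := nth_seqprod 0%N hmu (_ : (j < size (ranges sh))%N).
by rewrite size_map size_iota nth_ranges // mem_index_iota ltnS => /(_ hj).
Qed.

Lemma rowsum_branch0 A m L sh : all (ltn^~ m) A -> (0 < m)%N ->
  sorted geq sh -> (head 0 sh <= L)%N ->
  rowsum (rcons A m) (nseq L 0%N) sh =
  \sum_(mu <- seqprod (ranges sh)) wt m ^+ (sumn sh - sumn mu) * rowsum A (nseq L 0%N) mu.
Proof.
move=> hA m0 hsh hL; have := @rowsum_branch A m (nseq L 0%N) 0 sh hA _ hsh _.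
rewrite cats0 size_nseq addn0 hL; apply=> //.
by apply/allP => x; rewrite mem_nseq => /andP[_ /eqP->].
Qed.

Lemma sorted_geq_nthS sh : sorted geq sh <-> forall j, (nth 0 sh j.+1 <= nth 0 sh j)%N.
Proof.
split=> [h j|h].
  case: (ltnP j.+1 (size sh)) => hj; last by rewrite [X in (X <= _)%N]nth_default.
  have /(sortedP 0%N) := h; exact.
by apply/(sortedP 0%N) => i _; apply: h.
Qed.

Lemma seqprod_ranges_sorted sh mu : mu \in seqprod (ranges sh) -> sorted geq mu.
Proof.
move=> hmu; apply/sorted_geq_nthS => j.
have smu : size mu = size sh by rewrite (size_seqprod hmu) size_map size_iota.
case: (ltnP j.+1 (size sh)) => hj; last by rewrite [X in (X <= _)%N]nth_default ?smu.
have /andP[_ h] := seqprod_ranges hmu hj; have /andP[h' _] := seqprod_ranges hmu (ltnW hj).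
exact: leq_trans h h'.
Qed.

Lemma seqprod_ranges_head sh mu L : mu \in seqprod (ranges sh) ->
  (head 0 sh <= L)%N -> (head 0 mu <= L)%N.
Proof.
move=> hmu; rewrite -!nth0; have smu : size mu = size sh by rewrite (size_seqprod hmu) size_map size_iota.
case: (posnP (size sh)) => hs; first by move=> _; rewrite nth_default ?smu ?hs.
by apply: leq_trans; have /andP[] := seqprod_ranges hmu hs.
Qed.

Lemma iota_rcons b r : iota b r.+1 = rcons (iota b r) (b + r)%N.
Proof. by rewrite -addn1 iotaD cats1. Qed.

Lemma iota_lt b r : all (ltn^~ (b + r)%N) (iota b r).
Proof. by apply/allP => x; rewrite mem_iota => /andP[_]. Qed.

(** Removing a letter moves a nonzero part up by at most one row, by interlacing; when no letter is
    left, a nonzero first row cannot be filled. *)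
Lemma rowsum_long b r L sh : sorted geq sh -> (head 0 sh <= L)%N -> (0 < nth 0 sh r)%N ->
  rowsum (iota b.+1 r) (nseq L 0%N) sh = 0.
Proof.
elim: r sh => [|r IH] sh hsh hL hr.
  case: sh hsh hL hr => //= k sh _ _ k0; rewrite big1_seq // => w /andP[_].
  case: k k0 => // k _; by rewrite [words _ _]iterS /=.
rewrite iota_rcons rowsum_branch0 ?iota_lt // big1_seq // => mu /andP[_ hmu].
have rs : (r < size sh)%N.
  by rewrite ltnNge; apply: contraL hr => hr; rewrite nth_default // leqW.
rewrite IH ?mulr0 //; first exact: seqprod_ranges_sorted hmu.
  exact: seqprod_ranges_head hmu hL.
by have /andP[h _] := seqprod_ranges hmu rs; apply: leq_trans h.
Qed.

Lemma rowsum_branch_rcons b r L sh : size sh = r.+1 ->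
  sorted geq sh -> (head 0 sh <= L)%N ->
  rowsum (iota b.+1 r.+1) (nseq L 0%N) sh =
  \sum_(mu <- seqprod (take r (ranges sh)))
     wt (b.+1 + r)%N ^+ (sumn sh - sumn mu) * rowsum (iota b.+1 r) (nseq L 0%N) mu.
Proof.
move=> ssh hsh hL; rewrite iota_rcons rowsum_branch0 ?iota_lt //.
have sr : size (ranges sh) = r.+1 by rewrite size_map size_iota.
have rE : ranges sh = rcons (take r (ranges sh)) (index_iota 0 (nth 0%N sh r).+1).
  rewrite -{1}[ranges sh]take_size sr (take_nth [::]) ?sr // nth_ranges ?ssh //.
  by rewrite [X in index_iota X]nth_default ?ssh.
rewrite {1}rE big_seqprod_rcons big_seq [RHS]big_seq; apply: eq_bigr => mu hmu.
have smu : size mu = r by rewrite (size_seqprod hmu) size_takel // sr.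
rewrite big_nat_recl // [X in _ + X]big1_seq ?addr0; last first.
  move=> a /andP[_]; rewrite mem_index_iota => /andP[_ ha].
  have hin : rcons mu a.+1 \in seqprod (ranges sh).
    by rewrite rE mem_seqprod_rcons ?hmu ?mem_index_iota // smu size_takel // sr.
  rewrite rowsum_long ?mulr0 //; first exact: seqprod_ranges_sorted hin.
    exact: seqprod_ranges_head hin hL.
  by rewrite nth_rcons smu ltnn eqxx.
by rewrite rowsum_rcons0 sumn_rcons addn0.
Qed.

End RowSums.

Section Alternants.
Variable R : comNzRingType.

Lemma altr_det r (y : 'I_r -> R) l : altr y l = \det (\matrix_(j, i) y i ^+ l j).
Proof. by apply: eq_bigr => s _; congr (_ * _); apply: eq_bigr => j _; rewrite mxE. Qed.

Lemma geometric_interval (x z : R) e a0 b : (a0 <= b)%N ->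
  x ^+ (e + b.+1) - z ^+ (b.+1 - a0) * x ^+ (e + a0) =
  (x - z) * \sum_(a <- index_iota a0 b.+1) z ^+ (b - a) * x ^+ (e + a).
Proof.
move=> ab; have -> : (e + b.+1 = (b.+1 - a0) + (e + a0))%N by lia.
rewrite exprD -mulrBl -opprB subrXX -mulNr opprB -mulrA; congr (_ * _).
rewrite mulr_suml -[in RHS](add0n a0) big_addn big_mkord; apply: eq_bigr => i _.
by rewrite -mulrA -exprD; congr (_ ^+ _ * _ ^+ _); have := ltn_ord i; lia.
Qed.

(** The branching rule for alternants. Row operations clear the column of z = y r except at the
    bottom; each remaining entry is divisible by y i - z, with a geometric sum over an interlacing
    range as quotient. *)
Lemma altr_branch r (y : nat -> R) sh : size sh = r.+1 -> sorted geq sh ->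
  altr (fun i : 'I_r.+1 => y i) (fun j => stair j + nth 0 sh j)%N =
  \prod_(i < r) (y i - y r) *
  \sum_(mu <- seqprod (take r (ranges sh))) y r ^+ (sumn sh - sumn mu) *
      altr (fun i : 'I_r => y i) (fun j => stair j + nth 0 mu j)%N.
Proof.
move=> ssh hsh; set z := y r; pose l (j : nat) := (r.+1 - j.+1 + nth 0 sh j)%N.
have lS j : (j < r)%N -> (l j.+1 < l j)%N.
  by move=> jr; rewrite /l; have /sorted_geq_nthS/(_ j) := hsh; lia.
rewrite altr_det; set A := \matrix_(_, _) _.
(* A unitriangular matrix: the row j + 1, scaled to the same power of z, is subtracted from the row
   j. *)
pose W := \matrix_(j < r.+1, k < r.+1)
  (if k == j then 1 else if k == j.+1 :> nat then - z ^+ (l j - l k) else 0).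
have dW : \det W = 1.
  rewrite -det_tr det_trig; last first.
    by apply/is_trig_mxP => i j ij; rewrite !mxE -val_eqE /= ltn_eqF // ltn_eqF // ltnW.
  by rewrite big1 // => i _; rewrite !mxE eqxx.
pose B := W *m A; transitivity (\det B); first by rewrite det_mulmx dW mul1r.
have AE (j i : 'I_r.+1) : A j i = y i ^+ l j by rewrite mxE.
have Bmax i : B ord_max i = y i ^+ l r.
  rewrite mxE (bigD1 ord_max) //= big1 ?addr0; last first.
    move=> k /negbTE kn; rewrite mxE kn; case: eqP => [E|_]; last by rewrite mul0r.
    by have := ltn_ord k; rewrite E ltnn.
  by rewrite mxE eqxx mul1r AE.
have Blift (j : 'I_r) i : B (lift ord_max j) i =
    y i ^+ l j - z ^+ (l j - l j.+1) * y i ^+ l j.+1.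
  have jr : (j.+1 < r.+1)%N by rewrite ltnS.
  have nj : Ordinal jr != lift ord_max j by rewrite -val_eqE /= /bump leqNgt ltn_ord /= gtn_eqF.
  rewrite mxE (bigD1 (lift ord_max j)) //= (bigD1 (Ordinal jr)) //= big1 ?addr0; last first.
    move=> k /andP[/negbTE k1 k2]; rewrite mxE k1 lift_max; case: eqP => [E|_]; last by rewrite mul0r.
    by case/eqP: k2; apply/val_inj.
  by rewrite !AE !mxE eqxx mul1r (negbTE nj) lift_max /= eqxx mulNr.
rewrite (expand_det_col _ ord_max) (bigD1 ord_max) //= big1 ?addr0; last first.
  move=> k kn; have [j ->] : exists j, k = lift ord_max j.
    by case: (unliftP ord_max k) kn => [j ->|->]; [exists j|rewrite eqxx].
  by rewrite Blift -exprD subnK ?subrr ?mul0r // ltnW // lS.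
rewrite Bmax /cofactor -signr_odd addnn odd_double expr0 mul1r.
rewrite -[r in l r]/(nat_of_ord (@ord_max r)) -/z.
have lr : l r = nth 0%N sh r by rewrite /l subnn.
(* The quotients of the entries by y i - z, from [geometric_interval]. *)
pose D := \matrix_(j < r, i < r)
  \sum_(a <- nth [::] (take r (ranges sh)) j) z ^+ (nth 0%N sh j - a) * y i ^+ (stair j + a).
have -> : row' ord_max (col' ord_max B) = D *m diag_mx (\row_i (y i - z)) :> 'M[R]_r.
  apply/matrixP => j i; rewrite mul_mx_diag [LHS]mxE [LHS]mxE Blift lift_max !mxE [RHS]mulrC.
  rewrite nth_take ?ltn_ord // nth_ranges; last by rewrite ssh ltnS ltnW ?ltn_ord.
  rewrite -geometric_interval; last by have /sorted_geq_nthS := hsh; exact.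
  have jr : (j < r)%N := ltn_ord j.
  congr (_ ^+ _ - _ ^+ _ * _ ^+ _); rewrite /l /stair; have /sorted_geq_nthS/(_ j) := hsh; lia.
rewrite det_mulmx det_diag [\det D * _]mulrC mulrCA; congr (_ * _).
  by apply: eq_bigr => i _; rewrite mxE.
have srs : size (take r (ranges sh)) = r by rewrite size_takel // size_map size_iota ssh.
transitivity (\sum_(s : 'S_r) \sum_(mu <- seqprod (take r (ranges sh)))
   z ^+ l r * ((-1) ^+ s * \prod_(j < r)
     (z ^+ (nth 0%N sh j - nth 0%N mu j) * y (s j) ^+ (stair j + nth 0%N mu j)))).
  rewrite mulr_sumr; apply: eq_bigr => s _; rewrite -mulr_sumr -mulr_sumr; congr (_ * (_ * _)).
  under eq_bigr do rewrite mxE.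
  by rewrite (prod_sum_seqprod 0%N).
rewrite exchange_big /= big_seq [RHS]big_seq; apply: eq_bigr => mu hmu.
rewrite mulr_sumr; apply: eq_bigr => s _; rewrite big_split /= mulrCA [RHS]mulrCA; congr (_ * _).
rewrite mulrA; congr (_ * _); rewrite prodrXr -exprD lr; congr (_ ^+ _).
have smu : size mu = r by rewrite (size_seqprod hmu).
have le j : (j < r)%N -> (nth 0%N mu j <= nth 0%N sh j)%N.
  move=> jr; have := nth_seqprod 0%N hmu (_ : (j < size (take r (ranges sh)))%N).
  rewrite srs nth_take // nth_ranges ?ssh ?leqW // => /(_ jr).
  by rewrite mem_index_iota => /andP[].
have sumE e : sumn e = (\sum_(j < size e) nth 0%N e j)%N by rewrite sumnE (big_nth 0%N) big_mkord.
rewrite !sumE ssh smu big_ord_recr /=.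
rewrite [X in (_ = X - _)%N]addnC -addnBA; last by apply: leq_sum => j _; apply: le.
by rewrite sumnB // => j _; apply: le.
Qed.

End Alternants.

Definition vdm (R : comNzRingType) r (y : nat -> R) : R :=
  \prod_(k < r) \prod_(i < k) (y i - y k).

(** The bialternant formula: both sides obey the same branching recursion in the last variable,
    whose extra factors build up the Vandermonde product. *)
Lemma altr_rowsum (R : comNzRingType) (wt : nat -> R) b r L sh : size sh = r ->
  sorted geq sh -> (head 0 sh <= L)%N ->
  altr (fun i : 'I_r => wt (b.+1 + i)%N) (fun j => stair j + nth 0 sh j)%N =
  vdm r (fun i => wt (b.+1 + i)%N) * rowsum wt (iota b.+1 r) (nseq L 0%N) sh.
Proof.
elim: r sh => [|r IH] sh ssh hsh hL.
  by rewrite altr_det det_mx00 /vdm big_ord0 mul1r (size0nil ssh).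
rewrite (altr_branch (fun i => wt (b.+1 + i)%N)) // rowsum_branch_rcons //.
rewrite /vdm big_ord_recr /= [X in _ = X * _]mulrC -[RHS]mulrA; congr (_ * _).
rewrite mulr_sumr big_seq [RHS]big_seq; apply: eq_bigr => mu hmu.
have sr : size (ranges sh) = r.+1 by rewrite size_map size_iota.
have smu : size mu = r by rewrite (size_seqprod hmu) size_takel // sr.
have hin : rcons mu 0%N \in seqprod (ranges sh).
  rewrite -[ranges sh]take_size sr (take_nth [::]) ?sr // nth_ranges ?ssh //.
  rewrite mem_seqprod_rcons ?hmu ?smu ?size_takel ?sr // mem_index_iota /=.
  by rewrite nth_default ?ssh.
rewrite IH //.
- by rewrite mulrCA.
- by have := seqprod_ranges_sorted hin; rewrite -cats1 => /cat_sorted2[].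
- have := seqprod_ranges_head hin hL; case: (mu) => //.
Qed.

Section SchurRowsum.
Variables (R : comNzRingType) (wt : nat -> R).

Lemma rowsum_fillings A p sh : rowsum wt A p sh =
  \sum_(T <- fillings A sh | all (sorted leq) T && path above_row p T)
     \prod_(r <- T) \prod_(x <- r) wt x.
Proof.
elim: sh p => [|k sh IH] p; first by rewrite /= big_cons !big_nil /= addr0.
rewrite [fillings _ _]/= big_mkcond big_allpairs_dep /= big_mkcond; apply: eq_bigr => r _.
case: ifP => [/andP[h1 h2]|h].
  rewrite IH mulr_sumr big_mkcond; apply: eq_bigr => T _.
  by rewrite h1 h2 /=; case: ifP => // _; rewrite big_cons.
by rewrite big1 // => T _; case: ifP => // /andP[/andP[h1 _] /andP[h2 _]]; rewrite h1 h2 in h.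
Qed.

Lemma fillingsP A sh T : T \in fillings A sh ->
  shape T = sh /\ all (all (mem A)) T.
Proof.
elim: sh T => [|k sh IH] T; first by rewrite inE => /eqP->.
by case/allpairsP => -[r T'] /= [/words_sizeP[<- hr] /IH[<- hT] ->] /=; rewrite hr hT.
Qed.

End SchurRowsum.

(** All entries are positive, so a row of zeros on top constrains nothing, whatever its length L. *)
Lemma schur_rowsum M b b' alpha L : is_part alpha ->
  schur M b b' alpha = rowsum (xvar M) (iota b.+1 (b' - b)) (nseq L 0%N) alpha.
Proof.
move=> pa; rewrite rowsum_fillings /schur big_seq_cond [RHS]big_seq_cond.
apply: eq_bigl => T; case: (boolP (T \in _)) => //= /fillingsP[sT hT].
have hT' : all (all (leq 1)) T.
  by apply: sub_all hT => r; apply: sub_all => x /=; rewrite mem_iota => /andP[]; lia.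
rewrite /is_ssyt sT pa hT' /=; congr (_ && _).
case: T hT' {sT hT} => //= r T /andP[hr _].
rewrite (_ : above_row _ _) //; apply/allP => j; rewrite mem_iota /= add0n => jr.
by rewrite nth_nseq if_same; apply: (all_nthP 0%N hr).
Qed.

Lemma rowsum_nseq0 (R : comNzRingType) (wt : nat -> R) A p sh k :
  rowsum wt A p (sh ++ nseq k 0%N) = rowsum wt A p sh.
Proof.
elim: k => [|k IH]; first by rewrite cats0.
by rewrite -IH -[in RHS]rowsum_rcons0 -cats1 -catA -[[:: 0%N]]/(nseq 1 0%N) -nseqD addn1.
Qed.

Lemma schur_long M b b' alpha : is_part alpha -> (b' - b < size alpha)%N ->
  schur M b b' alpha = 0.
Proof.
move=> pa hs; rewrite (schur_rowsum _ _ _ (head 0%N alpha)) // rowsum_long //.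
  by case/andP: pa.
case/andP: pa => _; apply: contraR; rewrite -leqNgt leqn0 => /eqP <-; exact: mem_nth.
Qed.

Lemma sorted_geq_pad alpha k : sorted geq alpha -> sorted geq (alpha ++ nseq k 0%N).
Proof.
move=> /sorted_geq_nthS h; apply/sorted_geq_nthS => j; rewrite !nth_cat !nth_nseq !if_same.
by case: ltnP => // hj; rewrite (ltnW hj); apply: h.
Qed.

Lemma altr_schur M b b' alpha : is_part alpha -> (size alpha <= b' - b)%N ->
  altr (fun i : 'I_(b' - b) => xvar M (b.+1 + i)%N) (fun j => stair j + nth 0 alpha j)%N =
  vdm (b' - b) (fun i => xvar M (b.+1 + i)%N) * schur M b b' alpha.
Proof.
move=> pa hs; set k := (b' - b - size alpha)%N; have /andP[sa _] := pa.
rewrite (schur_rowsum _ _ _ (head 0%N (alpha ++ nseq k 0%N))) //.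
rewrite -(@rowsum_nseq0 _ _ _ _ _ k) -altr_rowsum //.
- apply: eq_bigr => s _; congr (_ * _); apply: eq_bigr => j _.
  rewrite nth_cat; case: ltnP => // hj.
  by rewrite nth_nseq if_same nth_default.
- by rewrite size_cat size_nseq subnKC.
- exact: sorted_geq_pad.
Qed.

Lemma vdm_xvar_neq0 M b b' : (b' <= M)%N ->
  vdm (b' - b) (fun i => xvar M (b.+1 + i)%N) != 0.
Proof.
move=> hM; apply/prodf_neq0 => k _; apply/prodf_neq0 => i _.
have kM : (b + k < M)%N by have := ltn_ord k; lia.
have iM : (b + i < M)%N by have := ltn_ord i; have := ltn_ord k; lia.
rewrite !addSn (xvarS (Ordinal kM)) (xvarS (Ordinal iM)); apply: mpolyX_sub_neq0.
by rewrite -val_eqE /= eqn_add2l ltn_eqF.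
Qed.

(** * Tableaux as sequences of columns *)

Section Transpose.
Implicit Types X Y T : seq (seq nat).

Definition trp X : seq (seq nat) := [seq tab_col X k | k <- iota 0 (size (head [::] X))].

Lemma nth_shape X i : nth 0%N (shape X) i = size (nth [::] X i).
Proof.
by case: (ltnP i (size X)) => h; [rewrite (nth_map [::])|rewrite !nth_default // size_map].
Qed.

Lemma size_row_geq X i : sorted geq (shape X) ->
  (size (nth [::] X i) <= size (head [::] X))%N.
Proof.
move=> /sorted_geq_nthS hX; rewrite -nth0; elim: i => // i IH; apply: leq_trans IH.
by rewrite -!nth_shape.
Qed.

Lemma tab_col_cons r X k :
  tab_col (r :: X) k = if (k < size r)%N then nth 0%N r k :: tab_col X k else tab_col X k.
Proof. by rewrite /tab_col /=; case: ifP. Qed.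

Lemma tab_colP X k i : sorted geq (shape X) ->
  ((i < size (tab_col X k))%N = (k < size (nth [::] X i))%N) *
  ((k < size (nth [::] X i))%N -> nth 0%N (tab_col X k) i = nth 0%N (nth [::] X i) k).
Proof.
elim: X i => [|r X IH] i hX; first by rewrite nth_nil.
have hX' : sorted geq (shape X) by case: (X) hX => //= ? ? /andP[].
rewrite tab_col_cons; case: (ltnP k (size r)) => hk; last first.
  have h0 : tab_col X k = [::].
    apply: size0nil; apply/eqP; rewrite -leqn0 leqNgt (IH 0%N hX') -leqNgt.
    by apply: leq_trans hk; have /= := size_row_geq 1 hX.
  have := size_row_geq i hX; rewrite h0 /= => /leq_trans/(_ hk) h.
  by rewrite [(k < _)%N]ltnNge h.
case: i => [|i] /=; first by rewrite hk.
by split; [rewrite ltnS (IH i hX')|move=> h; rewrite (IH i hX')].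
Qed.

(** Transposition is an involution, stated through cells so that it also applies to lists of columns
    that end in empty ones. *)
Lemma tab_col_swap X Y : sorted geq (shape X) -> sorted geq (shape Y) ->
  (forall j, nth [::] X j = tab_col Y j) -> forall k, tab_col X k = nth [::] Y k.
Proof.
move=> hX hY E k; have H j : (j < size (tab_col X k))%N = (j < size (nth [::] Y k))%N.
  by rewrite tab_colP // E tab_colP.
have es : size (tab_col X k) = size (nth [::] Y k).
  by apply/eqP; rewrite eqn_leq leqNgt H ltnn leqNgt -H ltnn.
apply: (eq_from_nth (x0 := 0%N)) => // j hj.
have hk : (k < size (nth [::] X j))%N by rewrite -tab_colP.
by rewrite tab_colP // E tab_colP // -H.
Qed.

Lemma tab_col_ge X k : sorted geq (shape X) -> (size (head [::] X) <= k)%N -> tab_col X k = [::].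
Proof.
by move=> hX hk; apply: size0nil; apply/eqP; rewrite -leqn0 leqNgt tab_colP // nth0 -leqNgt.
Qed.

Lemma nth_trp X j : sorted geq (shape X) -> nth [::] (trp X) j = tab_col X j.
Proof.
move=> hX; case: (ltnP j (size (head [::] X))) => h.
  by rewrite (nth_map 0%N) ?size_iota // nth_iota.
by rewrite nth_default ?size_map ?size_iota // tab_col_ge.
Qed.

Lemma size_tab_col X k : size (tab_col X k) = count (fun r => k < r)%N (shape X).
Proof. by rewrite size_map size_filter /shape count_map. Qed.

Lemma shape_trp X : shape (trp X) = conj_part (shape X).
Proof.
rewrite /shape -map_comp /conj_part; have -> : head 0%N [seq size r | r <- X] = size (head [::] X) by case: X.
by apply: eq_map => k /=; rewrite size_tab_col.
Qed.

Lemma conj_partP s : is_part (conj_part s).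
Proof.
apply/andP; split.
  apply/(sortedP 0%N) => i; rewrite size_map size_iota => hi.
  rewrite !(nth_map 0%N) ?size_iota ?(ltnW hi) // !nth_iota ?(ltnW hi) //=.
  by apply: sub_count => x /ltnW.
apply/mapP => -[k]; rewrite mem_iota /= add0n; case: s => //= x s ->.
by rewrite add1n.
Qed.

Lemma trpK X : is_part (shape X) -> trp (trp X) = X.
Proof.
move=> /andP[hX nz]; have /andP[hT _] : is_part (shape (trp X)) by rewrite shape_trp conj_partP.
have E k : tab_col (trp X) k = nth [::] X k by apply: tab_col_swap => // j; apply: nth_trp.
have pos i : (i < size X)%N -> (0 < size (nth [::] X i))%N.
  move=> hi; rewrite lt0n; apply: contra nz => /eqP <-.
  by rewrite -nth_shape mem_nth // size_map.
have sX : size (head [::] (trp X)) = size X.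
  rewrite -nth0 nth_trp //; apply/eqP; rewrite eqn_leq; apply/andP; split; rewrite leqNgt; apply/negP => h.
    by move: h; rewrite tab_colP // nth_default.
  by have := pos _ h; rewrite -tab_colP // ltnn.
apply: (eq_from_nth (x0 := [::])); first by rewrite size_map size_iota sX.
by move=> i _; rewrite nth_trp.
Qed.

Lemma conj_partK s : is_part s -> conj_part (conj_part s) = s.
Proof.
move=> hs; pose X := [seq nseq k 0%N | k <- s].
have sX : shape X = s by rewrite /shape -map_comp map_id_in // => k _; rewrite /= size_nseq.
by rewrite -{1}sX -!shape_trp trpK // sX.
Qed.

End Transpose.

Definition conjp (s : seq nat) : intpart := IntPart (conj_partP s).

Section TableauColumns.
Variables (r t0 d : nat).
Implicit Types (c : columns r) (T : tableau).

Definition col_seq c : seq (seq nat) := [seq c j | j <- enum 'I_r].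

Definition tab_of c : tableau := trp (col_seq c).

Lemma nth_col_seq c (j : 'I_r) : nth [::] (col_seq c) j = c j.
Proof. by rewrite (nth_map j) ?size_enum_ord // nth_ord_enum. Qed.

Lemma size_col_seq c : size (col_seq c) = r.
Proof. by rewrite size_map size_enum_ord. Qed.

Definition tab_cols T : columns r := [ffun j : 'I_r => tab_col T j].

Definition bounded_tab T := [&& is_ssyt T, all (all (fun k => t0 <= k < t0 + d)%N) T
  & size (head [::] T) <= r]%N.

Lemma col_seq_sorted c : c \in ssyt_cols r t0 d -> sorted geq (shape (col_seq c)).
Proof.
rewrite mem_ssyt_cols => /ssyt_colsbP[h1 h2]; apply/sorted_geq_nthS => j; rewrite !nth_shape.
case: (ltnP j.+1 r) => hj; last by rewrite nth_default // size_col_seq.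
rewrite (nth_col_seq c (Ordinal hj)) (nth_col_seq c (Ordinal (ltnW hj))).
by have /andP[] := h2 (Ordinal (ltnW hj)) (Ordinal hj) erefl.
Qed.

Lemma tab_ofK c : c \in ssyt_cols r t0 d -> tab_cols (tab_of c) = c.
Proof.
move=> hc; apply/ffunP => j; rewrite ffunE -nth_col_seq; have hs := col_seq_sorted hc.
apply: tab_col_swap => // [|k]; last exact: nth_trp.
by rewrite shape_trp; case/andP: (conj_partP (shape (col_seq c))).
Qed.

Lemma tab_of_bounded c : (0 < t0)%N -> c \in ssyt_cols r t0 d -> bounded_tab (tab_of c).
Proof.
move=> t00 hc; have hs := col_seq_sorted hc; have hc' := hc.
move: hc'; rewrite mem_ssyt_cols => /ssyt_colsbP[h1 h2].
have hent i j : (j < size (nth [::] (tab_of c) i))%N -> exists2 hj : (j < r)%N,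
    (i < size (c (Ordinal hj)))%N & nth 0%N (nth [::] (tab_of c) i) j = nth 0%N (c (Ordinal hj)) i.
  rewrite nth_trp // tab_colP // => hi.
  have hj : (j < r)%N by rewrite ltnNge; apply: contraL hi => hj; rewrite nth_default // size_col_seq.
  exists hj; first by rewrite -nth_col_seq.
  by rewrite tab_colP // (nth_col_seq c (Ordinal hj)).
have hrange : all (all (fun k => t0 <= k < t0 + d)%N) (tab_of c).
  apply/(all_nthP [::]) => i hi; apply/(all_nthP 0%N) => j /hent[hj hij ->].
  by have [_ /(all_nthP 0%N)] := h1 (Ordinal hj); apply.
have hpart : is_part (shape (tab_of c)) by rewrite shape_trp conj_partP.
apply/and3P; split=> //; last first.
  by rewrite -nth0 nth_trp // size_tab_col /shape count_map -[X in (_ <= X)%N](size_col_seq c) count_size.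
apply/and4P; split=> //.
- by apply: sub_all hrange => s; apply: sub_all => k /andP[]; lia.
- apply/(all_nthP [::]) => i hi; apply/(sortedP 0%N) => j hj.
  have [hj1 hi1 ->] := hent i _ hj; have [hj0 hi0 ->] := hent i j (ltnW hj).
  have /andP[_ /allP] := h2 (Ordinal hj0) (Ordinal hj1) erefl; apply.
  by rewrite mem_iota.
- apply/(sortedP [::]) => i hi; apply/allP => j; rewrite mem_iota /= add0n => hj.
  have [hj1 hi1 ->] := hent i.+1 j hj.
  have hj' : (j < size (nth [::] (tab_of c) i))%N.
    by apply: leq_trans hj _; have /andP[/sorted_geq_nthS/(_ i)] := hpart; rewrite !nth_shape.
  have [hj0 hi0 ->] := hent i j hj'; rewrite (bool_irrelevance hj0 hj1).
  by have [/(sortedP 0%N) + _] := h1 (Ordinal hj1); apply.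
Qed.

Lemma tab_colsK T : bounded_tab T -> tab_of (tab_cols T) = T.
Proof.
case/and3P => /and4P[/andP[hT nz] _ _ _] _ hr.
have E j : nth [::] (col_seq (tab_cols T)) j = tab_col T j.
  case: (ltnP j r) => hj; first by rewrite (nth_col_seq _ (Ordinal hj)) ffunE.
  by rewrite nth_default ?size_col_seq // tab_col_ge // (leq_trans hr).
have hs : sorted geq (shape (col_seq (tab_cols T))).
  apply/sorted_geq_nthS => j; rewrite !nth_shape !E !size_tab_col.
  by apply: sub_count => x /ltnW.
rewrite -[RHS]trpK /is_part ?hT //; rewrite /tab_of.
have hT' : sorted geq (shape (trp T)) by rewrite shape_trp; case/andP: (conj_partP (shape T)).
(* The list [col_seq] pads the columns with empty ones up to r. Its transpose has as many rows as
   the first column is long, and this column is unaffected by the padding. *)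
have hh : head [::] (col_seq (tab_cols T)) = head [::] (trp T) by rewrite -!nth0 E nth_trp.
rewrite /trp -/(trp T) hh; apply: eq_map => k.
have E' : tab_col (col_seq (tab_cols T)) k = nth [::] T k by apply: tab_col_swap.
by rewrite E'; apply/esym/tab_col_swap => // j; apply: nth_trp.
Qed.

Lemma tab_cols_mem T : bounded_tab T -> tab_cols T \in ssyt_cols r t0 d.
Proof.
case/and3P => /and4P[/andP[hT nz] _ /allP hrow /(sortedP [::]) hab] hrange hr.
rewrite mem_ssyt_cols; apply/ssyt_colsbP; split=> [j|i j ij]; rewrite !ffunE.
  split.
    apply/(sortedP 0%N) => k hk.
    have a1 : (j < size (nth [::] T k.+1))%N by rewrite -tab_colP.
    have a0 : (j < size (nth [::] T k))%N by rewrite -tab_colP // ltnW.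
    have hkT : (k.+1 < size T)%N by rewrite ltnNge; apply: contraL a1 => ?; rewrite nth_default.
    rewrite /= !tab_colP //; have /allP := hab k hkT; apply.
    by rewrite mem_iota.
  apply/(all_nthP 0%N) => k hk.
  have a0 : (j < size (nth [::] T k))%N by rewrite -tab_colP.
  have hkT : (k < size T)%N by rewrite ltnNge; apply: contraL a0 => ?; rewrite nth_default.
  by rewrite tab_colP //; have /(all_nthP 0%N) := all_nthP [::] hrange k hkT; apply.
apply/andP; split.
  by rewrite !size_tab_col; apply: sub_count => x; rewrite ij => /ltnW.
apply/allP => k; rewrite mem_iota /= add0n => hk.
have hk1 : (j < size (nth [::] T k))%N by rewrite -tab_colP.
have hk0 : (i < size (nth [::] T k))%N by apply: leq_ltn_trans hk1; rewrite ij.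
have hkT : (k < size T)%N by rewrite ltnNge; apply: contraL hk0 => ?; rewrite nth_default.
rewrite !tab_colP // ij; have /(sortedP 0%N) := hrow _ (mem_nth [::] hkT); apply.
by rewrite -ij.
Qed.

Definition tabs : seq tableau := [seq tab_of c | c <- ssyt_cols r t0 d].

Lemma mem_tabs T : (0 < t0)%N -> (T \in tabs) = bounded_tab T.
Proof.
move=> t00; apply/mapP/idP => [[c hc ->]|hT]; first exact: tab_of_bounded.
by exists (tab_cols T); [exact: tab_cols_mem|rewrite tab_colsK].
Qed.

Lemma tabs_uniq : uniq tabs.
Proof.
rewrite map_inj_in_uniq ?ssyt_cols_uniq // => c c' hc hc' E.
by rewrite -(tab_ofK hc) E tab_ofK.
Qed.

Lemma col_word_tab_of c : c \in ssyt_cols r t0 d ->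
  col_word (tab_of c) = flatten [seq rev (c j) | j <- enum 'I_r].
Proof.
move=> hc; have hs := col_seq_sorted hc.
have hT : sorted geq (shape (tab_of c)) by rewrite shape_trp; case/andP: (conj_partP (shape (col_seq c))).
have E k : tab_col (tab_of c) k = nth [::] (col_seq c) k.
  by apply: tab_col_swap => // j; apply: nth_trp.
rewrite /col_word; set h := size _.
have hr : (h <= r)%N.
  rewrite /h -nth0 nth_trp // size_tab_col /shape count_map -[X in (_ <= X)%N](size_col_seq c).
  exact: count_size.
transitivity (flatten [seq rev (nth [::] (col_seq c) j) | j <- iota 0 r]).
  rewrite -(subnKC hr) iotaD map_cat flatten_cat add0n -[LHS]cats0; congr (_ ++ _).
    by congr flatten; apply: eq_map => j; rewrite E.
  suff : all (pred1 [::]) [seq rev (nth [::] (col_seq c) j) | j <- iota h (r - h)].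
    by elim: (map _ _) => //= x s IH /andP[/eqP-> /IH].
  apply/allP => x /mapP[j]; rewrite mem_iota => /andP[hj _] ->.
  by rewrite -E tab_col_ge.
rewrite -val_enum_ord -map_comp; congr flatten; apply: eq_map => j /=.
by rewrite nth_col_seq.
Qed.

Lemma conj_shape_tab_of c j : c \in ssyt_cols r t0 d ->
  nth 0%N (conj_part (shape (tab_of c))) j = size (nth [::] (col_seq c) j).
Proof.
move=> hc; have hs := col_seq_sorted hc.
have hT : sorted geq (shape (tab_of c)) by rewrite shape_trp; case/andP: (conj_partP (shape (col_seq c))).
rewrite -shape_trp nth_shape nth_trp //; congr size.
by apply: tab_col_swap => // k; apply: nth_trp.
Qed.

End TableauColumns.

(** * Products of commuting transpositions *)

Section ElemIndependence.
Variable n : nat.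
Local Notation P := {mpoly int[n]}.

Lemma msym_tpermX (i j k : 'I_n) : msym (tperm i j) 'X_k = 'X_(tperm i j k) :> P.
Proof.
rewrite msymX; congr mpolyX; apply/mnmP => l; rewrite mnmE !mnm1E tpermV.
by rewrite (can2_eq (tpermK i j) (tpermK i j)).
Qed.

Definition symm_upto q (f : P) :=
  forall i j : 'I_n, (i < q)%N -> (j < q)%N -> msym (tperm i j) f = f.

Lemma symm_elem r k : symm_upto r (elem n r k).
Proof.
move=> i j ir jr; set s := tperm i j.
have sr l : (s l < r)%N = (l < r)%N.
  by rewrite /s; case: tpermP => [->|->|]; rewrite ?ir ?jr.
rewrite /elem raddf_sum /=.
rewrite [RHS](reindex (fun h : {set 'I_n} => s @: h)) /=; last first.
  exists (fun h : {set 'I_n} => s @: h) => h _; rewrite -imset_comp (eq_imset (g := id)) ?imset_id //;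
  by move=> l; rewrite /= tpermK.
apply: eq_big => [h|h _].
  rewrite card_imset; last exact: perm_inj.
  congr (_ && _); apply/forallP/forallP => H l; apply/implyP.
    by case/imsetP => l' hl' ->; rewrite sr; apply: (implyP (H l')).
  by move=> hl; have /implyP := H (s l); rewrite sr imset_f // => ->.
rewrite rmorph_prod big_imset /=; last by move=> ? ? _ _; exact: perm_inj.
by apply: eq_bigr => l _; rewrite msym_tpermX.
Qed.

Lemma elem0 r : elem n r 0 = 1.
Proof.
rewrite /elem (big_pred1 set0) ?big_set0 // => h; rewrite cards_eq0 andb_idr //.
by move/eqP->; apply/forallP => i; rewrite in_set0.
Qed.

Lemma elemS r k (hr : (r < n)%N) :
  elem n r.+1 k.+1 = elem n r k.+1 + 'X_(Ordinal hr) * elem n r k.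
Proof.
set x := Ordinal hr; rewrite /elem (bigID (fun h : {set 'I_n} => x \in h)) /= addrC.
congr (_ + _).
  apply: eq_bigl => h; rewrite -andbA; congr (_ && _).
  apply/andP/forallP => [[/forallP H xh] i|H].
    apply/implyP => ih; have := implyP (H i) ih; rewrite ltnS leq_eqVlt => /predU1P[E|//].
    by case/negP: xh; have <- : i = x by apply/val_inj.
  split; last by apply/negP => xh; have := implyP (H x) xh; rewrite ltnn.
  by apply/forallP => i; apply/implyP => ih; apply: leqW; exact: (implyP (H i)).
rewrite mulr_sumr (reindex_onto (fun h => x |: h) (fun h => h :\ x)) /=; last first.
  by move=> h /andP[_ xh]; rewrite setD1K.
have E (h : {set 'I_n}) : ((#|x |: h| == k.+1) && [forall i in x |: h, (i < r.+1)%N] && (x \in x |: h)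
    && ((x |: h) :\ x == h)) = (#|h| == k) && [forall i in h, (i < r)%N].
  rewrite setU11 andbT; case: (boolP (x \in h)) => xh.
    rewrite (_ : (_ == h) = false); last first.
      by apply/negP => /eqP /setP /(_ x); rewrite !inE eqxx xh.
    rewrite andbF; apply/esym/negbTE; rewrite negb_and; apply/orP; right.
    by apply/forallPn; exists x; rewrite xh ltnn.
  rewrite setU1K // eqxx andbT cardsU1 xh eqSS; congr (_ && _).
  apply/forallP/forallP => H i; apply/implyP => ih.
    have := implyP (H i); rewrite !inE ih orbT => /(_ isT).
    rewrite ltnS leq_eqVlt => /predU1P[E|//].
    by case/negP: xh; have <- : i = x by apply/val_inj.
  move: ih; rewrite !inE => /predU1P[->|ih]; first exact: ltnSn.
  by apply: leqW; exact: (implyP (H i)).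
apply: eq_big => // h; rewrite E => /andP[_ /forallP H]; rewrite big_setU1 //.
by apply/negP => xh; have := implyP (H x) xh; rewrite ltnn.
Qed.

Lemma elem_gt r k : (r <= n)%N -> (r < k)%N -> elem n r k = 0.
Proof.
elim: r k => [|r IH] [|k] // hr hk.
  rewrite /elem big_pred0 // => h; apply/negP => /andP[/eqP hc /forallP H].
  have /card_gt0P[i ih] : (0 < #|h|)%N by rewrite hc.
  by have := implyP (H i) ih.
by rewrite (elemS _ hr) !IH ?mulr0 ?addr0 // ltnW.
Qed.

(** Its value at a variable x_j with j <= r + 1 is the i-th elementary symmetric polynomial in x_1,
    .., x_(r+1) without x_j. *)
Fixpoint elem_poly r i : {poly P} :=
  if i is i'.+1 then (elem n r.+1 i)%:P - 'X * elem_poly r i' else 1.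

Lemma elem_poly_last r i (hr : (r < n)%N) : (elem_poly r i).['X_(Ordinal hr)] = elem n r i.
Proof.
elim: i => [|i IH]; first by rewrite /= hornerC elem0.
by rewrite /= hornerD hornerN hornerC hornerM hornerX IH (elemS _ hr) addrK.
Qed.

Lemma elem_poly_swap r i (hr : (r < n)%N) (j : 'I_n) : (j <= r)%N ->
  msym (tperm j (Ordinal hr)) (elem_poly r i).['X_(Ordinal hr)] = (elem_poly r i).['X_j].
Proof.
move=> jr; elim: i => [|i IH]; first by rewrite /= !hornerC msym1.
rewrite /= !(hornerD, hornerN, hornerM, hornerX, hornerC) msymB msymM IH msym_tpermX tpermR.
by rewrite symm_elem //= ltnS.
Qed.

Lemma size_elem_poly r i : size (elem_poly r i) = i.+1 /\ (elem_poly r i)`_i = (-1) ^+ i.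
Proof.
elim: i => [|i [IHs IHc]]; first by rewrite /= size_poly1 coefC.
have h0 : elem_poly r i != 0 by rewrite -size_poly_gt0 IHs.
split; last by rewrite [elem_poly _ _]/= coefB coefC coefXM /= IHc sub0r exprS mulN1r.
rewrite [elem_poly _ _]/= addrC ['X * _]mulrC size_polyDl size_polyN size_mulX ?IHs //.
by apply: leq_ltn_trans (size_polyC_leq1 _) _.
Qed.

(** [elem_poly r i] has degree exactly i and leading coefficient 1 or -1, so the top coefficient of
    the relation kills the last a. *)
Lemma elem_poly_free r k (a : nat -> P) :
  \sum_(i < k) (a i)%:P * elem_poly r i = 0 -> forall i, (i < k)%N -> a i = 0.
Proof.
elim: k => // k IH E.
have sz : (size (\sum_(i < k) (a i)%:P * elem_poly r i)%R <= k)%N.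
  apply: leq_trans (size_sum _ _ _) _; apply/bigmax_leqP => i _.
  rewrite mul_polyC; apply: leq_trans (size_scale_leq _ _) _.
  by rewrite (size_elem_poly r i).1.
have ak : a k = 0.
  move/(congr1 (fun q : {poly P} => q`_k)): E; rewrite big_ord_recr /= coefD coef0 nth_default //.
  rewrite add0r coefCM (size_elem_poly r k).2 => /eqP; rewrite mulf_eq0 => /orP[/eqP //|].
  by rewrite signr_eq0.
move=> i; rewrite ltnS leq_eqVlt => /predU1P[->//|]; apply: IH.
by move: E; rewrite big_ord_recr /= ak mul0r addr0.
Qed.

(* Exchanging x_(r+1) with x_1, .., x_r turns the relation into a polynomial of
   degree at most r with r + 1 roots. *)
Lemma elem_symm_free r (a : nat -> P) : (r < n)%N -> (forall i, symm_upto r.+1 (a i)) ->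
  \sum_(i < r.+1) a i * elem n r i = 0 -> forall i, (i <= r)%N -> a i = 0.
Proof.
move=> hr ha E; apply: (@elem_poly_free r r.+1 a).
set Q := \sum_(_ < _) _; pose x := Ordinal hr.
have Qx : Q.['X_x] = 0.
  rewrite horner_sum -[RHS]E; apply: eq_bigr => i _.
  by rewrite hornerM hornerC elem_poly_last.
have Qj (j : 'I_n) : (j <= r)%N -> root Q 'X_j.
  move=> jr; apply/eqP; have := congr1 (msym (tperm j x)) Qx; rewrite msym0 => <-.
  rewrite !horner_sum raddf_sum /=; apply: eq_bigr => i _.
  by rewrite !hornerM !hornerC msymM elem_poly_swap // ha //= ltnS.
pose rs := [seq 'X_(widen_ord hr j) | j <- enum 'I_r.+1] : seq P.
apply: (@roots_geq_poly_eq0 _ Q rs).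
- by apply/allP => _ /mapP[j _ ->]; apply: Qj; rewrite /= -ltnS.
- rewrite map_inj_in_uniq ?enum_uniq // => i j _ _ /eqP; rewrite -subr_eq0 => /eqP.
  apply: contra_eq => ij; apply: mpolyX_sub_neq0.
  by rewrite -val_eqE.
- rewrite size_map size_enum_ord; apply: leq_trans (size_sum _ _ _) _; apply/bigmax_leqP => i _.
  rewrite mul_polyC; apply: leq_trans (size_scale_leq _ _) _.
  by rewrite (size_elem_poly r i).1.
Qed.

Definition elem_ranges m : seq (seq nat) := [seq iota 0 al.+2 | al <- iota 0 m].

(** Coefficients symmetric in x_1, .., x_(m+1), rather than constants, make the induction work:
    after the last factor is absorbed into the coefficients they are still symmetric in one variable
    less, and [elem_symm_free] then separates the last index. *)
Lemma elem_prod_free m (a : seq nat -> P) : (m < n)%N ->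
  (forall I, symm_upto m.+1 (a I)) ->
  \sum_(I <- seqprod (elem_ranges m)) a I * \prod_(al < m) elem n al.+1 (nth 0%N I al) = 0 ->
  forall I, I \in seqprod (elem_ranges m) -> a I = 0.
Proof.
elim: m a => [|m IH] a hm ha.
  by rewrite big_seq1 big_ord0 mulr1 => h I; rewrite inE => /eqP->.
rewrite /elem_ranges iota_rcons add0n map_rcons -/(elem_ranges m) big_seqprod_rcons => E.
have sE I : I \in seqprod (elem_ranges m) -> size I = m.
  by move/size_seqprod->; rewrite size_map size_iota.
have H := IH (fun I => \sum_(i < m.+2) a (rcons I i) * elem n m.+1 i) (ltnW hm).
have {H E IH}H I : I \in seqprod (elem_ranges m) -> forall i, (i <= m.+1)%N -> a (rcons I i) = 0.
  move=> hI; apply: elem_symm_free => //.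
  apply: H hI => [I' i j hi hj|].
    rewrite raddf_sum; apply: eq_bigr => k _ /=; rewrite msymM symm_elem //.
    by rewrite ha // ltnW.
  rewrite -[RHS]E big_seq [RHS]big_seq; apply: eq_bigr => I' hI'.
  rewrite -[X in _ = \sum_(_ <- X) _]/(index_iota 0 m.+2) big_mkord mulr_suml.
  apply: eq_bigr => i _; rewrite big_ord_recr /= nth_rcons sE // ltnn eqxx -mulrA; congr (_ * _).
  rewrite mulrC; congr (_ * _); apply: eq_bigr => al _.
  by rewrite nth_rcons sE // ltn_ord.
move=> J; elim/last_ind: J => [|I i _] hJ.
  by have := size_seqprod hJ; rewrite size_rcons.
have sI : size I = size (elem_ranges m).
  by have := size_seqprod hJ; rewrite !size_rcons => -[].
move: hJ; rewrite mem_seqprod_rcons // => /andP[hI]; rewrite mem_iota /= add0n ltnS.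
exact: H.
Qed.

End ElemIndependence.

(** * Products of transpositions s_k with pairwise non-adjacent, hence commuting, letters *)

Definition gapped (S : seq nat) : bool :=
  [&& uniq S, all (leq 1) S & all (fun k => k.+1 \notin S) S].

Lemma gapped_sub S S' : {subset S' <= S} -> uniq S' -> gapped S -> gapped S'.
Proof.
move=> sub us /and3P[_ /allP h1 /allP h2]; apply/and3P; split=> //.
  by apply/allP => k /sub /h1.
by apply/allP => k /sub /h2 h; apply: contra h; apply: sub.
Qed.

Lemma word_fun_gapped S x : gapped S ->
  word_fun S x = if x \in S then x.+1 else if x.-1 \in S then x.-1 else x.
Proof.
elim: S => [|k S IH] //= hS.
have uS : uniq S by case/and3P: hS => /andP[].
have hS' : gapped S by apply: gapped_sub uS hS => y yS; rewrite inE yS orbT.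
rewrite IH // !inE.
have /and3P[/= /andP[kS _] /andP[k0 S1] /andP[]] := hS.
rewrite inE negb_or => /andP[_ k1S] /allP hN.
have hN' y : y \in S -> y.+1 != k by move=> /hN; rewrite inE negb_or => /andP[].
have hN1 : k.-1 \notin S by apply/negP => /hN'; rewrite prednK ?eqxx.
have h0 : 0%N \notin S by apply/negP => /(allP S1).
case: (eqVneq x k) => [->|xk] /=.
  by rewrite (negbTE kS) (negbTE hN1) /s_nat eqxx.
case: (boolP (x \in S)) => [xS|xS].
  rewrite /s_nat (negbTE (hN' _ xS)); by case: eqP => // -[E]; rewrite E eqxx in xk.
case: (eqVneq x.-1 k) => [E|xk'] /=.
  have E' : x = k.+1 by move: E (k0 : 0 < k)%N; lia.
  by rewrite E' /= (negbTE kS) /s_nat eqxx; case: eqP => //; lia.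
case: (boolP (x.-1 \in S)) => [xS'|xS'].
  have nk : x.-1 != k by [].
  rewrite /s_nat (negbTE nk); case: eqP => // E.
  by rewrite E in xS'; rewrite xS' in k1S.
rewrite /s_nat (negbTE xk); by case: eqP => // E; rewrite E /= eqxx in xk'.
Qed.

Section GappedPermutations.
Variable n : nat.
Implicit Types (S : seq nat) (w : 'S_n).

Definition wperm S : 'S_n := wcomp 1%g S.

Lemma pfun_wperm S : letters n S -> pfun (wperm S) =1 word_fun S.
Proof. by move=> hS k; rewrite pfun_wcomp //= pfun1. Qed.

Lemma wperm_ext S S' : letters n S -> letters n S' -> gapped S -> gapped S' ->
  S =i S' -> wperm S = wperm S'.
Proof.
move=> h1 h2 g1 g2 E; apply: pfun_inj => x.
by rewrite !pfun_wperm // !word_fun_gapped // !E.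
Qed.

Lemma wperm_cat S S' : wperm (S ++ S') = pcomp (wperm S) (wperm S').
Proof.
rewrite /wperm /wcomp foldl_cat; elim/last_ind: S' => [|S' k IH]; first by rewrite /= /Defs.pcomp mul1g.
by rewrite !foldl_rcons IH pcompA.
Qed.

Lemma descent_wperm S k : letters n S -> gapped S -> descent (wperm S) k = (k \in S).
Proof.
move=> hS gS; rewrite /descent !pfun_wperm // !word_fun_gapped //=.
have /and3P[uS /allP S1 /allP hN] := gS.
case: (boolP (k \in S)) => kS.
  have /andP[-> ->] := allP hS _ kS; rewrite (negbTE (hN _ kS)) /=; lia.
apply/negP => /and3P[k0 kn]; case: ifP => _; last by case: ifP => _; lia.
by case: ifP => _; lia.
Qed.

Lemma letters_sub S S' : {subset S' <= S} -> letters n S -> letters n S'.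
Proof. by move=> sub /allP h; apply/allP => k /sub /h. Qed.

Lemma ell_wperm S : letters n S -> gapped S -> ell (wperm S) = size S.
Proof.
elim/last_ind: S => [|S k IH] hS gS; first exact: ell1.
have sub : {subset S <= rcons S k} by move=> y yS; rewrite mem_rcons inE yS orbT.
have hS' := letters_sub sub hS.
have uS : uniq S by case/and3P: gS; rewrite rcons_uniq => /andP[].
have gS' := gapped_sub sub uS gS.
have kn : (0 < k < n)%N by move: hS; rewrite /letters all_rcons => /andP[].
have kS : k \notin S by case/and3P: gS; rewrite rcons_uniq => /andP[].
have := ascent_ell (wperm S) kn; rewrite descent_wperm // kS IH // size_rcons => /esym/eqP <-.
by rewrite /wperm /wcomp foldl_rcons.
Qed.

Lemma wperm_rem S k : letters n S -> gapped S -> k \in S ->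
  pcomp (wperm S) (sref n k) = wperm (rem k S).
Proof.
move=> hS gS kS; have uS : uniq S by case/and3P: gS.
have sub : {subset rem k S <= S} by move=> y /mem_rem.
rewrite -[RHS](pcomp_srefK _ k) (_ : pcomp (wperm (rem k S)) (sref n k) = wperm S) //.
transitivity (wperm (rcons (rem k S) k)); first by rewrite /wperm /wcomp foldl_rcons.
have E : rcons (rem k S) k =i S.
  by move=> y; rewrite mem_rcons -(perm_mem (perm_to_rem kS)).
have us : uniq (rcons (rem k S) k) by rewrite rcons_uniq rem_uniq // mem_rem_uniqF.
apply: wperm_ext => //; first by apply: letters_sub hS => y; rewrite E.
by apply: gapped_sub gS => // y; rewrite E.
Qed.

(** The letters commute, so each k of S independently picks one factor of [l] with that letter; the
    induction decides whether the last factor is picked. *)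
Lemma wcoef_wperm (R : comNzRingType) S (l : seq (R * nat)) : letters n S -> gapped S ->
  wcoef (wperm S) (hprod (umat R n) l) = \prod_(k <- S) \sum_(p <- l | p.2 == k) p.1.
Proof.
elim/last_ind: l S => [|l p IH] S hS gS.
  rewrite /hprod big_nil wcoef_1; case: S hS gS => [|k S] hS gS.
    by rewrite big_nil /wperm /= eqxx.
  rewrite big_cons big_nil mul0r; case: eqP => // E.
  by have := ell_wperm hS gS; rewrite E ell1.
rewrite -cats1 hprod_cat hprod1 wcoef_hfac IH // descent_wperm //.
have E k : \sum_(q <- l ++ [:: p] | q.2 == k) q.1 =
    \sum_(q <- l | q.2 == k) q.1 + (if p.2 == k then p.1 else 0).
  by rewrite big_cat big_cons big_nil /=; case: ifP; rewrite ?addr0.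
case: (boolP (p.2 \in S)) => hp; last first.
  rewrite mulr0 addr0; apply: eq_big_seq => k kS; rewrite E; case: eqP => [e|]; last by rewrite addr0.
  by rewrite e kS in hp.
have uS : uniq S by case/and3P: gS.
have sub : {subset rem p.2 S <= S} by move=> y /mem_rem.
rewrite wperm_rem // IH; last 2 first.
- exact: letters_sub hS.
- by apply: gapped_sub gS; rewrite ?rem_uniq.
rewrite !(perm_big _ (perm_to_rem hp)) !big_cons E eqxx /= mulrDl; congr (_ * _ + _ * _).
  apply: eq_big_seq => k; rewrite mem_rem_uniq // inE => /andP[/negbTE kp _].
  by rewrite E eq_sym kp addr0.
apply: eq_big_seq => k; rewrite mem_rem_uniq // inE => /andP[/negbTE kp _].
by rewrite E eq_sym kp addr0.
Qed.

End GappedPermutations.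

Lemma afac_hprod_sum (R : comNzRingType) (B : algType R) (u : nat -> B) d i x :
  exists2 l, afac u d i x = hprod u l &
    forall k, \sum_(p <- l | p.2 == k) p.1 = if (i <= k < i + d)%N then x else 0.
Proof.
elim: d i => [|d IH] i /=.
  exists [::]; rewrite /hprod ?big_nil // => k; rewrite big_nil addn0; case: ifP => //; lia.
have [l -> hl] := IH i.+1; exists (l ++ [:: (x, i)]); first by rewrite hprod_cat hprod1.
move=> k; rewrite big_cat big_cons big_nil hl /=; case: (eqVneq i k) => [->|ik].
  rewrite ltnn /= add0r addr0; case: ifP => //; lia.
by rewrite addr0; congr (if _ then _ else _); lia.
Qed.

(** The letter k occurs once in each factor A_i(y_i) with i <= k and in no other one. *)
Lemma stanley_hprod_sum (R : comNzRingType) n (y : nat -> R) :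
  exists2 l, stanley n y = hprod (umat R n) l &
    forall k, (0 < k < n)%N -> \sum_(p <- l | p.2 == k) p.1 = \sum_(1 <= i < k.+1) y i.
Proof.
suff [l E hl] : exists2 l, stanley n y = hprod (umat R n) l &
    forall k, (0 < k < n)%N -> \sum_(p <- l | p.2 == k) p.1 =
       \sum_(1 <= i < n) if (i <= k)%N then y i else 0.
  exists l => // k kn; rewrite hl // (@big_cat_nat _ _ _ k.+1) //=; last by lia.
  rewrite [X in _ + X]big_nat [X in _ + X]big1 ?addr0; last first.
    by move=> i hi; case: ifP => //; lia.
  by apply: eq_big_nat => i hi; case: ifP => //; lia.
rewrite /stanley; suff /(_ n (leqnn n)) : forall m, (m <= n)%N ->
  exists2 l, \prod_(1 <= i < m) afrom (umat R n) n i (y i) = hprod (umat R n) l &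
    forall k, (0 < k < n)%N -> \sum_(p <- l | p.2 == k) p.1 =
       \sum_(1 <= i < m) if (i <= k)%N then y i else 0 by [].
elim=> [|m IH] mn.
  by exists [::]; rewrite /hprod ?big_nil ?big_geq // => k kn; rewrite big_nil big_geq.
case: m IH mn => [|m] IH mn.
  by exists [::]; rewrite /hprod ?big_nil ?big_geq // => k kn; rewrite big_nil big_geq.
have [l E hl] := IH (ltnW mn).
have [l' E' hl'] := afac_hprod_sum (umat R n) (n - m.+1) m.+1 (y m.+1).
exists (l ++ l'); first by rewrite hprod_cat big_nat_recr //= E /afrom E'.
move=> k kn; rewrite big_cat /= hl // hl' [RHS]big_nat_recr //=; congr (_ + _).
by congr (if _ then _ else _); lia.
Qed.

Lemma elem1 n k : (k <= n)%N -> elem n k 1 = \sum_(1 <= i < k.+1) xvar n i.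
Proof.
elim: k => [|k IH] kn; first by rewrite big_geq // elem_gt.
by rewrite (elemS _ kn) IH 1?ltnW // elem0 mulr1 [RHS]big_nat_recr //= (xvarS (Ordinal kn)).
Qed.

Lemma schubert_wperm n S : letters n S -> gapped S ->
  schubert (wperm n S) = \prod_(k <- S) elem n k 1.
Proof.
move=> hS gS; have [l E hl] := stanley_hprod_sum n (xvar n).
rewrite schubert_wcoef E wcoef_wperm //; apply: eq_big_seq => k /(allP hS) kn.
by rewrite hl // elem1 // ltnW //; case/andP: kn.
Qed.

Lemma prod_letters (R : comNzRingType) n S (f : nat -> R) : letters n S -> uniq S ->
  \prod_(al < n.-1) (if al.+1 \in S then f al.+1 else 1) = \prod_(k <- S) f k.
Proof.
move=> hS uS; rewrite -(big_mkord xpredT (fun k => if k.+1 \in S then f k.+1 else 1)).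
rewrite -(big_add1 _ _ 0 n xpredT (fun k => if k \in S then f k else 1)) -big_mkcond -big_filter.
apply: perm_big; apply: uniq_perm => //; first by rewrite filter_uniq // iota_uniq.
move=> k; rewrite mem_filter mem_index_iota; case: (boolP (k \in S)) => //= kS.
exact: (allP hS _ kS).
Qed.

Section ElemCoefficients.
Variable n : nat.
Implicit Types (v : 'S_n) (a : elem_index n -> int) (S : seq nat).

Definition index_list (I : elem_index n) : seq nat := [seq (I al : nat) | al <- enum 'I_n.-1].

Lemma nth_index_list I (al : 'I_n.-1) : nth 0%N (index_list I) al = I al.
Proof. by rewrite (nth_map al) ?size_enum_ord // nth_ord_enum. Qed.

Lemma index_list_inj : injective index_list.
Proof. by move=> I J E; apply/ffunP => al; apply/val_inj; rewrite /= -!nth_index_list E. Qed.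

Lemma mem_index_list v I : elem_admissible v I -> index_list I \in seqprod (elem_ranges n.-1).
Proof.
case/andP => /forallP H _; rewrite /index_list /elem_ranges -val_enum_ord -map_comp.
elim: (enum _) => [|al s IH] //; rewrite !map_cons mem_seqprod_cons IH andbT.
by rewrite -[X in _ \in X]/(iota 0 al.+2) mem_iota add0n ltnS; apply: H.
Qed.

Lemma seqprod_uniq (T : eqType) (rs : seq (seq T)) : all uniq rs -> uniq (seqprod rs).
Proof.
elim: rs => //= r rs IH /andP[ur /IH us]; apply: allpairs_uniq => //.
by move=> [x v] [x' v'] _ _ /= [-> ->].
Qed.

(** Makes [elem_coef], an arbitrary choice of an expansion, comparable with an explicit one. *)
Lemma elem_expansion_unique v a a' : (0 < n)%N ->
  elem_expansion v a -> elem_expansion v a' -> forall I, elem_admissible v I -> a I = a' I.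
Proof.
move=> n0; rewrite /elem_expansion => -> /eqP; rewrite -subr_eq0 -sumrB => /eqP E J hJ.
(* The difference of the coefficients as a function of lists, the index type of [elem_prod_free]; a
   list that is not an admissible index gets 0. *)
pose b (L : seq nat) : {mpoly int[n]} :=
  \sum_(I | elem_admissible v I && (index_list I == L)) (a I - a' I)%:MP.
suff : b (index_list J) = 0.
  rewrite /b (big_pred1 J) => [/eqP|I]; first by rewrite mpolyC_eq0 subr_eq0 => /eqP.
  by rewrite (inj_eq index_list_inj) /=; case: eqP => [->|]; rewrite ?hJ ?andbF.
apply: (@elem_prod_free n n.-1 b) (mem_index_list hJ); first by rewrite ltn_predL.
  move=> L i j _ _; rewrite /b raddf_sum; apply: eq_bigr => I _ /=.
  by rewrite -[_%:MP]mulr1 mul_mpolyC msymZ msym1.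
rewrite -[RHS]E; under eq_bigr do rewrite mulr_suml.
rewrite (exchange_big_dep (elem_admissible v)) /=; last by move=> ? ? _ /andP[].
apply: eq_bigr => I hI; rewrite -scalerBl big_mkcond.
rewrite (bigD1_seq (index_list I)) ?(mem_index_list hI) ?seqprod_uniq //=; last first.
  by apply/allP => _ /mapP[al _ ->]; exact: iota_uniq.
rewrite hI eqxx [X in _ + X]big1 ?addr0 => [|L hL]; last by rewrite [_ == L]eq_sym (negbTE hL).
by rewrite mul_mpolyC; congr (_ *: _); apply: eq_bigr => al _; rewrite nth_index_list.
Qed.

Lemma elem_index_letters_subproof S (al : 'I_n.-1) : ((al.+1 \in S : nat) < n)%N.
Proof. by have := ltn_ord al; case: (al.+1 \in S) => /=; lia. Qed.

Definition elem_index_letters S : elem_index n :=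
  [ffun al => Ordinal (elem_index_letters_subproof S al)].

Lemma elem_index_lettersE S al : elem_index_letters S al = (al.+1 \in S) :> nat.
Proof. by rewrite ffunE. Qed.

Lemma elem_index_letters_adm S : letters n S -> gapped S ->
  elem_admissible (wperm n S) (elem_index_letters S).
Proof.
move=> hS gS; apply/andP; split.
  by apply/forallP => al; rewrite elem_index_lettersE; case: (al.+1 \in S).
rewrite ell_wperm // -sum1_size; have uS : uniq S by case/and3P: gS.
under [X in X == _]eq_bigr do rewrite elem_index_lettersE.
rewrite -(big_mkord xpredT (fun k => (k.+1 \in S : nat))) -(big_add1 _ _ 0 n xpredT (fun k => (k \in S : nat))).
rewrite (eq_bigr (fun k => if k \in S then 1%N else 0%N)) => [|k _]; last by case: (k \in S).
rewrite -big_mkcond -big_filter; apply/eqP/perm_big/uniq_perm => //.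
  by rewrite filter_uniq // iota_uniq.
move=> k; rewrite mem_filter mem_index_iota; case: (boolP (k \in S)) => //= kS.
exact: (allP hS _ kS).
Qed.

Lemma prod_elem_index (R : comNzRingType) (c : nat -> nat -> R) S : (forall k, c k 0%N = 1) ->
  letters n S -> gapped S ->
  \prod_(al < n.-1) c al.+1 (elem_index_letters S al) = \prod_(k <- S) c k 1%N.
Proof.
move=> c0 hS gS; rewrite -(@prod_letters _ n S (fun k => c k 1%N)) //; last by case/and3P: gS.
by apply: eq_bigr => al _; rewrite elem_index_lettersE; case: (al.+1 \in S); rewrite ?c0.
Qed.

(** By [schubert_wperm] the expansion is the single term with exponent 1 at the letters of S. It
    shows that an expansion exists, so the choice satisfies its specification and agrees with it. *)
Lemma univ_schubert_wperm (R : comNzRingType) (c : nat -> nat -> R) S : (0 < n)%N ->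
  (forall k, c k 0%N = 1) -> letters n S -> gapped S ->
  univ_schubert c (wperm n S) = \prod_(k <- S) c k 1%N.
Proof.
move=> n0 c0 hS gS; pose a0 (I : elem_index n) : int := (I == elem_index_letters S)%:R.
have hadm := elem_index_letters_adm hS gS.
have h0 : elem_expansion (wperm n S) a0.
  rewrite /elem_expansion schubert_wperm // (bigD1 (elem_index_letters S)) //= [X in _ + X]big1 ?addr0.
    rewrite /a0 eqxx scale1r.
    by rewrite (prod_elem_index (c := fun r k => elem n r k)) // => k; apply: elem0.
  by move=> I /andP[_ /negbTE hI]; rewrite /a0 hI scale0r.
have h1 : elem_expansion (wperm n S) (elem_coef (wperm n S)).
  by apply: ClassicalEpsilon.epsilon_spec; exists a0.
rewrite /univ_schubert (bigD1 (elem_index_letters S)) //= [X in _ + X]big1 ?addr0.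
  rewrite (elem_expansion_unique n0 h1 h0) // /a0 eqxx mul1r prod_elem_index //.
by move=> I /andP[hI /negbTE hI']; rewrite (elem_expansion_unique n0 h1 h0) // /a0 hI' mul0r.
Qed.

End ElemCoefficients.

Section Factorizations.
Variable n : nat.
Implicit Types (u v w : 'S_n) (S : seq nat).

Lemma no_descent_id w : (forall k, ~~ descent w k) -> w = 1%g.
Proof.
move=> H; apply/permP => i; apply/val_inj; rewrite perm1 /=.
have asc k : (0 < k < n)%N -> (pfun w k < pfun w k.+1)%N.
  move=> kn; have := H k; have := @pfun_injective _ w k k.+1; rewrite /descent.
  have /andP[-> ->] := kn; rewrite /= -leqNgt leq_eqVlt => inj /predU1P[/inj|//]; lia.
have lo m : (m < n)%N -> (m < pfun w m.+1)%N.
  elim: m => [|m IH] mn.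
    by rewrite lt0n; apply/eqP => /(@pfun_injective _ w 1 0).
  have := IH (ltnW mn); have := asc m.+1; lia.
have hi m : (m < n)%N -> (pfun w (n - m) <= n - m)%N.
  elim: m => [|m IH] mn; first by rewrite subn0 pfun_leq.
  have := IH (ltnW mn); have := asc (n - m.+1)%N.
  have -> : (n - m.+1).+1 = (n - m)%N by lia.
  lia.
have := lo i (ltn_ord i); have := hi (n - i.+1)%N.
have -> : (n - (n - i.+1) = i.+1)%N by move: (ltn_ord i); lia.
rewrite pfunS; have := ltn_ord i; lia.
Qed.

Lemma reduced_word_exists w : exists e, redw w e.
Proof.
elim: {w}(ell w) {-2}w (erefl (ell w)) => [|m IH] w ew.
  have -> : w = 1%g by apply: no_descent_id => k; rewrite descent_ell ew; case: (_ < _ < _)%N.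
  by exists [::]; rewrite /redw /= eqxx ell1.
case: (boolP [exists k : 'I_n, descent w k]) => [/existsP[k hk]|/existsPn H]; last first.
  suff w1 : w = 1%g by rewrite w1 ell1 in ew.
  apply: no_descent_id => k; case: (ltnP k n) => kn; first exact: (H (Ordinal kn)).
  by rewrite /descent [(k < n)%N]ltnNge kn andbF.
have := hk; rewrite descent_ell ew eqSS => /andP[kn /eqP ew'].
have [e /and3P[he /eqP Ee /eqP se]] := IH _ (esym ew').
exists (rcons e k); apply/and3P; split.
- by rewrite /letters all_rcons kn.
- by rewrite /wcomp foldl_rcons -/(wcomp _ _) -Ee pcomp_srefK.
- by rewrite size_rcons se -ew' ew.
Qed.

(** Each k of S is sent to k + 1, so by [word_fun_leq] it occurs in e; equal lengths leave room for
    nothing else. *)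
Lemma redw_wperm S e : letters n S -> gapped S -> redw (wperm n S) e -> perm_eq e S.
Proof.
move=> hS gS /and3P[he /eqP Ee /eqP se]; rewrite ell_wperm // in se.
have uS : uniq S by case/and3P: gS.
have sub : {subset S <= e}.
  move=> k kS; apply/negPn/negP => ke.
  have := word_fun_leq k ke; have := pfun_wperm hS k; rewrite Ee (pfun_wcomp _ he) /= pfun1.
  by rewrite (word_fun_gapped _ gS) kS => ->; rewrite ltnn leqnn.
have [_ E] := uniq_min_size uS sub (eq_leq se).
have ue : uniq e by apply: leq_size_uniq uS sub _; rewrite se.
by apply: uniq_perm => // k; rewrite E.
Qed.

Lemma wperm_inv S : letters n S -> gapped S -> (wperm n S)^-1%g = wperm n S.
Proof.
move=> hS gS; apply/eqP; rewrite eq_invg_mul; apply/eqP; rewrite -/(pcomp _ _).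
apply: pfun_inj => x; rewrite pfun_comp /= pfun1 !pfun_wperm // !(word_fun_gapped _ gS).
have /and3P[uS /allP S1 /allP hN] := gS.
case: (boolP (x \in S)) => xS; first by rewrite (negbTE (hN _ xS)) /= xS.
case: (boolP (x.-1 \in S)) => xS'; last by rewrite (negbTE xS) (negbTE xS').
by rewrite xS' prednK //; case: (x) xS xS' => // xS xS'; rewrite xS' in xS.
Qed.

Section DoubleUniversal.
Variables (S : seq nat) (hS : letters n S) (gS : gapped S).

Let uS : uniq S. Proof. by case/and3P: gS. Qed.

Definition subletters (J : {set 'I_(size S)}) : seq nat := [seq nth 0%N S (j : 'I_(size S)) | j : 'I_(size S) <- enum J].

Lemma mem_subletters (J : {set 'I_(size S)}) (j : 'I_(size S)) :
  (nth 0%N S j \in subletters J) = (j \in J).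
Proof.
apply/mapP/idP => [[j' hj' /eqP]|hj]; last by exists j; rewrite ?mem_enum.
rewrite nth_uniq // => /eqP /val_inj ->; by rewrite mem_enum in hj'.
Qed.

Lemma subletters_sub J : {subset subletters J <= S}.
Proof. by move=> k /mapP[j _ ->]; apply: mem_nth. Qed.

Lemma subletters_uniq J : uniq (subletters J).
Proof.
rewrite map_inj_in_uniq ?enum_uniq // => j j' _ _ /eqP.
by rewrite nth_uniq // => /eqP/val_inj.
Qed.

Lemma subletters_letters J : letters n (subletters J).
Proof. exact: letters_sub (@subletters_sub J) hS. Qed.

Lemma subletters_gapped J : gapped (subletters J).
Proof. exact: gapped_sub (@subletters_sub J) (@subletters_uniq J) gS. Qed.

Lemma perm_subletters J : perm_eq (subletters J ++ subletters (~: J)) S.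
Proof.
apply: uniq_perm => // [|k].
  rewrite cat_uniq !subletters_uniq andbT /=; apply/hasPn => _ /mapP[j hj ->].
  by rewrite mem_subletters; move: hj; rewrite mem_enum inE.
rewrite mem_cat; apply/orP/idP => [[]/subletters_sub //|kS].
have hk : (index k S < size S)%N by rewrite index_mem.
have := mem_subletters J (Ordinal hk); have := mem_subletters (~: J) (Ordinal hk).
rewrite /= nth_index // inE => -> ->; by case: (_ \in J); [left|right].
Qed.

Definition split_letters J : 'S_n * 'S_n := (wperm n (subletters J), wperm n (subletters (~: J))).

Definition descent_letters (uu : 'S_n * 'S_n) : {set 'I_(size S)} :=
  [set j : 'I_(size S) | descent uu.1 (nth 0%N S j)].

Definition factorization (v : 'S_n) (uu : 'S_n * 'S_n) : bool :=
  (pcomp uu.1 uu.2 == v) && (ell uu.1 + ell uu.2 == ell v)%N.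

Lemma split_lettersK J : descent_letters (split_letters J) = J.
Proof.
apply/setP => j; rewrite inE /= descent_wperm ?mem_subletters //.
- exact: subletters_letters.
- exact: subletters_gapped.
Qed.

Lemma factorization_split J : factorization (wperm n S) (split_letters J).
Proof.
apply/andP; split=> /=.
  rewrite -wperm_cat; apply/eqP/wperm_ext => //.
  - by rewrite /letters all_cat; apply/andP; split; apply: subletters_letters.
  - apply: gapped_sub gS => [k|]; first by rewrite (perm_mem (perm_subletters J)).
    by rewrite (perm_uniq (perm_subletters J)).
  - exact/perm_mem/perm_subletters.
rewrite !ell_wperm ?subletters_letters ?subletters_gapped //.
by rewrite -size_cat (perm_size (perm_subletters J)).
Qed.

(** Concatenated reduced words of the two factors form a reduced word of the product, hence a
    rearrangement of S. The factorization is a splitting of the letters, read off from the descents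
    of the first factor. *)
Lemma descent_lettersK uu : factorization (wperm n S) uu ->
  split_letters (descent_letters uu) = uu.
Proof.
case: uu => u u' /andP[/= /eqP Ev /eqP El].
have [e /and3P[he /eqP Ee /eqP se]] := reduced_word_exists u.
have [e' /and3P[he' /eqP Ee' /eqP se']] := reduced_word_exists u'.
have hp : perm_eq (e ++ e') S.
  apply: redw_wperm => //; apply/and3P; split.
  - by rewrite /letters all_cat; apply/andP.
  - by rewrite -/(wperm n _) wperm_cat /wperm -Ee -Ee' Ev.
  - by rewrite size_cat se se' El.
have := perm_uniq hp; rewrite uS cat_uniq => /and3P[ue disj ue'].
have ge : gapped e by apply: gapped_sub gS => // k ke; rewrite -(perm_mem hp) mem_cat ke.
have ge' : gapped e' by apply: gapped_sub gS => // k ke; rewrite -(perm_mem hp) mem_cat ke orbT.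
have dl (j : 'I_(size S)) : (j \in descent_letters (u, u')) = (nth 0%N S j \in e).
  by rewrite inE /= Ee -/(wperm n e) descent_wperm.
have memJ J k (kS : k \in S) (hk : (index k S < size S)%N) : (k \in subletters J) = (Ordinal hk \in J).
  by rewrite -mem_subletters /= nth_index.
have ext (e1 : seq nat) (J : {set 'I_(size S)}) : letters n e1 -> gapped e1 -> {subset e1 <= S} ->
    (forall j : 'I_(size S), (j \in J) = (nth 0%N S j \in e1)) -> wperm n (subletters J) = wperm n e1.
  move=> h1 h2 h3 h4; apply: wperm_ext => //; [exact: subletters_letters|exact: subletters_gapped|].
  move=> k; case: (boolP (k \in S)) => kS; last first.
    by rewrite (contraNF (@subletters_sub _ _) kS) (contraNF (@h3 _) kS).
  have hk : (index k S < size S)%N by rewrite index_mem.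
  by rewrite (memJ _ _ kS hk) h4 /= nth_index.
congr (_, _) => /=.
  rewrite (ext e) // => k ke; by rewrite -(perm_mem hp) mem_cat ke.
rewrite (ext e') // => [k ke|j]; first by rewrite -(perm_mem hp) mem_cat ke orbT.
rewrite inE dl; have : nth 0%N S j \in e ++ e' by rewrite (perm_mem hp) mem_nth.
rewrite mem_cat; case: (boolP (_ \in e)) => //= je _; apply/esym/negbTE.
by apply/negP => je'; case/hasP: disj; exists (nth 0%N S j).
Qed.

(** The sum over length-additive factorizations is a sum over subsets of S, which is the expanded
    product; the first factor is its own inverse and its length gives the sign. *)
Lemma univ_double_schubert_wperm (R : comNzRingType) (c d : nat -> nat -> R) : (0 < n)%N ->
  (forall k, c k 0%N = 1) -> (forall k, d k 0%N = 1) ->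
  univ_double_schubert c d (wperm n S) = \prod_(k <- S) (c k 1%N - d k 1%N).
Proof.
move=> n0 c0 d0; rewrite /univ_double_schubert -/(factorization _).
rewrite (reindex_onto split_letters descent_letters) /=; last first.
  by move=> uu h; apply: descent_lettersK.
rewrite (big_nth 0%N) big_mkord.
under [RHS]eq_bigr do rewrite addrC.
rewrite bigA_distr; apply: eq_big => [J|J _].
  by rewrite -/(factorization _ (split_letters J)) factorization_split split_lettersK eqxx.
have hl := subletters_letters; have hg := subletters_gapped.
rewrite wperm_inv // !univ_schubert_wperm // ell_wperm //.
rewrite (bigID (mem J)) /= !big_map !big_enum /=.
rewrite size_map -cardE; congr (_ * _).
  by rewrite -prodrN; apply: eq_bigr => j ->.
by apply: eq_big => [j|j]; rewrite inE // => /negbTE->.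
Qed.

End DoubleUniversal.

End Factorizations.

Definition shift_letters m (S : seq nat) : seq nat := [seq (m + k)%N | k <- S].

Lemma mem_shift_letters m S x : ((m + x)%N \in shift_letters m S) = (x \in S).
Proof. by rewrite mem_map // => ? ? /addnI. Qed.

Lemma letters_shift m n S : letters n S -> letters (m + n) (shift_letters m S).
Proof. by move=> hS; apply/allP => _ /mapP[k /(allP hS) hk ->]; lia. Qed.

Lemma gapped_shift m S : gapped S -> gapped (shift_letters m S).
Proof.
case/and3P => uS /allP S1 /allP hN; apply/and3P; split.
- by rewrite map_inj_uniq // => ? ? /addnI.
- by apply/allP => _ /mapP[k /S1 /= hk ->]; lia.
- by apply/allP => _ /mapP[k /hN hk ->]; rewrite -addnS mem_shift_letters.
Qed.

Lemma one_times_wperm m n S : letters n S -> gapped S ->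
  one_times m (wperm n S) = wperm (m + n) (shift_letters m S).
Proof.
move=> hS gS; have /and3P[uS /allP S1 /allP hN] := gS.
have lS x : (x <= m)%N -> (x \in shift_letters m S) = false.
  by move=> xm; apply/mapP => -[k /S1 /= hk E]; lia.
have hS' := letters_shift m hS; have gS' := gapped_shift m gS.
have S0 : 0%N \notin S by apply/negP => /S1.
apply: pfun_inj => -[|x]; first by rewrite pfun_wperm // word_fun_gapped // lS //= lS.
rewrite pfun_wperm // word_fun_gapped // [x.+1.-1]/=.
case: (ltnP x (m + n)) => hx; last first.
  rewrite pfun_gt //; case: ifP => [/(allP hS')|_]; first by lia.
  by case: ifP => [/(allP hS')|//]; lia.
rewrite (pfunS _ (Ordinal hx)) permE /shift_fun; case: split_ordP => i E.
  have {}E : x = i := congr1 val E.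
  have im := ltn_ord i; rewrite !lS ?E //; exact: ltnW.
have {}E : x = (m + i)%N := congr1 val E.
have := pfun_wperm hS i.+1; rewrite pfunS word_fun_gapped // [i.+1.-1]/= => Ei.
rewrite /= -addnS Ei E -addnS mem_shift_letters; case: ifP => _; first by rewrite addnS.
by rewrite mem_shift_letters; case: ifP => _ //; rewrite addnS.
Qed.

(** * Quiver coefficients *)

Section Pieri.
Variables (R : comNzRingType) (h : nat -> R).
Hypothesis h0 : h 0%N = 1.

Definition jt_entry (a i : nat) : R := if (i <= a)%N then h (a - i)%N else 0.

Definition jt (s : seq nat) : R :=
  \det (\matrix_(i < size s, j < size s) jt_entry (nth 0%N s i + j) i).

(** The Jacobi-Trudi determinant of a fixed size p, [s] being padded by zero parts, so that shapes
    of different lengths can be compared. *)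
Definition jtn p (s : seq nat) : R :=
  \det (\matrix_(i < p, j < p) jt_entry (nth 0%N s i + j) i).

Lemma jtnS p s : nth 0%N s p = 0%N -> jtn p.+1 s = jtn p s.
Proof.
move=> sp; rewrite /jtn (expand_det_row _ ord_max) (bigD1 ord_max) //= big1 ?addr0; last first.
  move=> j jm; rewrite mxE sp add0n /jt_entry leqNgt.
  have jp : (j < p)%N by rewrite ltn_neqAle -ltnS ltn_ord andbT; apply: contra jm => /eqP E; apply/eqP/val_inj.
  by rewrite jp mul0r.
rewrite mxE sp add0n /jt_entry leqnn subnn h0 mul1r /cofactor -signr_odd addnn odd_double expr0 mul1r.
by congr (\det _); apply/matrixP => i j; rewrite !mxE !lift_max.
Qed.

Lemma jtn_jt p s : (size s <= p)%N -> jtn p s = jt s.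
Proof.
move=> hs; rewrite -(subnK hs); elim: (p - size s)%N => [//|k IH].
by rewrite addSn jtnS ?IH // nth_default // leq_addl.
Qed.

(** In the Leibniz expansion both sides sum over a permutation together with one cell of its graph,
    where the entry comes from M'. *)
Lemma sum_det_rows_cols p (M M' : 'M[R]_p) :
  \sum_i \det (\matrix_(k, j) if k == i then M' k j else M k j) =
  \sum_i \det (\matrix_(k, j) if j == i then M' k j else M k j).
Proof.
rewrite /determinant exchange_big [RHS]exchange_big /=; apply: eq_bigr => s _.
rewrite [RHS](reindex_inj (@perm_inj _ s)) /=; apply: eq_bigr => i _; congr (_ * _).
by apply: eq_bigr => k _; rewrite !mxE (inj_eq perm_inj).
Qed.

(** Adding a box in row i raises all indices in that row by one. Summed over rows this equals the
    sum over raised columns; a raised column repeats its right neighbour, except for the last one,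
    whose bottom entry is h_1. *)
Lemma pieri_box s : jt s * h 1%N = \sum_(i < (size s).+1) jt (incr_nth s i).
Proof.
set p := size s.
pose M := \matrix_(i < p.+1, j < p.+1) jt_entry (nth 0%N s i + j) i.
pose M' := \matrix_(i < p.+1, j < p.+1) jt_entry (nth 0%N s i + j).+1 i.
transitivity (\sum_i \det (\matrix_(k, j) if k == i then M' k j else M k j)); last first.
  apply: eq_bigr => i _; rewrite -(@jtn_jt p.+1); last first.
    by rewrite size_incr_nth; case: ifP => // _; rewrite ltnW.
  congr (\det _); apply/matrixP => k j; rewrite !mxE nth_incr_nth eq_sym.
  by rewrite -val_eqE; case: eqP => /= _; rewrite ?add0n // add1n addSn.
rewrite sum_det_rows_cols (bigD1 ord_max) //= big1 ?addr0; last first.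
  move=> j jm; have jp : (j < p)%N.
    by rewrite ltn_neqAle -ltnS ltn_ord andbT; apply: contra jm => /eqP E; apply/eqP/val_inj.
  have jp' : (j.+1 < p.+1)%N by [].
  rewrite -det_tr; apply: (@determinant_alternate _ _ _ j (Ordinal jp')).
    by rewrite -val_eqE /= ltn_eqF.
  move=> k; rewrite !mxE eqxx -val_eqE /= gtn_eqF //.
  by rewrite addnS.
rewrite (expand_det_row _ ord_max) (bigD1 ord_max) //= big1 ?addr0; last first.
  move=> j jm; rewrite !mxE (negbTE jm) nth_default // add0n /jt_entry leqNgt.
  have jp : (j < p)%N.
    by rewrite ltn_neqAle -ltnS ltn_ord andbT; apply: contra jm => /eqP E; apply/eqP/val_inj.
  by rewrite jp mul0r.
rewrite !mxE eqxx nth_default // add0n /jt_entry leqnSn subSnn.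
rewrite /cofactor -signr_odd addnn odd_double expr0 mul1r mulrC; congr (_ * _).
congr (\det _); apply/matrixP => i j; rewrite !mxE !lift_max.
by rewrite -val_eqE /= /bump leqNgt ltn_ord /= add0n ltn_eqF.
Qed.

(** A box that breaks the partition lies below a row of equal length, and then the determinant has
    two equal rows. *)
Lemma jt_not_part s i : is_part s -> (i <= size s)%N -> ~~ is_part (incr_nth s i) ->
  jt (incr_nth s i) = 0.
Proof.
move=> /andP[/sorted_geq_nthS hs nz] hi hn.
have nz' : 0%N \notin incr_nth s i.
  apply/(nthP 0%N) => -[k]; rewrite size_incr_nth nth_incr_nth => hk.
  case: (ltnP k (size s)) => ks.
    by case: eqP => //= _; rewrite add0n => E; case/negP: nz; rewrite -E mem_nth.
  case: (ltnP i (size s)) hk => his hk; first by lia.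
  have ik : i = k by lia.
  by rewrite ik eqxx.
case: i hi hn nz' => [|i] hi hn nz'.
  case/negP: hn; apply/andP; split=> //; apply/sorted_geq_nthS => j.
  by rewrite !nth_incr_nth /= add0n (leq_trans (hs j)) // leq_addl.
have E : nth 0%N s i.+1 = nth 0%N s i.
  apply/eqP; rewrite eqn_leq hs leqNgt; apply/negP => hlt; case/negP: hn.
  apply/andP; split=> //; apply/sorted_geq_nthS => j; rewrite !nth_incr_nth.
  case: (eqVneq i.+1 j.+1) => [[<-]|_]; last by rewrite add0n (leq_trans (hs j)) // leq_addl.
  by rewrite gtn_eqF.
rewrite -(@jtn_jt (size s).+1); last by rewrite size_incr_nth; case: ifP => // _; rewrite ltnW.
have h1 : (i < (size s).+1)%N by rewrite ltnW.
have h2 : (i.+1 < (size s).+1)%N by [].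
apply: (@determinant_alternate _ _ _ (Ordinal h1) (Ordinal h2)).
  by rewrite -val_eqE /= ltn_eqF.
move=> k; rewrite !mxE /= !nth_incr_nth eqxx gtn_eqF // E add0n add1n /jt_entry addSn ltnS.
by rewrite subSS.
Qed.

End Pieri.

Definition addbox (al : intpart) : seq intpart :=
  pmap insub [seq incr_nth al i | i <- iota 0 (size al).+1].

Lemma mem_addbox (be al : intpart) :
  (be \in addbox al) = (parts be \in [seq incr_nth al i | i <- iota 0 (size al).+1]).
Proof. by rewrite mem_pmap_sub. Qed.

Lemma jt_addbox (R : comNzRingType) (h : nat -> R) (h0 : h 0%N = 1) (al : intpart) :
  jt h al * h 1%N = \sum_(be <- addbox al) jt h be.
Proof.
rewrite pieri_box // -(big_mkord xpredT (fun i => jt h (incr_nth al i))) /addbox.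
rewrite /index_iota subn0 -(big_map (incr_nth al) xpredT (jt h)).
have : all (fun s => ~~ is_part s ==> (jt h s == 0)) [seq incr_nth al i | i <- iota 0 (size al).+1].
  apply/allP => _ /mapP[i + ->]; rewrite mem_iota /= add0n ltnS => hi.
  by apply/implyP => hn; apply/eqP/jt_not_part => //; case: (al).
elim: (map _ _) => [_|s ss IH /andP[/implyP hs /IH E]]; first by rewrite !big_nil.
rewrite big_cons E /=; case: insubP => [be _ <-|/hs/eqP->]; last by rewrite add0r.
by rewrite /= big_cons.
Qed.

Lemma addbox_uniq al : uniq (addbox al).
Proof.
apply: pmap_sub_uniq; rewrite map_inj_in_uniq ?iota_uniq // => i j _ _ E.
have := congr1 (fun s => nth 0%N s i) E; rewrite !nth_incr_nth eqxx.
by case: (eqVneq j i) => // _ /eqP; rewrite add0n add1n gtn_eqF.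
Qed.

Lemma sumn_incr_nth s i : sumn (incr_nth s i) = (sumn s).+1.
Proof.
elim: s i => [|a s IH] [|i] //=; last by rewrite IH addnS.
by elim: i => //= i ->.
Qed.

Lemma sumn_addbox (be al : intpart) : be \in addbox al -> sumn be = (sumn al).+1.
Proof. by rewrite mem_addbox => /mapP[i _ ->]; rewrite sumn_incr_nth. Qed.

(** * Sequences of partitions grown box by box *)

Section BoxSequences.
Variable q : nat.
Implicit Types kap : q.-tuple intpart.

Definition set_part kap (i : 'I_q) (be : intpart) : q.-tuple intpart :=
  [tuple if j == i then be else tnth kap j | j < q].

Definition add_boxes (ok : pred nat) kap : seq (q.-tuple intpart) :=
  [seq set_part kap i be | i <- filter (fun i : 'I_q => ok i.+1) (enum 'I_q), be <- addbox (tnth kap i)].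

Definition tuple0 : q.-tuple intpart := [tuple part0 | _ < q].

(** The list has repetitions on purpose: the multiplicity of a sequence counts the ways to grow it
    and becomes its coefficient. *)
Fixpoint box_seqs (oks : seq (pred nat)) : seq (q.-tuple intpart) :=
  if oks is ok :: oks' then flatten [seq add_boxes ok kap | kap <- box_seqs oks'] else [:: tuple0].

Definition jt_prod (R : comNzRingType) (h : nat -> nat -> R) kap : R :=
  \prod_(i < q) jt (h i.+1) (tnth kap i).

Lemma jt_nil (R : comNzRingType) (h : nat -> R) : jt h [::] = 1.
Proof. exact: det_mx00. Qed.

Lemma jt_prod_box (R : comNzRingType) (h : nat -> nat -> R) kap (i : 'I_q) : h i.+1 0%N = 1 ->
  jt_prod h kap * h i.+1 1%N = \sum_(be <- addbox (tnth kap i)) jt_prod h (set_part kap i be).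
Proof.
move=> h0; rewrite /jt_prod (bigD1 i) //= mulrAC jt_addbox // mulr_suml; apply: eq_bigr => be _.
rewrite [RHS](bigD1 i) //= tnth_mktuple eqxx; congr (_ * _).
by apply: eq_bigr => j /negbTE ji; rewrite tnth_mktuple ji.
Qed.

Lemma jt_prod_add_boxes (R : comNzRingType) (h : nat -> nat -> R) (ok : pred nat) kap :
  (forall i, h i 0%N = 1) ->
  \sum_(k <- add_boxes ok kap) jt_prod h k =
  jt_prod h kap * \sum_(i < q | ok i.+1) h i.+1 1%N.
Proof.
move=> h0; rewrite big_allpairs_dep big_filter big_enum_cond /= mulr_sumr.
by apply: eq_bigr => i _; rewrite jt_prod_box.
Qed.

Lemma jt_prod_box_seqs (R : comNzRingType) (h : nat -> nat -> R) oks : (forall i, h i 0%N = 1) ->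
  \sum_(k <- box_seqs oks) jt_prod h k =
  \prod_(ok <- oks) \sum_(i < q | (ok : pred nat) i.+1) h i.+1 1%N.
Proof.
move=> h0; elim: oks => [|ok oks IH].
  rewrite /= big_seq1 big_nil /jt_prod big1 // => i _; by rewrite tnth_mktuple jt_nil.
rewrite /= big_flatten big_map big_cons -IH mulr_sumr; apply: eq_bigr => k _.
by rewrite jt_prod_add_boxes // mulrC.
Qed.

Definition tuple_weight kap : nat := \sum_(i < q) sumn (tnth kap i).

Lemma weight_set_part kap i be : be \in addbox (tnth kap i) ->
  tuple_weight (set_part kap i be) = (tuple_weight kap).+1.
Proof.
move=> hb; rewrite /tuple_weight (bigD1 i) //= [in RHS](bigD1 i) //= tnth_mktuple eqxx.
rewrite (sumn_addbox hb) addSn; congr (_ + _).+1.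
by apply: eq_bigr => j /negbTE ji; rewrite tnth_mktuple ji.
Qed.

Lemma weight_box_seqs oks kap : kap \in box_seqs oks -> tuple_weight kap = size oks.
Proof.
elim: oks kap => [|ok oks IH] kap /=.
  by rewrite inE => /eqP->; rewrite /tuple_weight big1 // => i _; rewrite tnth_mktuple.
case/flattenP => _ /mapP[k /IH <- ->] /allpairsPdep[i [be [_ hb ->]]].
exact: weight_set_part.
Qed.

Variable i0 : 'I_q.

Definition single_part (al : intpart) : q.-tuple intpart := set_part tuple0 i0 al.

Lemma add_boxes_uniq ok kap : uniq (add_boxes ok kap).
Proof.
apply: allpairs_uniq_dep; first by rewrite filter_uniq // enum_uniq.
  by move=> i _; exact: addbox_uniq.
move=> [i be] [i' be'] /allpairsPdep[x [y [_ hb [? ?]]]] /allpairsPdep[x' [y' [_ hb' [? ?]]]] /=.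
subst x y x' y' => E; have Ej j := congr1 (fun t => tnth t j) E.
have ii : i = i'.
  apply/eqP/negPn/negP => ne; have := Ej i; rewrite !tnth_mktuple (negbTE ne) eqxx => b0.
  by have := sumn_addbox hb; rewrite b0 => /n_Sn.
by subst i'; have := Ej i; rewrite !tnth_mktuple eqxx => ->.
Qed.

Lemma mem_add_boxes_single (ok : pred nat) kap be : ok i0.+1 ->
  (single_part be \in add_boxes ok kap) =
  (kap == single_part (tnth kap i0)) && (be \in addbox (tnth kap i0)).
Proof.
move=> hok; apply/allpairsPdep/andP => [[i [b [_ hb E]]]|[/eqP E hb]].
  have Ej j := congr1 (fun t => tnth t j) E.
  have ii : i = i0.
    apply/eqP/negPn/negP => ne; have := Ej i; rewrite !tnth_mktuple (negbTE ne) eqxx => b0.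
    by have := sumn_addbox hb; rewrite -b0.
  subst i; have := Ej i0; rewrite !tnth_mktuple eqxx => ->; split=> //.
  apply/eqP/eq_from_tnth => j; have := Ej j; rewrite !tnth_mktuple.
  by case: eqP => [->|].
exists i0, be; split=> //; first by rewrite mem_filter hok mem_enum.
by apply: eq_from_tnth => j; rewrite !tnth_mktuple; case: eqP => // /eqP ne;
   rewrite E !tnth_mktuple (negbTE ne).
Qed.

(** All boxes of a sequence concentrated at [i0] were added there, so its growth paths split
    according to the shape before the last box. *)
Lemma count_box_seqs_cons (ok : pred nat) oks be (als : seq intpart) : ok i0.+1 -> uniq als ->
  (forall al : intpart, (be \in addbox al) = (al \in als)) ->
  count_mem (single_part be) (box_seqs (ok :: oks)) =
  (\sum_(al <- als) count_mem (single_part al) (box_seqs oks))%N.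
Proof.
move=> hok ual hal; rewrite /= count_flatten sumnE !big_map.
under eq_bigr do rewrite count_uniq_mem ?add_boxes_uniq // mem_add_boxes_single // hal.
rewrite [RHS](eq_bigr (fun al => (\sum_(k <- box_seqs oks) (k == single_part al))%N)); last first.
  by move=> al _; rewrite -sum1_count big_mkcond.
rewrite exchange_big /=; apply: eq_bigr => k _.
have Ek al : (k == single_part al) = (al == tnth k i0) && (k == single_part (tnth k i0)).
  apply/eqP/andP => [->|[/eqP-> /eqP //]].
  by rewrite tnth_mktuple eqxx !eqxx.
under eq_bigr do rewrite Ek.
case: eqP => _; last by rewrite big1 // => al _; rewrite andbF.
rewrite /=; under eq_bigr do rewrite andbT.
case: (boolP (tnth k i0 \in als)) => hk.
  rewrite (bigD1_seq _ hk) //= eqxx big1 // => al /negbTE->; by [].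
rewrite big1_seq // => al /andP[_ hal']; case: eqP => // E; by rewrite -E hal' in hk.
Qed.

End BoxSequences.

Lemma row_part_subproof t : is_part (nseq (0 < t) t).
Proof. by case: t. Qed.

(** The boolean used as a length makes the row of length 0 the empty partition. *)
Definition row_part t : intpart := IntPart (row_part_subproof t).

Definition hook_part t : intpart := @IntPart [:: t.+1; 1%N] isT.

Lemma intpart_eqE (al be : intpart) : (al == be) = (parts al == parts be).
Proof. by apply/eqP/eqP => [->|/val_inj]. Qed.

Lemma incr_nth_neq0 s i : incr_nth s i != [::].
Proof. by apply/eqP => /(congr1 sumn); rewrite sumn_incr_nth. Qed.

Lemma addbox_row t al : (row_part t.+1 \in addbox al) = (al \in [:: row_part t]).
Proof.
rewrite mem_addbox [RHS]inE intpart_eqE [parts _]/= [X in _ = (_ == X)]/=.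
case/andP: (partsP al) => _; move: (parts al) => s nz; apply/mapP/eqP => [[i hi]|->].
  case: s nz hi => [|a [|b s]] nz; first by case: i t => [|i] [|t].
    case: i => [_ [E]|i]; last by rewrite mem_iota /=; case: i.
    by rewrite -{a}E in nz *; case: t nz.
  by case: i => [|[|i]].
by exists 0%N; case: t.
Qed.

Lemma addbox_hook t al : (hook_part t \in addbox al) =
  (al \in row_part t.+1 :: (if t is t'.+1 then [:: hook_part t'] else [::])).
Proof.
rewrite mem_addbox [RHS]inE intpart_eqE.
have -> : (al \in (if t is t'.+1 then [:: hook_part t'] else [::])) = (0 < t)%N && (parts al == [:: t; 1%N]).
  by case: t => // t; rewrite inE intpart_eqE.
rewrite [parts (hook_part _)]/= [parts (row_part _)]/=.
case/andP: (partsP al) => _; move: (parts al) => s nz.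
apply/mapP/orP => [[i hi]|[/eqP->|/andP[t0 /eqP->]]]; last 2 first.
- by exists 1%N.
- by exists 0%N.
case: s nz {hi} => [|a [|b s]] nz.
- by case: i => [|i] // [].
- case: i => [//|[|i]]; first by case=> <-; left.
  by case.
- case: i => [|[|i]] /=.
  + by case=> E <- <-; right; rewrite -{a}E in nz *; case: (t) nz => //=; rewrite eqxx.
  + by case=> _ b0; move: nz; rewrite -b0 !inE orbT.
  + by case=> _ _ es; have := incr_nth_neq0 s i; rewrite -es.
Qed.

Section CountBoxes.
Variables (q : nat) (i0 : 'I_q).

Lemma count_row (oks : seq (pred nat)) : all (fun ok : pred nat => ok i0.+1) oks ->
  count_mem (single_part i0 (row_part (size oks))) (box_seqs q oks) = 1%N.
Proof.
elim: oks => [_|ok oks IH /= /andP[hok /IH E]].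
  rewrite /= addn0; apply/eqP; rewrite eqb1; apply/eqP/eq_from_tnth => j.
  by rewrite !tnth_mktuple; case: eqP => // _; apply/val_inj.
rewrite -/(box_seqs q (ok :: oks)) (@count_box_seqs_cons _ _ _ _ _ [:: row_part (size oks)]) //.
  by rewrite big_seq1.
exact: addbox_row.
Qed.

(** The last box either starts the second row, after the only path to a single row, or extends the
    first row, which leaves the case t - 1. *)
Lemma count_hook (oks : seq (pred nat)) t : all (fun ok : pred nat => ok i0.+1) oks ->
  size oks = t.+2 -> count_mem (single_part i0 (hook_part t)) (box_seqs q oks) = t.+1.
Proof.
elim: oks t => // ok oks IH t /andP[hok hoks] [sz].
rewrite (@count_box_seqs_cons _ _ _ _ _ (row_part t.+1 :: (if t is t'.+1 then [:: hook_part t'] else [::]))) //.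
- rewrite big_cons -sz count_row //; case: t sz => [|t] sz; first by rewrite big_nil.
  by rewrite big_seq1 IH // add1n.
- by case: (t) => // t'; rewrite /= inE intpart_eqE eqseq_cons andbF.
- exact: addbox_hook.
Qed.

End CountBoxes.

Lemma prod_split_at (R : comNzRingType) (F : nat -> R) N : (0 < N)%N ->
  \prod_(1 <= i < 2 * N) F i = \prod_(1 <= i < N) F i * F N * \prod_(N.+1 <= i < 2 * N) F i.
Proof.
move=> N0; rewrite (@big_cat_nat _ _ _ N) //=; last by lia.
by rewrite [X in _ * X]big_ltn ?mulrA //; lia.
Qed.

Section QuiverFamily.
Variables (N : nat) (S : seq nat).
Hypotheses (N0 : (0 < N)%N) (hS : letters N.+1 S) (gS : gapped S).

Local Notation q := (2 * N - 1)%N.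

Definition letter_range k : pred nat := fun pos => (k <= pos <= 2 * N - k)%N.

Definition box_count (kap : q.-tuple intpart) : int :=
  (count_mem kap (box_seqs q [seq letter_range k | k <- S]))%:Z.

Lemma hcoef0 (R : comNzRingType) (c d : nat -> R) : c 0%N = 1 -> d 0%N = 1 -> hcoef c d 0 = 1.
Proof.
by move=> c0 d0; have := hcoefP 0 c0 d0; rewrite big_nat1 !expr0 !mul1r c0 mul1r d0.
Qed.

Lemma hcoef1 (R : comNzRingType) (c d : nat -> R) : c 0%N = 1 -> d 0%N = 1 ->
  hcoef c d 1 = c 1%N - d 1%N.
Proof.
move=> c0 d0; have := hcoefP 1 c0 d0; rewrite big_nat_recr //= big_nat1 subnn hcoef0 //.
rewrite expr0 expr1 c0 !mul1r subn0 mulr1 !mulN1r => /(canRL (addrK _)) ->.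
by rewrite opprK addrC.
Qed.

Section Specialization.
Variables (m : nat).
Local Notation L := (N + m)%N.
Let c := cd_var L true.
Let d := cd_var L false.

Definition quiver_top (pos : nat) : nat -> cd_ring L :=
  if (pos < N)%N then d (pos + 1 + m)%N else if pos == N then c (N + m)%N else c (2 * N - pos + m)%N.

Definition quiver_bot (pos : nat) : nat -> cd_ring L :=
  if (pos < N)%N then d (pos + m)%N else if pos == N then d (N + m)%N else c (2 * N - pos + 1 + m)%N.

Definition quiver_h (pos : nat) : nat -> cd_ring L := hcoef (quiver_top pos) (quiver_bot pos).

Lemma schur_diff_jt (R : comNzRingType) (c' d' : nat -> R) al :
  schur_diff c' d' al = jt (hcoef c' d') al.
Proof. by []. Qed.

Lemma quiver_top0 pos : quiver_top pos 0%N = 1.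
Proof. by rewrite /quiver_top; do ?case: ifP. Qed.

Lemma quiver_bot0 pos : quiver_bot pos 0%N = 1.
Proof. by rewrite /quiver_bot; do ?case: ifP. Qed.

Lemma quiver_term_jt (kap : q.-tuple intpart) : quiver_term N m kap = jt_prod quiver_h kap.
Proof.
rewrite /quiver_term /jt_prod.
rewrite (eq_bigr (fun i : 'I_q => jt (quiver_h i.+1) (parts (nth part0 kap i)))) => [|i _]; last first.
  by rewrite (tnth_nth part0).
rewrite -(big_mkord xpredT (fun i => jt (quiver_h i.+1) (parts (nth part0 kap i)))).
have -> : \prod_(0 <= i < q) jt (quiver_h i.+1) (parts (nth part0 kap i)) =
  \prod_(1 <= i < 2 * N) jt (quiver_h i) (parts (nth part0 kap i.-1)).
  by rewrite big_add1 -[(2 * N).-1]subn1.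
have e1 : \prod_(1 <= i < N) jt (quiver_h i) (parts (nth part0 kap i.-1)) =
  \prod_(1 <= i < N) schur_diff (d (i + 1 + m)%N) (d (i + m)%N) (parts (nth part0 kap i.-1)).
  apply: eq_big_nat => i /andP[_ hi]; rewrite schur_diff_jt /quiver_h /quiver_top /quiver_bot hi.
  by [].
have e2 : jt (quiver_h N) (parts (nth part0 kap N.-1)) =
  schur_diff (c (N + m)%N) (d (N + m)%N) (parts (nth part0 kap N.-1)).
  by rewrite schur_diff_jt /quiver_h /quiver_top /quiver_bot ltnn eqxx.
have e3 : \prod_(N.+1 <= i < 2 * N) jt (quiver_h i) (parts (nth part0 kap i.-1)) =
  \prod_(N.+1 <= i < 2 * N) schur_diff (c (2 * N - i + m)%N) (c (2 * N - i + 1 + m)%N)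
     (parts (nth part0 kap i.-1)).
  apply: eq_big_nat => i hi; rewrite schur_diff_jt /quiver_h /quiver_top /quiver_bot.
  have -> : (i < N)%N = false by lia.
  by have -> : (i == N) = false by lia.
rewrite (prod_split_at _ N0).
exact: (esym (congr2 *%R (congr2 *%R e1 e2) e3)).
Qed.

(** Differences of d below position N, of c above it, and the mixed difference at N itself; the
    symmetric range makes both chains stop at index m + k. *)
Lemma quiver_telescope k : (0 < k <= N)%N ->
  \sum_(i < q | letter_range k i.+1) quiver_h i.+1 1%N = c (m + k)%N 1%N - d (m + k)%N 1%N.
Proof.
move=> kN; have E pos : quiver_h pos 1%N = quiver_top pos 1%N - quiver_bot pos 1%N.
  by rewrite /quiver_h hcoef1 ?quiver_top0 ?quiver_bot0.
rewrite -(big_mkord (fun i => letter_range k i.+1) (fun i => quiver_h i.+1 1%N)).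
have -> : \sum_(0 <= i < q | letter_range k i.+1) quiver_h i.+1 1%N =
  \sum_(1 <= i < 2 * N | letter_range k i) quiver_h i 1%N.
  by rewrite big_add1 -[(2 * N).-1]subn1.
have -> : \sum_(1 <= i < 2 * N | letter_range k i) quiver_h i 1%N =
    \sum_(k <= i < (2 * N - k).+1) quiver_h i 1%N.
  have k1 : (1 <= k)%N by lia.
  have k2 : (k <= 2 * N)%N by lia.
  have k3 : (k <= (2 * N - k).+1)%N by lia.
  have k4 : ((2 * N - k).+1 <= 2 * N)%N by lia.
  rewrite (big_cat_nat k1 k2) /=.
  rewrite [X in X + _]big_nat_cond [X in X + _]big_pred0 ?add0r; last first.
    by move=> i; rewrite /letter_range; lia.
  rewrite (big_cat_nat k3 k4) /=.
  rewrite [X in _ + X]big_nat_cond [X in _ + X]big_pred0 ?addr0; last first.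
    by move=> i; rewrite /letter_range; lia.
  rewrite big_nat_cond [RHS]big_nat_cond; apply: eq_bigl => i.
  by rewrite /letter_range; lia.
have k5 : (k <= N)%N by lia.
have k6 : (N <= (2 * N - k).+1)%N by lia.
have k7 : (N < (2 * N - k).+1)%N by lia.
rewrite (big_cat_nat k5 k6) (big_ltn k7) /=.
have -> : \sum_(k <= i < N) quiver_h i 1%N = d (N + m)%N 1%N - d (k + m)%N 1%N.
  rewrite -(telescope_sumr (fun i => d (i + m)%N 1%N)); last by lia.
  apply: eq_big_nat => i /andP[_ iN]; rewrite E /quiver_top /quiver_bot iN.
  by rewrite addn1 addSn.
have -> : \sum_(N.+1 <= i < (2 * N - k).+1) quiver_h i 1%N = c (k + m)%N 1%N - c (N + m)%N 1%N.
  transitivity (\sum_(N.+1 <= i < (2 * N - k).+1)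
     (c (2 * N - i.+1 + 1 + m)%N 1%N - c (2 * N - i + 1 + m)%N 1%N)).
    apply: eq_big_nat => i hi; rewrite E /quiver_top /quiver_bot ltnNge.
    have -> : (N <= i)%N by lia.
    have -> : (i == N) = false by lia.
    by have -> : (2 * N - i.+1 + 1 = 2 * N - i)%N by lia.
  rewrite (telescope_sumr (fun i => c (2 * N - i + 1 + m)%N 1%N)); last by lia.
  have -> : (2 * N - (2 * N - k).+1 + 1 = k)%N by lia.
  by have -> : (2 * N - N.+1 + 1 = N)%N by lia.
rewrite E /quiver_top /quiver_bot ltnn eqxx [(m + k)%N]addnC; ring.
Qed.

End Specialization.

Lemma quiver_family_wperm : quiver_family (wperm N.+1 S) box_count.
Proof.
split=> [kap hk|m].
  rewrite /box_count; congr Posz; apply/eqP; rewrite -leqn0 leqNgt -has_count; apply/negP.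
  move=> /hasP[k' hk' /eqP ek]; move: hk; rewrite -ek => /eqP; apply.
  rewrite ell_wperm // -(size_map letter_range S) -(weight_box_seqs hk') /tuple_weight.
  by rewrite big_tuple.
exists (undup (box_seqs q [seq letter_range k | k <- S])); split; first exact: undup_uniq.
  move=> kap; rewrite mem_undup; apply: contraR => hk; rewrite /box_count.
  by rewrite (count_memPn hk) mul0r.
rewrite one_times_wperm // univ_double_schubert_wperm //; last 3 first.
- exact: letters_shift.
- exact: gapped_shift.
- by rewrite addnS.
rewrite big_map.
transitivity (\sum_(kap <- box_seqs q [seq letter_range k | k <- S]) quiver_term N m kap).
  under [RHS]eq_bigr do rewrite quiver_term_jt.
  rewrite jt_prod_box_seqs => [|i]; last by rewrite /quiver_h hcoef0 ?quiver_top0 ?quiver_bot0.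
  rewrite big_map; apply: eq_big_seq => k /(allP hS) hk.
  by rewrite quiver_telescope.
(* Collecting equal terms turns multiplicities into the coefficients [box_count]. *)
rewrite -big_undup_iterop_count; apply: eq_bigr => kap _.
by rewrite /box_count -pmulrn mulr_natl.
Qed.

End QuiverFamily.

(* For v = s_1 s_3 s_5 .. the double Schubert polynomial of 1^m x v is a product
   of differences c_1(k + m) - d_1(k + m), each of which telescopes into a sum of
   the h_1 at the positions k, .., 2N - k.  Position N lies in all these ranges, so
   by Pieri's rule the coefficient of a sequence concentrated there is the number
   of standard tableaux of its shape; the shape (t + 1, 1) has t + 1 of them. *)
Lemma quiver_coefficient_nat (z : nat) : quiver_coefficient z%:Z.
Proof.
case: z => [|t].
  have hS : letters 2 [::] by []; have gS : gapped [::] by [].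
  (* The value 0: for the identity only the sequence of empty partitions has a nonzero
     coefficient. *)
  exists 1%N, (wperm 2 [::]), [tuple row_part 1 | _ < 1], (box_count [::]).
  split=> //; first exact: (quiver_family_wperm (N := 1)).
  rewrite /box_count /= addn0; congr Posz; apply/esym/eqP; rewrite eqb0.
  by apply/negP => /eqP /(congr1 (fun u => tnth u ord0)); rewrite !tnth_mktuple.
(* The letters 1, 3, .., 2t + 3, as many as the hook (t + 1, 1) has boxes; N exceeds them all. *)
pose S := [seq k.*2.+1 | k <- iota 0 t.+2]; pose N := (t.+2).*2.
have N0 : (0 < N)%N by [].
have hS : letters N.+1 S.
  by apply/allP => _ /mapP[k + ->]; rewrite mem_iota /N; lia.
have gS : gapped S.
  apply/and3P; split.
  - by rewrite map_inj_uniq ?iota_uniq // => k k' []; lia.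
  - by apply/allP => _ /mapP[k _ ->].
  - by apply/allP => _ /mapP[k _ ->]; apply/mapP => -[k' _]; lia.
have hq : (N.-1 < 2 * N - 1)%N by rewrite /N; lia.
(* The 0-based index of position N. *)
pose i0 := Ordinal hq.
have hall : all (fun ok : pred nat => ok i0.+1) [seq letter_range N k | k <- S].
  have ei : nat_of_ord i0 = N.-1 by [].
  rewrite all_map; apply/allP => k /(allP hS) hk; apply/andP.
  by split; move: hk N0; rewrite ei; lia.
have sz : size [seq letter_range N k | k <- S] = t.+2 by rewrite !size_map size_iota.
exists N, (wperm N.+1 S), (single_part i0 (hook_part t)), (box_count S).
split=> //; first exact: quiver_family_wperm.
by rewrite /box_count (count_hook hall sz).
Qed.

(** * Block decomposition of Schubert polynomials *)

Lemma seqprodP (T : eqType) (x0 : T) (rs : seq (seq T)) v :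
  reflect (size v = size rs /\ forall i, (i < size rs)%N -> nth x0 v i \in nth [::] rs i)
    (v \in seqprod rs).
Proof.
apply: (iffP idP) => [hv|[]].
  by split; [exact: size_seqprod hv|move=> i; exact: nth_seqprod].
elim: rs v => [|r rs IH] [|x v] //= [sv] H.
rewrite -[X in _ \in X]/(seqprod (r :: rs)) mem_seqprod_cons (H 0%N) // IH // => i hi.
exact: (H i.+1).
Qed.

Lemma uword_flatten (R : comNzRingType) (B : algType R) (u : nat -> B) (ss : seq (seq nat)) :
  uword u (flatten ss) = \prod_(s <- ss) uword u s.
Proof. by rewrite /uword big_flatten. Qed.

Lemma size_conj_part s : size (conj_part s) = head 0%N s.
Proof. by rewrite size_map size_iota. Qed.

Lemma head_shape (T : tableau) : head 0%N (shape T) = size (head [::] T).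
Proof. by case: T. Qed.

Lemma path_ltn_last b a x : path ltn b a -> x \in a -> (x <= last b a)%N.
Proof.
move=> hpath /splitPr xa; case: xa hpath => a1 a2; rewrite cat_path last_cat /= => /and3P[_ _].
move=> /(order_path_min ltn_trans); case: (lastP a2) => // s z.
by rewrite all_rcons last_rcons => /andP[/ltnW].
Qed.

Section Blocks.
Variables (M n : nat).
Local Notation R := {mpoly int[M]}.
Local Notation u := (umat R n).

(** [reflection_principle] divided by the Vandermonde product: the column lengths of a tableau form
    the conjugate of its shape, so each alternant is that product times a Schur polynomial. *)
Lemma block_schur b b' : (b <= b')%N -> (b' <= M)%N ->
  \prod_(b.+1 <= i < b'.+1) afrom u n b.+1 (xvar M i) =
  \sum_(T <- tabs (b' - b) b.+1 (n - b.+1))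
     schur M b b' (conj_part (shape T)) *: uword u (col_word T).
Proof.
move=> bb' hM; set r := (b' - b)%N; pose y (j : 'I_r) := xvar M (b.+1 + j)%N.
have V0 := vdm_xvar_neq0 b hM; set V := vdm _ _ in V0.
have scaleI (X Y : 'M[R]_#|{perm 'I_n}|.-1.+1) : V *: X = V *: Y -> X = Y.
  move=> /matrixP E; apply/matrixP => i j; have := E i j; rewrite !mxE; exact: mulfI.
(* The Vandermonde identity, as the bialternant formula for the empty partition. *)
have yE : altr y (@stair r) = V.
  have := @altr_schur M b b' [::] isT (leq0n _).
  rewrite [schur _ _ _ _]big_cons big_nil /= big_nil addr0 mulr1 -/V => <-.
  by apply: eq_bigr => s _; congr (_ * _); apply: eq_bigr => j _; rewrite nth_nil addn0.
apply: scaleI.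
have -> : \prod_(b.+1 <= i < b'.+1) afrom u n b.+1 (xvar M i) =
    \prod_(j < r) afrom u n b.+1 (y j).
  rewrite -{1}[b.+1]add0n big_addn subSS big_mkord.
  by apply: eq_bigr => j _; rewrite addnC.
rewrite -{1}yE reflection_principle; first last.
- exact: umat_braid.
- exact: umat_far.
- exact: umat_nil.
rewrite scaler_sumr big_map big_seq [RHS]big_seq; apply: eq_bigr => c hc.
have hsz : (size (conj_part (shape (tab_of c))) <= b' - b)%N.
  by rewrite size_conj_part head_shape; case/and3P: (tab_of_bounded (ltn0Sn b) hc).
have e1 : V * schur M b b' (conj_part (shape (tab_of c))) = altr y (fun j => stair j + size (c j))%N.
  rewrite /V -(altr_schur M (conj_partP _) hsz).
  apply: eq_bigr => s _; congr (_ * _); apply: eq_bigr => j _.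
  by rewrite (conj_shape_tab_of _ hc) nth_col_seq.
have e2 : uword u (col_word (tab_of c)) = \prod_(j < r) uword u (rev (c j)).
  by rewrite (col_word_tab_of hc) uword_flatten big_map enumT [index_enum _]unlock.
by rewrite scalerA e2 e1.
Qed.

Definition block_tabs (bd rd : nat -> nat) p : seq (seq tableau) :=
  [seq tabs (rd i) (bd i).+1 (n - (bd i).+1) | i <- iota 0 p].

Lemma block_prod_schur b a : path ltn b a -> all (fun x => x <= M)%N a ->
  let bd := nth 0%N (b :: a) in
  block_prod u n (xvar M) b a =
  \sum_(Ts <- seqprod (block_tabs bd (fun i => bd i.+1 - bd i)%N (size a)))
    (\prod_(i < size a) schur M (bd i) (bd i.+1) (conj_part (shape (nth [::] Ts i)))) *:
    uword u (flatten [seq col_word T | T <- Ts]).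
Proof.
elim: a b => [|c a IH] b /=.
  by rewrite big_seq1 big_ord0 scale1r /uword big_nil.
move=> /andP[bc hpath] /andP[cM haM].
rewrite block_schur ?(ltnW bc) // IH // mulr_suml.
rewrite [X in _ = \sum_(_ <- X) _](_ : _ = seqprod (tabs (c - b) b.+1 (n - b.+1) ::
  block_tabs (nth 0%N (c :: a)) (fun i => nth 0%N (c :: a) i.+1 - nth 0%N (c :: a) i)%N (size a))); last first.
  by rewrite /block_tabs /= (iotaDl 1 0) -map_comp.
rewrite big_seqprod_cons; apply: eq_bigr => T _.
rewrite mulr_sumr; apply: eq_bigr => Ts _.
rewrite big_ord_recl /= -scalerAl -scalerAr scalerA; congr (_ *: _).
by rewrite /uword big_cat.
Qed.

Variable w : 'S_n.

Lemma wcoef_uword e : wcoef w (uword u e) = (redw w e)%:R.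
Proof. exact: wcoef_word. Qed.

Lemma wcoef_sum I (s : seq I) (F : I -> 'M[R]_#|{perm 'I_n}|.-1.+1) :
  wcoef w (\sum_(i <- s) F i) = \sum_(i <- s) wcoef w (F i).
Proof. exact: entry_sum. Qed.

(** Two corrections are invisible to the coefficient of w: the leftover letters of the blocks, which
    avoid [a], and the factors A_i with i beyond the last bound, whose letters exceed every element
    of [a]. *)
Lemma schubertX_block (a : seq nat) : (n <= M)%N -> path ltn 0 a -> compatible w a ->
  schubertX M w = wcoef w (block_prod u n (xvar M) 0 a).
Proof.
move=> nM hpath wa; rewrite schubertX_wcoef //.
have nd k : k \notin a -> ~~ descent w k.
  by apply: contra => /and3P[_ _]; exact: wa.
have [l -> hl] := block_prod_staircase (@umat_far R n) n (xvar M) hpath.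
rewrite wcoef_hprod_nondescent; last first.
  by apply: sub_all hl => q /andP[_]; exact: nd.
(* The last bound may lie on either side of n; the common range is obtained from trivial factors. *)
rewrite (@stanleyE _ _ (maxn n (last 0%N a).+1)) ?leq_maxl //.
rewrite (@big_cat_nat _ _ _ (last 0%N a).+1) ?leq_maxr //=.
move: (\prod_(1 <= i < _) _) => X; rewrite big_nat_cond.
move: X; apply: (big_ind (fun Y => forall X, wcoef w (X * Y) = wcoef w X)) => [X|Y Y' hY hY' X|i].
- by rewrite mulr1.
- by rewrite mulrA hY' hY.
rewrite andbT => /andP[hi _] X; have [l' + hl'] := afac_hprod u (n - i) i (xvar M i).
rewrite /afrom => ->; apply: wcoef_hprod_nondescent; apply: sub_all hl' => q /andP[hq _].
apply: nd; apply/negP => /(path_ltn_last hpath) hh.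
by have := leq_trans (leq_trans hi hq) hh; rewrite ltnn.
Qed.

End Blocks.

(** * Counting the tableau sequences of given shapes *)

Section Counting.
Variables (n p : nat) (w : 'S_n) (a : p.-tuple nat).

Definition shapes_conj (t : p.-tuple tableau) : p.-tuple intpart :=
  [tuple conjp (shape (tnth t i)) | i < p].

Definition reduced_tabs (rd : nat -> nat) : seq (p.-tuple tableau) :=
  [seq t <- pmap insub (seqprod (block_tabs n (bound a) rd p))
   | redw w (flatten [seq col_word T | T <- tval t])].

Lemma uniq_reduced_tabs rd : uniq (reduced_tabs rd).
Proof.
apply/filter_uniq/pmap_sub_uniq/seqprod_uniq/allP => _ /mapP[i _ ->]; exact: tabs_uniq.
Qed.

Lemma mem_reduced_tabs rd t : (t \in reduced_tabs rd) <->
  (forall i : 'I_p, bounded_tab (rd i) (bound a i).+1 (n - (bound a i).+1) (tnth t i)) /\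
  reduced_word w (flatten [seq col_word T | T <- t]).
Proof.
rewrite mem_filter mem_pmap_sub redwP.
have sb : size (block_tabs n (bound a) rd p) = p by rewrite size_map size_iota.
have nb (i : 'I_p) : nth [::] (block_tabs n (bound a) rd p) i =
    tabs (rd i) (bound a i).+1 (n - (bound a i).+1).
  by rewrite (nth_map 0%N) ?size_iota // nth_iota.
split=> [/andP[h1 /(seqprodP [::])[_ h2]]|[h1 h2]].
  split=> // i; rewrite -mem_tabs // -nb (tnth_nth [::]); apply: h2.
  by rewrite sb.
rewrite h2; apply/(seqprodP [::]); rewrite size_tuple sb; split=> // i hi.
by rewrite (nb (Ordinal hi)) mem_tabs // -(tnth_nth [::] t (Ordinal hi)).
Qed.

Definition tabs_of_shape rd (lam : p.-tuple intpart) : seq (p.-tuple tableau) :=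
  [seq t <- reduced_tabs rd | shapes_conj t == lam].

(** The bounds built into [tabs] lose nothing: the i-th tableau has as many columns as the i-th
    partition has parts, and its entries are letters of a reduced word, hence below n. *)
Lemma mem_tabs_of_shape (rd : nat -> nat) (lam : p.-tuple intpart) t : (forall i : 'I_p, size (tnth lam i) <= rd i)%N ->
  (t \in tabs_of_shape rd lam) <-> counted_tableaux w a lam t.
Proof.
move=> hr; rewrite mem_filter; split.
  case/andP => /eqP hlam /mem_reduced_tabs[hb hred]; split=> // i; have /and3P[h1 h2 _] := hb i.
  - exact: h1.
  - by apply: sub_all h2 => s; apply: sub_all => k /andP[].
  - rewrite -hlam tnth_mktuple /= conj_partK //; by case/and4P: h1.
case=> h1 h2 h3 h4; have hE i : tnth lam i = conjp (shape (tnth t i)).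
  by apply/val_inj; rewrite /= h3 conj_partK // partsP.
apply/andP; split.
  by apply/eqP/eq_from_tnth => i; rewrite tnth_mktuple hE.
apply/mem_reduced_tabs; split=> // i; apply/and3P; split=> //; last first.
  by rewrite -head_shape -size_conj_part; have := hr i; rewrite hE.
have /redwP/and3P[hl _ _] := h4.
apply/(all_nthP [::]) => j hj; apply/(all_nthP 0%N) => k hk.
have hb := all_nthP 0%N (all_nthP [::] (h2 i) j hj) k hk.
set x := nth 0%N _ _ in hb *; have {}hb : (bound a i < x)%N := hb; rewrite hb /=.
suff /(allP hl) : x \in flatten [seq col_word T | T <- t] by move=> /andP[_]; move: hb; lia.
apply/flattenP; exists (col_word (tnth t i)); first by apply/map_f/mem_tnth.
have /and4P[/andP[hs _] _ _ _] := h1 i.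
apply/flattenP; exists (rev (tab_col (tnth t i) k)).
  apply: map_f; rewrite mem_iota /= add0n; apply: leq_trans hk _; exact: size_row_geq.
rewrite mem_rev /x -tab_colP // mem_nth //.
by rewrite tab_colP.
Qed.

End Counting.

Theorem corollary3 (n p M : nat) (w : 'S_n) (a : p.-tuple nat)
    (a_pos : all (leq 1) a) (a_incr : sorted ltn a) (wa : compatible w a)
    (nM : (n <= M)%N) (aM : all (fun x => (x <= M)%N) a) :
  exists c : p.-tuple intpart -> nat,
    is_fsum
      (fun lam => (c lam)%:R *
         \prod_(i < p) schur M (bound a i) (bound a i.+1) (tnth lam i))
      (schubertX M w)
    /\ forall lam : p.-tuple intpart,
         quiver_coefficient (c lam)%:Z
         /\ has_card (counted_tableaux w a lam) (c lam).
Proof.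
pose sz (lam : p.-tuple intpart) i := size (nth part0 lam i).
have szE (lam : p.-tuple intpart) (i : 'I_p) : size (tnth lam i) = sz lam i by rewrite (tnth_nth part0).
(* The column bound comes from [lam] and not from the block sizes, so that [c] counts all sequences,
   also for shapes with more rows than the block has variables. *)
pose c (lam : p.-tuple intpart) := size (tabs_of_shape w a (sz lam) lam).
pose rd i := (bound a i.+1 - bound a i)%N.
have cardE (lam : p.-tuple intpart) : (forall i : 'I_p, size (tnth lam i) <= rd i)%N ->
    size (tabs_of_shape w a rd lam) = c lam.
  move=> hr; apply/perm_size/uniq_perm; try exact/filter_uniq/uniq_reduced_tabs.
  have hr' (i : 'I_p) : (size (tnth lam i) <= sz lam i)%N by rewrite szE.
  by move=> t; apply/idP/idP => /mem_tabs_of_shape h; apply/mem_tabs_of_shape => //; apply: h.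
pose G (lam : p.-tuple intpart) : {mpoly int[M]} :=
  \prod_(i < p) schur M (bound a i) (bound a i.+1) (tnth lam i).
have hpath : path ltn 0%N a.
  by case: (tval a) a_pos a_incr => //= x s /andP[x0 _] hs; rewrite x0.
have schubE : schubertX M w = \sum_(t <- reduced_tabs w a rd) G (shapes_conj t).
  rewrite (schubertX_block nM hpath wa) block_prod_schur // wcoef_sum.
  rewrite -/(bound a) size_tuple.
  have ss : all (fun s => insub s : option (p.-tuple tableau)) (seqprod (block_tabs n (bound a) rd p)).
    apply/allP => s /size_seqprod hs; rewrite insubT //.
    by rewrite hs size_map size_iota.
  rewrite -[X in seqprod X]/(block_tabs n (bound a) rd p) -(all_filterP ss).
  rewrite -(pmap_filter (insubK _)) big_map big_filter.
  rewrite [RHS]big_mkcond; apply: eq_bigr => t _.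
  rewrite wcoefZ wcoef_uword; case: ifP => _; last by rewrite mulr0.
  rewrite mulr1 /G; apply: eq_bigr => i _.
  by rewrite tnth_mktuple (tnth_nth [::]).
exists c; split; last first.
  move=> lam; split; first exact: quiver_coefficient_nat.
  exists (tabs_of_shape w a (sz lam) lam); split=> //.
    exact/filter_uniq/uniq_reduced_tabs.
  by move=> t; apply: mem_tabs_of_shape => i; rewrite szE.
pose shapes := [seq shapes_conj t | t <- reduced_tabs w a rd].
have countE (lam : p.-tuple intpart) : count_mem lam shapes = size (tabs_of_shape w a rd lam).
  by rewrite count_map size_filter.
exists (undup shapes); split; first exact: undup_uniq.
  move=> lam; rewrite mem_undup; apply: contraR => hlam.
  case: (boolP [forall i : 'I_p, (size (tnth lam i) <= rd i)%N]) => [/forallP hr|/forallPn[i]].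
    by rewrite -(cardE _ hr) -countE (count_memPn hlam) mul0r.
  (* Here [c lam] may be nonzero, but the Schur polynomial of block i has too few variables and
     vanishes. *)
  rewrite -ltnNge => hi; rewrite (bigD1 i) //= schur_long ?mul0r ?mulr0 //.
  exact: partsP.
rewrite schubE -(big_map (@shapes_conj p) xpredT G) -/shapes -big_undup_iterop_count.
rewrite big_seq [RHS]big_seq; apply: eq_bigr => lam; rewrite mem_undup => hlam.
rewrite -/(G lam) -cardE ?countE ?mulr_natl // => i; case/mapP: hlam => t /mem_reduced_tabs[hb _] ->.
by rewrite tnth_mktuple /= size_conj_part head_shape; case/and3P: (hb i).
Qed.
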